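(* Let $n,m,T\ge 1$ be integers, let $\phi:\mathbb{R}^n\to\mathbb{R}^m$ and $\bar A\in\mathbb{R}^{n\times m}$ with rows $\bar a_1^T,\dots,\bar a_n^T$, and let $x_{t+1}=\bar A\phi(x_t)+w_t$, $t=0,\dots,T-1$, be a random trajectory in $\mathbb{R}^n$. Let $\mu>0$. Assume the following. 1. (Stability) $\rho:=\|\bar A\|_2$, $\phi$ is $L$-Lipschitz in the Euclidean norm, $\phi(0)=0$, and $\rho L<1$. 2. (Sub-Gaussian disturbance) With $\mathcal{F}_t=\bm{\sigma}\{x_0,\dots,x_t\}$, there is $\sigma>0$ such that $\|x_0^{(i)}\|_{\psi_2}\le\sigma$ and $\|w_t^{(i)}\mid\mathcal{F}_t\|_{\psi_2}\le\sigma$ for all $t\ge 0$ and $i\in\{1,\dots,n\}$. 3. (Persistent zero-mean independent noise) The random vectors $x_0,w_0,w_1,\dots$ are independent, $\mathbb{E}[w_t]=0$ for all $t\ge0$, and $\mathbb{E}[x_0]=0$. 4. (Expected excitation) There is $\lambda>0$ such that $\mathbb{E}[\phi(x_t)\phi(x_t)^T\mid\mathcal{F}_{t-1}]\succeq\lambda^2 I$ for all $t=1,\dots,T$. 5. There is $q>0$ such that $\mathbb{P}(|w_t^{(i)}|\le\frac{\mu}{2})\ge q$ for every $t\ge0$ and $i\in\{1,\dots,n\}$. Assume moreover that at least one of the following holds: (a) $w_t$ has a symmetric distribution for all $t\ge0$; or (b) $\phi(x)=\bar Bx$ for some $\bar B\in\mathbb{R}^{m\times n}$ with $\|\bar B\|_2\le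 L$. Let $\hat a_1,\dots,\hat a_n\in\mathbb{R}^m$ be a minimizer of $$\min_{\{a_i\}_{i=1}^n}\ \sum_{t=0}^{T-1}\sum_{i=1}^n H_\mu\big(x_{t+1}^{(i)}-a_i^T\phi(x_t)\big).$$ Given $\delta\in(0,1)$, when $$T=\Omega\biggl(\frac{n^2L^4\sigma^4}{q^2\lambda^4(1-\rho L)^4}\log^2\Bigl(\frac{mn}{\delta}\Bigr)\log\Bigl(\frac{nL\sigma}{q\lambda(1-\rho L)\delta}\Bigr)\biggr),$$ it holds with probability at least $1-\delta$ that $$\|\bar a_i-\hat a_i\|_2=\mathcal{O}\biggl(\frac{\mu\sqrt{n}L\sigma}{\sqrt{T}\,q\lambda^2(1-\rho L)}\log\Bigl(\frac{n}{\delta}\Bigr)\biggr)\qquad\forall i\in\{1,\dots,n\}.$$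
   Context: For $\mu>0$, the Huber function is $H_\mu(z)=\frac12z^2$ if $|z|\le\mu$ and $H_\mu(z)=\mu|z|-\frac12\mu^2$ if $|z|>\mu$. The superscript $(i)$ denotes the $i$-th coordinate of a vector; $\|\cdot\|_2$ is the Euclidean norm of vectors and the operator norm of matrices; $\bm{\sigma}\{\cdot\}$ is the generated sigma-algebra. The $\psi_2$-norm of a scalar random variable $x$ is $\|x\|_{\psi_2}=\inf\{k>0:\mathbb{E}[\exp(x^2/k^2)]\le e\}$, and $\|x\mid\mathcal{F}\|_{\psi_2}\le\sigma$ means the same with conditional expectation given $\mathcal{F}$, i.e. $\mathbb{E}[\exp(x^2/\sigma^2)\mid\mathcal{F}]\le e$ almost surely. A random vector $w$ has a symmetric distribution if $w$ and $-w$ are identically distributed. $\mathcal{O}(\cdot)$ and $\Omega(\cdot)$ denote upper and lower bounds up to absolute positive constants: the statement means that there are absolute constants $C_1,C_2>0$ such that if $T\ge C_1\cdot(\text{expression inside }\Omega)$, then with the stated probability the error is at most $C_2\cdot(\text{expression inside }\mathcal{O})$.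
   Formalization: For n = 1 the constants C1, C2 may depend on a chosen bound δ0 < 1 and δ ≤ δ0 is required, since absolute constants fail as δ → 1 (log(n/δ) → 0; counterexample n = m = T = 1, x_0 = 0). For n ≥ 2 the constants are absolute and δ ranges over (0,1). *)

(* Defs.v *)
From HB Require Import structures.
From mathcomp Require Import all_boot all_order all_algebra.
From mathcomp Require Import finmap.
From mathcomp Require Import all_classical all_reals all_analysis.

Set Implicit Arguments.
Unset Strict Implicit.
Unset Printing Implicit Defensive.

Import Order.TTheory GRing.Theory Num.Theory.
Import numFieldNormedType.Exports.

Local Open Scope classical_set_scope.
Local Open Scope ring_scope.

Definition mx_display : measure_display -> measure_display.
Proof. exact. Qed.

(* Matrices (hence column vectors) carry the sigma-algebra generated by the
   entries; over the reals this is the Borel sigma-algebra. *)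
Section measurable_matrix.
Context {d} {T : sigmaRingType d} (m n : nat).

Definition mx_measurable : set (set 'M[T]_(m, n)) :=
  <<s \bigcup_ij preimage_set_system setT
        (fun A : 'M[T]_(m, n) => A ij.1 ij.2) measurable >>.

Let mx_set0 : mx_measurable set0.
Proof. exact: sigma_algebra0. Qed.

Let mx_setC A : mx_measurable A -> mx_measurable (~` A).
Proof. exact: sigma_algebraC. Qed.

Let mx_bigcup (F : (set 'M[T]_(m, n))^nat) :
  (forall i, mx_measurable (F i)) -> mx_measurable (\bigcup_i F i).
Proof. exact: sigma_algebra_bigcup. Qed.

HB.instance Definition _ := @isMeasurable.Build (mx_display d)
  'M[T]_(m, n) mx_measurable mx_set0 mx_setC mx_bigcup.

End measurable_matrix.

Section deterministic.
Context {R : realType}.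

Definition huber (mu z : R) : R :=
  if `|z| <= mu then z ^+ 2 / 2 else mu * `|z| - mu ^+ 2 / 2.

(* The library norm on matrices is the maximum norm, so the Euclidean norm is
   defined here. *)
Definition enorm n (v : 'cV[R]_n) : R := Num.sqrt (\sum_i v i ord0 ^+ 2).

Definition opnorm m n (A : 'M[R]_(m, n)) : R :=
  sup [set enorm (A *m v) | v in [set v : 'cV[R]_n | enorm v <= 1]].

Definition elipschitz n m (L : R) (phi : 'cV[R]_n -> 'cV[R]_m) : Prop :=
  forall x y, enorm (phi x - phi y) <= L * enorm (x - y).

Definition loewner_le m (A B : 'M[R]_m) : Prop :=
  forall v : 'cV[R]_m, 0 <= (v^T *m (B - A) *m v) ord0 ord0.

(* The family a lists the rows, as column vectors. *)
Definition huber_loss n m T (mu : R) (phi : 'cV[R]_n -> 'cV[R]_m)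
    (x : nat -> 'cV[R]_n) (a : 'I_n -> 'cV[R]_m) : R :=
  \sum_(0 <= t < T) \sum_(i < n)
    huber mu (x t.+1 i ord0 - ((a i)^T *m phi (x t)) ord0 ord0).

Definition huber_minimizer n m T (mu : R) (phi : 'cV[R]_n -> 'cV[R]_m)
    (x : nat -> 'cV[R]_n) (a : 'I_n -> 'cV[R]_m) : Prop :=
  forall b : 'I_n -> 'cV[R]_m,
    huber_loss T mu phi x a <= huber_loss T mu phi x b.

End deterministic.

Section probabilistic.
Context {d} {Omega : measurableType d} {R : realType}.
Context (P : probability Omega R).

(* Extended-real valued, so that the infimum over the empty set is +oo. *)
Definition psi2_norm (X : Omega -> R) : \bar R :=
  ereal_inf [set k%:E | k in [set k : R | 0 < k /\
    ('E_P[fun om => expR (X om ^+ 2 / k ^+ 2)] <= (expR 1)%:E)%E]].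

(* g is a version of the conditional expectation of f given G. *)
Definition is_cond_expectation (G : set (set Omega)) (f g : Omega -> R) :
    Prop :=
  [/\ P.-integrable setT (EFin \o f),
      P.-integrable setT (EFin \o g),
      preimage_set_system setT g measurable `<=` G &
      forall A, G A ->
        (\int[P]_(om in A) (g om)%:E = \int[P]_(om in A) (f om)%:E)%E].

Definition cond_psi2_norm_le (G : set (set Omega)) (X : Omega -> R)
    (sigma : R) : Prop :=
  exists2 g : Omega -> R,
    is_cond_expectation G (fun om => expR (X om ^+ 2 / sigma ^+ 2)) g &
    {ae P, forall om, g om <= expR 1}.

(* E[Y Y^T | G] >= c I almost surely; M is an entrywise version of the
   conditional expectation. *)
Definition cond_second_moment_ge m (G : set (set Omega))
    (Y : Omega -> 'cV[R]_m) (c : R) : Prop :=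
  exists2 M : Omega -> 'M[R]_m,
    (forall i j, is_cond_expectation G
       (fun om => (Y om *m (Y om)^T) i j) (fun om => M om i j)) &
    {ae P, forall om, loewner_le (c%:M) (M om)}.

Definition natural_filtration n (x : nat -> Omega -> 'cV[R]_n) (t : nat) :
    set (set Omega) :=
  <<s \bigcup_(s in [set s | (s <= t)%N])
        preimage_set_system setT (x s) measurable >>.

(* Mutual independence: the product rule over every finite subfamily. *)
Definition mutually_independent (I : choiceType) n
    (X : I -> Omega -> 'cV[R]_n) : Prop :=
  forall (J : {fset I}) (B : I -> set 'cV[R]_n),
    (forall j, measurable (B j)) ->
    (P (\bigcap_(j in [set` J]) (X j @^-1` B j)) =
      \prod_(j <- J) P (X j @^-1` B j))%E.

Definition symmetric_distribution n (X : Omega -> 'cV[R]_n) : Prop :=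
  forall B : set 'cV[R]_n, measurable B ->
    P (X @^-1` B) = P ((fun om => - X om) @^-1` B).

(* A need not be measurable: it has to contain an event of probability at
   least p. *)
Definition with_probability_ge (p : R) (A : set Omega) : Prop :=
  exists E : set Omega, [/\ measurable E, (p%:E <= P E)%E & E `<=` A].

End probabilistic.

(* Main.v *)
Require Import Defs.
From HB Require Import structures.
From mathcomp Require Import all_boot all_order all_algebra.
From mathcomp Require Import finmap ring lra.
From mathcomp Require Import all_classical all_reals all_analysis.
From mathcomp Require Import measurable_realfun.

Set Implicit Arguments.
Unset Strict Implicit.
Unset Printing Implicit Defensive.

Import Order.TTheory GRing.Theory Num.Theory.
Import numFieldNormedType.Exports.

Local Open Scope classical_set_scope.
Local Open Scope ring_scope.

(** Why the theorem holds.

    Write [kap = 1 - rho * L], [V = n * sigma ^+ 2] and [K2 = L ^+ 2 * V / kap ^+ 2]; the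
    latter is the scale of the squared norms of the features [phi (x t)]. The loss
    splits over the rows. For one row let [D] be the error of the minimizer and
    [clip] the derivative of the Huber function, so that the residuals of the true
    row are the disturbances [w t]. Passing from the true row to the minimizer
    changes the loss at time [t] by at least [- clip (w t) * (D . phi (x t))], by
    convexity ([huber_tangent]). If [w t] is at most [mu / 2] in absolute value,
    there is a quadratic gain on top of this ([huber_curvature]). As the total
    change is nonpositive, [D] is bounded by the quotient of the norm of the
    gradient, the sum of [clip (w t) *: phi (x t)], and the curvature collected at the
    times with a small disturbance ([huber_error]). It remains to see that, with high
    probability, the gradient is of size [mu * sqrt (K2 * T) * log] and the curvature is
    at least of size [q * lambda ^+ 2 * T].

    Both are statements about vector-valued martingales, and both follow from one
    convexity property: since the power series of the hyperbolic cosine [ch] has only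
    even powers and nonnegative coefficients, [ch] is convex in the square of its
    argument. Hence, if a vector [S] is moved by an increment of length at most [b],
    then [ch] of its length grows at most by the factor [expR b - b], up to a term that
    is linear in the increment ([ch_nrmD]). Conditional expectation removes the linear
    term ([ch_martingale_step], [ch_martingale_growth]), and Markov's inequality turns
    a bound on the mean of [ch] into a bound on the length that is logarithmic in the
    probability and free of the dimension.

    Gradient. Let [c t] be the mean of [clip (w t)]. The vectors
    [(clip (w t) - c t) *: phi (x t)] are centred given the past, and their lengths are
    bounded by multiples of the lengths of the features, which are known in advance.
    The contraction [rho * L < 1] bounds the sum of the squared lengths by the energy of
    the inputs ([energy_balance]), which is of order [V * T] because the inputs are
    sub-Gaussian ([energy_exp]); this gives [centered_exp]. The rest, the sum of
    [c t *: phi (x t)], vanishes under symmetric laws because [clip] is odd. If [phi] is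
    linear, it is a linear function of the independent inputs, in which each input has
    a coefficient of size [mu * L / kap] ([tail_mx_bound]), and the same potential
    applies ([drift_exp]).

    Curvature. Given the past, the outer product of the feature with itself has a mean
    of at least [lambda ^+ 2], and it is counted with probability at least [q],
    independently of the feature. The deviation from the mean is a martingale for
    the Frobenius norm. Its increments are controlled by looking at odd times only,
    and only at those whose preceding even time has a state of moderate size: the
    feature is then bounded in terms of the last disturbance ([outer_bound]), which has
    an exponential moment, and so is its conditional second moment ([M_bound]). This
    yields [excitation_exp]. By the energy bound a positive fraction of the times is
    kept ([moderate_count]).

    The quadratic gain is available along the whole segment up to the error radius if
    the largest feature times this radius is at most [mu / 2] ([feature_radius]). The
    largest feature involves [ln T]; the last logarithm in the sample size absorbs it
    ([sample_ge_max]). The number [m] of unknowns per row is dominated by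
    [K2 / lambda ^+ 2], as the trace of the excitation shows ([excitation_le_features]). *)

(** * Hyperbolic cosine *)

Section hyperbolic.
Context {R : realType}.
Implicit Types a b u x p q t : R.

Definition ch x : R := (expR x + expR (- x)) / 2.
Definition sh x : R := (expR x - expR (- x)) / 2.

Lemma chN x : ch (- x) = ch x.
Proof. by rewrite /ch opprK addrC. Qed.

Lemma ch_norm x : ch `|x| = ch x.
Proof. by case: (ger0P x) => _; rewrite ?chN. Qed.

Lemma ch_gt0 x : 0 < ch x.
Proof. by rewrite divr_gt0// addr_gt0// expR_gt0. Qed.

Lemma ch_ge0 x : 0 <= ch x. Proof. exact/ltW/ch_gt0. Qed.

Lemma ch0 : ch 0 = 1.
Proof. by rewrite /ch oppr0 expR0; lra. Qed.

Lemma sh_ge0 x : 0 <= x -> 0 <= sh x.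
Proof.
move=> x0; rewrite divr_ge0// subr_ge0 ler_expR; lra.
Qed.

Lemma sh_le_ch x : sh x <= ch x.
Proof. by rewrite /sh /ch; have := expR_gt0 (- x); lra. Qed.

Lemma expR_le_2ch x : expR x <= 2 * ch x.
Proof. by rewrite /ch; have := expR_gt0 (- x); lra. Qed.

Lemma ch_sqrt_series p : 0 <= p ->
  (fun N : nat => \sum_(0 <= k < N) p ^+ k / ((2 * k)`!)%:R) @ \oo
    --> ch (Num.sqrt p).
Proof.
move=> p0; set x := Num.sqrt p.
have double N : series (exp_coeff x) (2 * N)%N + series (exp_coeff (- x)) (2 * N)%N
    = 2 * \sum_(0 <= k < N) p ^+ k / ((2 * k)`!)%:R.
  rewrite /series /=; elim: N => [|N IH]; first by rewrite muln0 !big_nil; lra.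
  rewrite mulnS !addSn add0n !big_nat_recr//= mulrDr -IH /exp_coeff/=.
  have -> : (- x) ^+ (2 * N) = p ^+ N by rewrite exprM sqrrN sqr_sqrtr.
  have -> : x ^+ (2 * N) = p ^+ N by rewrite exprM sqr_sqrtr.
  have -> : (- x) ^+ (2 * N).+1 = - x ^+ (2 * N).+1.
    by rewrite !exprS !exprM sqrrN mulNr.
  lra.
have cv (y : R) : (fun N => series (exp_coeff y) (2 * N)%N) @ \oo --> expR y.
  apply: (@cvg_comp _ _ _ (fun N => (2 * N)%N) (series (exp_coeff y)) _ \oo).
    apply/cvgnyPge => A; near=> N.
    by rewrite (leq_trans _ (leq_pmull N (isT : 0 < 2)%N))//; near: N; exact: nbhs_infty_ge.
  exact: is_cvg_series_exp_coeff.
have := cvgM (cvg_cst (2^-1 : R)) (cvgD (cv x) (cv (- x))).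
rewrite /ch mulrC (_ : _ \* _ =
  (fun N => \sum_(0 <= k < N) p ^+ k / ((2 * k)`!)%:R)).
  by apply.
apply/funext => N /=; rewrite [X in _ * X]double mulrA mulVf ?mul1r//.
Unshelve. all: by end_near. Qed.

Lemma exprn_convex t p q k : 0 <= t <= 1 -> 0 <= p -> 0 <= q ->
  ((1 - t) * p + t * q) ^+ k <= (1 - t) * p ^+ k + t * q ^+ k.
Proof.
move=> /andP[t0 t1] p0 q0; elim: k => [|k IH]; first by rewrite !expr0; lra.
have s0 : 0 <= (1 - t) * p + t * q by rewrite addr_ge0// mulr_ge0//; lra.
rewrite exprS; apply: (le_trans (ler_wpM2l s0 IH)); rewrite -subr_ge0 !exprS.
have -> : (1 - t) * (p * p ^+ k) + t * (q * q ^+ k) -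
  ((1 - t) * p + t * q) * ((1 - t) * p ^+ k + t * q ^+ k) =
  t * (1 - t) * ((p - q) * (p ^+ k - q ^+ k)) by ring.
apply: mulr_ge0; first by rewrite mulr_ge0//; lra.
have [pq|/ltW qp] := leP p q.
  by rewrite mulr_le0// subr_le0// lerXn2r.
by rewrite mulr_ge0// subr_ge0// lerXn2r.
Qed.

(** The power series of [ch] only has even powers with nonnegative
    coefficients, so [ch] is convex as a function of the square of its
    argument. *)
Lemma ch_sqrt_convex t p q : 0 <= t <= 1 -> 0 <= p -> 0 <= q ->
  ch (Num.sqrt ((1 - t) * p + t * q)) <=
  (1 - t) * ch (Num.sqrt p) + t * ch (Num.sqrt q).
Proof.
move=> t01 p0 q0; have /andP[t0 t1] := t01.
have s0 : 0 <= (1 - t) * p + t * q by rewrite addr_ge0// mulr_ge0//; lra.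
have c1 := ch_sqrt_series s0.
have c2 := cvgD (cvgM (cvg_cst (1 - t)) (ch_sqrt_series p0))
                (cvgM (cvg_cst t) (ch_sqrt_series q0)).
have F : Filter (\oo : set_system nat) by exact: _.
refine (ler_cvg_to c1 (c2 F F F F F) _); near=> N.
rewrite fctE /= !mulr_sumr -big_split/=; apply: ler_sum => k _.
by rewrite !mulrA -mulrDl ler_pM2r ?invr_gt0 ?ltr0n ?fact_gt0// exprn_convex.
Unshelve. all: by end_near. Qed.

(** Interpolating between the two extreme positions [|a + b|] and [|a - b|]
    of two vectors of lengths [a] and [b] whose angle has cosine [u]. *)
Lemma ch_angle a b u : 0 <= a -> 0 <= b -> -1 <= u <= 1 ->
  ch (Num.sqrt (a ^+ 2 + 2 * (a * b * u) + b ^+ 2)) <=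
  ch a * ch b + u * (sh a * sh b).
Proof.
move=> a0 b0 /andP[u0 u1].
have t01 : 0 <= (1 + u) / 2 <= 1 by lra.
have := ch_sqrt_convex t01 (sqr_ge0 (a - b)) (sqr_ge0 (a + b)).
rewrite !sqrtr_sqr !ch_norm.
have -> : (1 - (1 + u) / 2) * (a - b) ^+ 2 + (1 + u) / 2 * (a + b) ^+ 2 =
  a ^+ 2 + 2 * (a * b * u) + b ^+ 2 by field.
move=> /le_trans; apply.
rewrite /ch /sh !opprD !opprK !expRD le_eqVlt; apply/orP; left; apply/eqP.
by field.
Qed.

(** With [e = expR (x / 2) >= 1 + x / 2] this reduces to
    [2 * x <= (1 + x / 2) ^+ 2], that is to [0 <= (x / 2 - 1) ^+ 2]. *)
Lemma expR_sub_ge x : x <= expR x - x.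
Proof.
have h : expR x = expR (x / 2) ^+ 2 by rewrite expr2 -expRD -splitr.
rewrite h; have := expR_ge1Dx (x / 2); set e := expR _ => he.
have [|] := leP 0 (1 + x / 2) => h1; last by have := sqr_ge0 e; lra.
have : (1 + x / 2) ^+ 2 <= e ^+ 2 by rewrite lerXn2r// nnegrE; lra.
by have := sqr_ge0 (x / 2 - 1); lra.
Qed.

Lemma expR_sub_ge0 x : 0 <= expR x - x.
Proof. by have := expR_ge1Dx x; lra. Qed.

Lemma sh_ge_id b : 0 <= b -> b <= sh b.
Proof.
move=> b0; rewrite /sh.
pose f (x : R) := expR x - expR (- x) - 2 * x.
have df (x : R) : is_derive x (1 : R) f (expR x + expR (- x) - 2).
  rewrite /f; apply: is_derive_eq.
  rewrite /GRing.scale /=; ring.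
suff : f 0 <= f b by rewrite /f oppr0 expR0; lra.
have dd (x : R) : derivable f x 1 by apply: ex_derive.
have cf : continuous f.
  by move=> x; apply: differentiable_continuous; apply/derivable1_diffP.
apply: (@ger0_derive1_le_cc _ f 0 b) => //; rewrite ?in_itv/= ?lexx ?b0//.
  move=> x _; rewrite derive1E derive_val.
  have := expR_gt0 x; have := expR_gt0 (- x); have := expRxMexpNx_1 x.
  set e := expR x; set g := expR (- x) => eg g0 e0.
  have := sqr_ge0 (e - 1); nra.
exact: continuous_subspaceT.
Qed.

(** One step of the potential [ch]: after removing the part that is linear in
    the increment, the growth factor only depends on the length [b] of the
    increment. *)
Lemma ch_step a b u : 0 <= a -> 0 <= b -> -1 <= u <= 1 ->
  ch (Num.sqrt (a ^+ 2 + 2 * (a * b * u) + b ^+ 2)) <=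
  ch a * (expR b - b) + u * b * sh a.
Proof.
move=> a0 b0 u1; apply: (le_trans (ch_angle a0 b0 u1)).
have -> : expR b = ch b + sh b by rewrite /ch /sh; field.
have := sh_le_ch a; have := sh_ge0 a0; have := sh_ge_id b0.
move: (ch a) (ch b) (sh a) (sh b) => A B C D h1 h2 h3.
have : u * (C * (D - b)) <= A * (D - b).
  apply: (@le_trans _ _ (1 * (C * (D - b)))).
    by rewrite ler_wpM2r ?mulr_ge0//; lra.
  by rewrite mul1r ler_wpM2r//; lra.
lra.
Qed.

(** From [1 - b / 2 <= expR (- (b / 2))], squared and inverted. *)
Lemma expR_le_quad b : 0 <= b <= 1 -> expR b <= 1 + b + 2 * b ^+ 2.
Proof.
move=> /andP[b0 b1].
have h : expR b = expR (b / 2) ^+ 2 by rewrite expr2 -expRD -splitr.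
have h1 : 1 - b / 2 <= expR (- (b / 2)) by rewrite expR_ge1Dx.
have := expRxMexpNx_1 (b / 2); move: (expR (- (b / 2))) (expR (b / 2)) (expR_gt0 (b / 2)) h h1.
move=> g e e0 -> h1 eg.
have he : e * (1 - b / 2) <= 1 by rewrite -[leRHS]eg ler_pM2l.
have he2 : e ^+ 2 * (1 - b / 2) ^+ 2 <= 1.
  by rewrite -exprMn expr_le1//; apply: mulr_ge0; lra.
have c : 1 <= (1 + b + 2 * b ^+ 2) * (1 - b / 2) ^+ 2.
  have -> : (1 + b + 2 * b ^+ 2) * (1 - b / 2) ^+ 2 =
    1 + b ^+ 2 * ((1 - b) * (5 / 4 - b / 2)) by field.
  by rewrite lerDl mulr_ge0 ?sqr_ge0// mulr_ge0; lra.
have := le_trans he2 c; rewrite ler_pM2r//.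
by rewrite exprn_gt0//; lra.
Qed.

(** The growth factor of [ch_step] is of second order in [b] for small [b] and
    at most exponential for large [b]; the Gaussian majorant covers both. *)
Lemma expR_sub_le_sqr b : 0 <= b -> expR b - b <= expR (2 * b ^+ 2).
Proof.
move=> b0; have [b1|b1] := leP b 1.
  have := expR_le_quad (introT andP (conj b0 b1)).
  have := expR_ge1Dx (2 * b ^+ 2); lra.
apply: (@le_trans _ _ (expR b)); first by lra.
by rewrite ler_expR; nra.
Qed.

Lemma expR_sub_le_1D b : 0 <= b -> expR b - b <= 1 + 2 * b ^+ 2 * expR b.
Proof.
move=> b0; have [b1|b1] := leP b 1.
  have := expR_le_quad (introT andP (conj b0 b1)).
  have := expR_ge1Dx b; have : 0 <= 2 * b ^+ 2 by rewrite mulr_ge0 ?sqr_ge0.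
  nra.
have : 1 * expR b <= 2 * b ^+ 2 * expR b.
  by rewrite ler_pM2r ?expR_gt0//; nra.
lra.
Qed.

End hyperbolic.

(** * Euclidean norms *)

(** Vectors and matrices are both treated as functions on a finite index type,
    so that [nrm] is the Euclidean norm of the former and the Frobenius norm of
    the latter. *)
Section euclidean.
Context {R : realType} {I : finType}.
Implicit Types f g : I -> R.

Definition dot f g : R := \sum_i f i * g i.
Definition nrm f : R := Num.sqrt (\sum_i f i ^+ 2).

Lemma sum_sqr_ge0 f : 0 <= \sum_i f i ^+ 2.
Proof. by apply: sumr_ge0 => i _; exact: sqr_ge0. Qed.

Lemma nrm_ge0 f : 0 <= nrm f. Proof. exact: sqrtr_ge0. Qed.

Lemma sqr_nrm f : nrm f ^+ 2 = \sum_i f i ^+ 2.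
Proof. by rewrite sqr_sqrtr// sum_sqr_ge0. Qed.

Lemma cauchy_schwarz f g : `|dot f g| <= nrm f * nrm g.
Proof.
rewrite -(@ler_pXn2r _ 2)// ?nnegrE ?mulr_ge0 ?nrm_ge0//.
rewrite exprMn !sqr_nrm real_normK ?num_real//.
have : 0 <= \sum_i \sum_j (f i * g j - f j * g i) ^+ 2.
  by apply: sumr_ge0 => i _; apply: sumr_ge0 => j _; exact: sqr_ge0.
have -> : \sum_i \sum_j (f i * g j - f j * g i) ^+ 2 =
  2 * ((\sum_i f i ^+ 2) * (\sum_i g i ^+ 2) - dot f g ^+ 2).
  transitivity (\sum_i \sum_j (f i ^+ 2 * g j ^+ 2 + f j ^+ 2 * g i ^+ 2
      - 2 * ((f i * g i) * (f j * g j)))).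
    by apply: eq_bigr => i _; apply: eq_bigr => j _; ring.
  under eq_bigr do rewrite sumrB big_split/=.
  rewrite sumrB big_split/= [X in _ + X - _]exchange_big/=.
  have e1 : \sum_i \sum_j f i ^+ 2 * g j ^+ 2
      = (\sum_i f i ^+ 2) * (\sum_i g i ^+ 2).
    by rewrite mulr_suml; apply: eq_bigr => i _; rewrite mulr_sumr.
  have e2 : \sum_i \sum_j 2 * (f i * g i * (f j * g j)) = 2 * dot f g ^+ 2.
    rewrite /dot expr2 mulr_suml mulr_sumr; apply: eq_bigr => i _.
    by rewrite -mulr_sumr -mulr_sumr.
  rewrite !e1 e2; ring.
lra.
Qed.

Lemma nrm_sqrD f g :
  nrm (fun i => f i + g i) ^+ 2 = nrm f ^+ 2 + 2 * dot f g + nrm g ^+ 2.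
Proof.
rewrite !sqr_nrm /dot mulr_sumr -!big_split/=.
by apply: eq_bigr => i _; ring.
Qed.

Lemma nrmD f g : nrm (fun i => f i + g i) <= nrm f + nrm g.
Proof.
rewrite -(@ler_pXn2r _ 2)// ?nnegrE ?addr_ge0 ?nrm_ge0// nrm_sqrD.
have := cauchy_schwarz f g; have := ler_norm (dot f g); nra.
Qed.

Lemma nrmZ (c : R) f : nrm (fun i => c * f i) = `|c| * nrm f.
Proof.
rewrite /nrm -sqrtr_sqr -sqrtrM ?sqr_ge0// mulr_sumr; congr Num.sqrt.
by apply: eq_bigr => i _; rewrite exprMn.
Qed.

Lemma nrm_eq f g : f =1 g -> nrm f = nrm g.
Proof. by move=> fg; congr Num.sqrt; apply: eq_bigr => i _; rewrite fg. Qed.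

Lemma nrm0 : nrm (fun _ => 0) = 0.
Proof. by rewrite /nrm big1 ?sqrtr0// => i _; rewrite expr0n. Qed.

Lemma le_coord_nrm f i : `|f i| <= nrm f.
Proof.
rewrite -(@ler_pXn2r _ 2)// ?nnegrE ?nrm_ge0// sqr_nrm.
rewrite real_normK ?num_real// (bigD1 i)//= lerDl.
by apply: sumr_ge0 => j _; exact: sqr_ge0.
Qed.

(** The partial derivative of [ch (nrm f)] in the coordinate [i]; at the origin
    the convention [0^-1 = 0] gives the value [0]. *)
Definition ch_slope f i : R := f i * (sh (nrm f) / nrm f).

Lemma ch_slope_le f i : `|ch_slope f i| <= ch (nrm f).
Proof.
rewrite /ch_slope; have [->|n0] := eqVneq (nrm f) 0.
  by rewrite invr0 !mulr0 normr0 ch_ge0.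
rewrite normrM (ger0_norm (divr_ge0 (sh_ge0 (nrm_ge0 f)) (nrm_ge0 f))).
apply: (@le_trans _ _ (nrm f * (sh (nrm f) / nrm f))).
  by rewrite ler_wpM2r ?le_coord_nrm// divr_ge0 ?sh_ge0 ?nrm_ge0.
by rewrite mulrC divfK// sh_le_ch.
Qed.

(** [ch_step] with [u] the cosine of the angle between [f] and [g]. The linear
    term is kept because it disappears in conditional mean; the remaining factor
    increases with [b], so that [b] may be any bound on the length of [g]. *)
Lemma ch_nrmD f g b : nrm g <= b ->
  ch (nrm (fun i => f i + g i)) <=
  ch (nrm f) * (expR b - b) + \sum_i ch_slope f i * g i.
Proof.
move=> gb.
have mono : expR (nrm g) - nrm g <= expR b - b.
  have -> : expR b = expR (nrm g) * expR (b - nrm g).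
    by rewrite -expRD subrKC.
  have h1 : 1 <= expR (nrm g).
    by have := expR_ge1Dx (nrm g); have := nrm_ge0 g; lra.
  have h2 := expR_ge1Dx (b - nrm g).
  have : 0 <= (expR (nrm g) - 1) * (b - nrm g) by rewrite mulr_ge0//; lra.
  have : expR (nrm g) * (1 + (b - nrm g)) <= expR (nrm g) * expR (b - nrm g).
    by rewrite ler_wpM2l// expR_ge0.
  lra.
apply: (@le_trans _ _ (ch (nrm f) * (expR (nrm g) - nrm g)
    + \sum_i ch_slope f i * g i)); last first.
  by rewrite lerD2r ler_wpM2l// ch_ge0.
have slope : \sum_i ch_slope f i * g i = dot f g * (sh (nrm f) / nrm f).
  by rewrite /dot mulr_suml; apply: eq_bigr => i _; rewrite /ch_slope; ring.
have norm_add : nrm (fun i => f i + g i) =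
    Num.sqrt (nrm f ^+ 2 + 2 * dot f g + nrm g ^+ 2).
  by rewrite -nrm_sqrD sqrtr_sqr ger0_norm// nrm_ge0.
have cs := cauchy_schwarz f g.
have [n0|n0] := eqVneq (nrm f * nrm g) 0.
  have d0 : dot f g = 0.
    by apply/eqP; rewrite -normr_eq0 eq_le normr_ge0 -n0 cs.
  have u01 : -1 <= (0 : R) <= 1 by lra.
  have := ch_step (nrm_ge0 f) (nrm_ge0 g) u01.
  by rewrite norm_add slope d0 !mulr0 !mul0r.
have f0 : 0 < nrm f by rewrite lt0r nrm_ge0 andbT; apply: contraNneq n0 => ->; rewrite mul0r.
have g0 : 0 < nrm g by rewrite lt0r nrm_ge0 andbT; apply: contraNneq n0 => ->; rewrite mulr0.
set u := dot f g / (nrm f * nrm g).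
have u1 : -1 <= u <= 1.
  by rewrite -ler_norml normrM normfV (ger0_norm (mulr_ge0 (ltW f0) (ltW g0)))
    ler_pdivrMr ?mulr_gt0// mul1r.
have := ch_step (nrm_ge0 f) (nrm_ge0 g) u1.
have -> : nrm f * nrm g * u = dot f g by rewrite /u mulrC divfK.
rewrite norm_add slope => /le_trans; apply; rewrite lerD2l le_eqVlt; apply/orP; left.
by apply/eqP; rewrite /u; field; rewrite !gt_eqF.
Qed.

End euclidean.

Lemma nrm_outer {R : realType} (I : finType) (f : I -> R) :
  nrm (fun ij : I * I => f ij.1 * f ij.2) = nrm f ^+ 2.
Proof.
rewrite /nrm sqr_sqrtr ?sum_sqr_ge0//.
have -> : \sum_(ij : I * I) (f ij.1 * f ij.2) ^+ 2 = (\sum_i f i ^+ 2) ^+ 2.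
  rewrite expr2 mulr_suml.
  under [RHS]eq_bigr do rewrite mulr_sumr.
  rewrite pair_big/=; apply: eq_bigr => -[i j] _ /=; ring.
by rewrite sqrtr_sqr ger0_norm// sum_sqr_ge0.
Qed.

Section matrix_norms.
Context {R : realType}.

Lemma enormE n (v : 'cV[R]_n) : enorm v = nrm (fun i => v i ord0).
Proof. by []. Qed.

Lemma enorm_ge0 n (v : 'cV[R]_n) : 0 <= enorm v.
Proof. exact: nrm_ge0. Qed.

Lemma enorm0 n : enorm (0 : 'cV[R]_n) = 0.
Proof. by rewrite enormE -[RHS](@nrm0 R 'I_n); apply: nrm_eq => i; rewrite mxE. Qed.

Lemma enormD n (u v : 'cV[R]_n) : enorm (u + v) <= enorm u + enorm v.
Proof.
rewrite !enormE; apply: le_trans (nrmD _ _).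
by rewrite (nrm_eq (g := fun i => u i ord0 + v i ord0))// => i; rewrite mxE.
Qed.

Lemma enormZ n c (v : 'cV[R]_n) : enorm (c *: v) = `|c| * enorm v.
Proof. by rewrite !enormE -nrmZ; apply: nrm_eq => i; rewrite mxE. Qed.

Lemma enorm_eq0 n (v : 'cV[R]_n) : enorm v = 0 -> v = 0.
Proof.
move=> v0; apply/colP => i; rewrite mxE; apply/eqP.
by rewrite -normr_eq0 eq_le normr_ge0 andbT -v0 enormE (le_coord_nrm (fun i => v i ord0)).
Qed.

Lemma enorm_sum_abs n (v : 'cV[R]_n) : enorm v <= \sum_i `|v i ord0|.
Proof.
have s0 : 0 <= \sum_i `|v i ord0| by apply: sumr_ge0.
rewrite -(@ler_pXn2r _ 2)// ?nnegrE ?enorm_ge0// enormE sqr_nrm.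
rewrite [leRHS]expr2 mulr_suml; apply: ler_sum => i _.
rewrite -(@real_normK _ (v i ord0)) ?num_real// expr2 ler_wpM2l//.
by rewrite (bigD1 i)//= lerDl; apply: sumr_ge0.
Qed.

Lemma enorm_mulmx_frobenius m n (A : 'M[R]_(m, n)) (v : 'cV[R]_n) :
  enorm (A *m v) <= nrm (fun i => nrm (fun j => A i j)) * enorm v.
Proof.
rewrite mulrC -[X in X * _](ger0_norm (enorm_ge0 v)) -nrmZ /enorm /nrm ler_wsqrtr//.
apply: ler_sum => i _; rewrite mxE.
have cs := cauchy_schwarz (fun j => A i j) (fun j => v j ord0).
rewrite -[leLHS]real_normK ?num_real// lerXn2r ?nnegrE ?mulr_ge0 ?nrm_ge0//.
by rewrite mulrC.
Qed.

Lemma opnorm_has_ubound m n (A : 'M[R]_(m, n)) :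
  has_ubound [set enorm (A *m v) | v in [set v : 'cV[R]_n | enorm v <= 1]].
Proof.
exists (nrm (fun i => nrm (fun j => A i j))) => _ [u /= u1 <-].
apply: le_trans (enorm_mulmx_frobenius A u) _.
by rewrite ler_piMr ?nrm_ge0.
Qed.

Lemma enorm_mulmx m n (A : 'M[R]_(m, n)) (v : 'cV[R]_n) :
  enorm (A *m v) <= opnorm A * enorm v.
Proof.
have [v0|v0] := eqVneq (enorm v) 0.
  by rewrite v0 mulr0 (enorm_eq0 v0) mulmx0 enorm0.
have vp : 0 < enorm v by rewrite lt0r v0 enorm_ge0.
rewrite -ler_pdivrMr//; apply: (ub_le_sup (opnorm_has_ubound A)).
exists ((enorm v)^-1 *: v) => /=.
  by rewrite enormZ ger0_norm ?invr_ge0 ?enorm_ge0// mulVf.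
by rewrite -scalemxAr enormZ ger0_norm ?invr_ge0 ?enorm_ge0// mulrC.
Qed.

Lemma opnorm_ge0 m n (A : 'M[R]_(m, n)) : 0 <= opnorm A.
Proof.
apply: (ub_le_sup (opnorm_has_ubound A)); exists 0 => /=; first by rewrite enorm0 ler01.
by rewrite mulmx0 enorm0.
Qed.

End matrix_norms.

(** * The Huber function *)

Section huber.
Context {R : realType}.
Implicit Types mu w z t : R.

(** The derivative of the Huber function. *)
Definition clip mu w : R := Num.max (- mu) (Num.min w mu).

Lemma clip_id mu w : `|w| <= mu -> clip mu w = w.
Proof.
rewrite ler_norml => /andP[h1 h2].
by rewrite /clip (min_idPl h2) (max_idPr h1).
Qed.

Lemma clip_ge mu w : 0 < mu -> mu <= w -> clip mu w = mu.
Proof.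
move=> m0 h; rewrite /clip (min_idPr h); apply/max_idPr; lra.
Qed.

Lemma clip_le mu w : 0 < mu -> w <= - mu -> clip mu w = - mu.
Proof.
move=> m0 h; have h' : w <= mu by lra.
by rewrite /clip (min_idPl h'); apply/max_idPl.
Qed.

Lemma clipN mu w : 0 < mu -> clip mu (- w) = - clip mu w.
Proof.
move=> m0; have [h|h] := leP `|w| mu; first by rewrite !clip_id ?normrN.
have [w0|w0] := leP 0 w.
  rewrite ger0_norm// in h.
  by rewrite clip_le ?clip_ge//; lra.
rewrite ltr0_norm// in h.
by rewrite clip_ge ?clip_le ?opprK//; lra.
Qed.

Lemma clip_bound mu w : 0 < mu -> `|clip mu w| <= mu.
Proof.
move=> m0; have [h|h] := leP `|w| mu; first by rewrite clip_id.
have [w0|w0] := leP 0 w.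
  rewrite ger0_norm// in h.
  by rewrite clip_ge ?gtr0_norm//; lra.
rewrite ltr0_norm// in h.
by rewrite clip_le ?normrN ?gtr0_norm//; lra.
Qed.

Lemma huber_big mu z : 0 < mu -> mu <= z -> huber mu z = mu * z - mu ^+ 2 / 2.
Proof.
move=> m0 h; rewrite /huber ger0_norm; last lra.
case: ifPn => // h'; have -> : z = mu by lra.
by field.
Qed.

Lemma huber_small mu z : `|z| <= mu -> huber mu z = z ^+ 2 / 2.
Proof. by rewrite /huber => ->. Qed.

Lemma huberN mu z : huber mu (- z) = huber mu z.
Proof. by rewrite /huber normrN sqrrN. Qed.

Lemma huber_bigN mu z : 0 < mu -> z <= - mu ->
  huber mu z = - mu * z - mu ^+ 2 / 2.
Proof. by move=> m0 h; rewrite -huberN huber_big//; lra. Qed.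

(** Convexity, [clip] being the derivative. *)
Lemma huber_tangent mu w z : 0 < mu ->
  0 <= huber mu (w - z) - huber mu w + clip mu w * z.
Proof.
move=> m0.
have cas (y : R) : [\/ `|y| <= mu, mu <= y | y <= - mu].
  have [h|h] := leP `|y| mu; first by constructor 1.
  have [y0|y0] := leP 0 y.
    by constructor 2; rewrite ger0_norm// in h; exact: ltW.
  by constructor 3; rewrite ltr0_norm// in h; lra.
case: (cas w) => hw; case: (cas (w - z)) => hz;
  rewrite ?(huber_small hw) ?(huber_small hz) ?(huber_big m0 hw)
   ?(huber_big m0 hz) ?(huber_bigN m0 hw) ?(huber_bigN m0 hz)
   ?(clip_id hw) ?(clip_ge m0 hw) ?(clip_le m0 hw);
  rewrite ?ler_norml in hw; rewrite ?ler_norml in hz;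
  try (case/andP: hw => hw1 hw2); try (case/andP: hz => hz1 hz2); try nra.
Qed.

(** Between [- mu] and [mu] the Huber function is a parabola. By convexity the gain over
    the tangent grows at least linearly once the parabola is left, which is why
    it is compared with a fraction [t] of the quadratic gain, [t * z] being
    short enough to stay within the parabola. *)
Lemma huber_curvature mu w z t : 0 < mu -> `|w| <= mu / 2 ->
  0 <= t <= 1 -> `|t * z| <= mu / 2 ->
  t * z ^+ 2 / 2 <= huber mu (w - z) - huber mu w + clip mu w * z.
Proof.
move=> m0.
have main (w' z' : R) : `|w'| <= mu / 2 -> 0 <= t <= 1 -> `|t * z'| <= mu / 2 ->
    0 <= z' ->
    t * z' ^+ 2 / 2 <= huber mu (w' - z') - huber mu w' + clip mu w' * z'.
  move=> hw /andP[t0 t1] ht z0.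
  have hw' : `|w'| <= mu by lra.
  rewrite (huber_small hw') (clip_id hw').
  move: hw ht; rewrite !ler_norml => /andP[w1 w2] /andP[t2 t3].
  have [h|h] := leP `|w' - z'| mu.
    rewrite (huber_small h).
    have := sqr_ge0 z'; nra.
  have h' : w' - z' <= - mu.
    have [p|p] := leP 0 (w' - z'); first by rewrite ger0_norm// in h; lra.
    by rewrite ltr0_norm// in h; lra.
  rewrite huber_bigN//.
  have h3 : t * z' ^+ 2 <= mu / 2 * z' by nra.
  have : 0 <= (z' - (mu + w')) * (mu + w') by rewrite mulr_ge0//; lra.
  have : mu / 2 * z' <= (mu + w') * z' by rewrite ler_wpM2r//; lra.
  lra.
move=> hw ht hz; have [z0|z0] := leP 0 z; first exact: main.
have -> : w - z = - (- w - - z) by ring.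
have := main (- w) (- z); rewrite normrN mulrN normrN sqrrN [huber mu (- w)]huberN.
by rewrite huberN clipN// mulrNN; apply => //; lra.
Qed.

End huber.

(** * Functions that are measurable for a sub-sigma-algebra *)

Section sub_sigma_algebra.
Context {d} {Omega : measurableType d} {R : realType}.
Variable P : probability Omega R.
Variable G : set (set Omega).
Hypothesis Gm : G `<=` measurable.
Local Notation GT := (g_sigma_algebraType G).

Lemma sub_measurable A : <<s G >> A -> measurable A.
Proof. exact: (smallest_sub (@sigma_algebra_measurable _ Omega) Gm). Qed.

Lemma sub_measurable_fun d' (S : sigmaRingType d') (h : Omega -> S) :
  measurable_fun (setT : set GT) h -> measurable_fun (setT : set Omega) h.
Proof.
by move=> mh _ B mB; apply: sub_measurable; exact: (mh measurableT B mB).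
Qed.

Import HBNNSimple.

Lemma nnsfun_integralM (s : {nnsfun GT >-> R}) (f : Omega -> R) :
  measurable_fun setT f -> (forall x, 0 <= f x) ->
  (\int[P]_x (s x * f x)%:E =
   \sum_(y \in range s) y%:E * \int[P]_(x in s @^-1` [set y]) (f x)%:E)%E.
Proof.
move=> mf f0.
have ms y : measurable (s @^-1` [set y] : set Omega).
  apply: sub_measurable; rewrite -[X in _ X]setTI.
  exact: (measurable_funP s measurableT).
have m1 y : measurable_fun setT (\1_(s @^-1` [set y]) : Omega -> R).
  exact/measurable_indic/ms.
transitivity (\int[P]_x (\sum_(y \in range s)
    (y * (\1_(s @^-1` [set y]) x * f x))%:E))%E.
  apply: eq_integral => x _; rewrite fimfunE fsumEFin//.
  rewrite !fsbig_finite//= mulr_suml; congr EFin; apply: eq_bigr => y _.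
  by rewrite mulrA.
rewrite ge0_integral_fsum//; last 2 first.
- by move=> y; apply/measurable_EFinP; apply: measurable_funM => //; exact: measurable_funM.
- move=> y x _; rewrite lee_fin mulrA.
  by rewrite mulr_ge0//; have := nnfun_muleindic_ge0 s y x; rewrite lee_fin.
apply: eq_fsbigr => y; rewrite inE => -[z _ <-].
under eq_integral do rewrite EFinM.
rewrite ge0_integralZl//; last 3 first.
- by apply/measurable_EFinP; exact: measurable_funM.
- by move=> x _; rewrite lee_fin mulr_ge0.
- by rewrite lee_fin.
congr (_ * _)%E; rewrite [RHS]integral_mkcond; apply: eq_integral => x _.
by rewrite epatch_indic EFinM muleC.
Qed.

(** This and [pull_out0] express in terms of integrals over events that a
    function known to [<<s G >>] can be pulled out of a conditional expectation.
    Simple functions reduce to finitely many events; monotone convergence gives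
    the general case. *)
Lemma pull_out_le (h f g : Omega -> R) :
  measurable_fun setT f -> measurable_fun setT g ->
  (forall x, 0 <= f x) -> (forall x, 0 <= g x) ->
  (forall A, <<s G >> A ->
    (\int[P]_(x in A) (f x)%:E <= \int[P]_(x in A) (g x)%:E)%E) ->
  measurable_fun (setT : set GT) h -> (forall x, 0 <= h x) ->
  (\int[P]_x (h x * f x)%:E <= \int[P]_x (h x * g x)%:E)%E.
Proof.
move=> mf mg f0 g0 fg mh h0.
have mh' : measurable_fun (setT : set GT) (EFin \o h) by exact/measurable_EFinP.
have h0' (x : GT) : setT x -> (0 <= (EFin \o h) x)%E by rewrite lee_fin.
pose s := nnsfun_approx measurableT mh'.
have mono (k : Omega -> R) : measurable_fun setT k -> (forall x, 0 <= k x) ->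
    (\int[P]_x (h x * k x)%:E = limn (fun n => \int[P]_x (s n x * k x)%:E))%E.
  move=> mk k0; rewrite -monotone_convergence//.
  - apply: eq_integral => x _; apply/esym/cvg_lim => //.
    under eq_fun do rewrite EFinM; rewrite EFinM.
    by apply: cvgeZr => //; exact: (@cvg_nnsfun_approx _ GT R setT measurableT _ mh' h0' x).
  - move=> n; apply/measurable_EFinP; apply: measurable_funM => //.
    by apply: sub_measurable_fun; exact/measurable_funP.
  - by move=> n x _; rewrite lee_fin mulr_ge0.
  - move=> x _ a b ab; rewrite lee_fin ler_wpM2r//.
    by have /lefP/(_ x) := nd_nnsfun_approx measurableT mh' ab.
have nd (k : Omega -> R) : measurable_fun setT k -> (forall x, 0 <= k x) ->
    cvgn (fun n => \int[P]_x (s n x * k x)%:E)%E.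
  move=> mk k0; apply: ereal_nondecreasing_is_cvgn => a b ab.
  have ms n : measurable_fun (setT : set Omega) (fun x : Omega => (s n x * k x)%:E).
    apply/measurable_EFinP; apply: measurable_funM => //.
    by apply: sub_measurable_fun; exact/measurable_funP.
  apply: ge0_le_integral => //.
  - by move=> x _; rewrite lee_fin mulr_ge0.
  - move=> x _; rewrite lee_fin ler_wpM2r//.
    by have /lefP/(_ x) := nd_nnsfun_approx measurableT mh' ab.
rewrite !mono//; apply: lee_lim; [exact: nd|exact: nd|apply: nearW => n].
rewrite !nnsfun_integralM// lee_fsum// => y [x _ <-].
rewrite lee_wpmul2l ?lee_fin//; apply: fg; rewrite -[X in _ X]setTI.
exact: (measurable_funP (s n) measurableT).
Qed.

Lemma integrable_le_real (f g : Omega -> R) :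
  measurable_fun setT f -> P.-integrable setT (EFin \o g) ->
  (forall x, `|f x| <= g x) -> P.-integrable setT (EFin \o f).
Proof.
move=> mf ig fg; apply: (le_integrable _ _ _ ig) => //.
  exact/measurable_EFinP.
by move=> x _ /=; rewrite lee_fin (le_trans (fg x))// ler_norm.
Qed.

(** Apply [pull_out_le] in both directions to [`|D| + D] and [`|D|], whose
    integrals over events agree, with the positive and negative parts of [h] as
    multipliers. *)
Lemma pull_out0 (h D : Omega -> R) :
  P.-integrable setT (EFin \o D) ->
  (forall A, <<s G >> A -> (\int[P]_(x in A) (D x)%:E = 0)%E) ->
  measurable_fun (setT : set GT) h ->
  P.-integrable setT (fun x => (h x * D x)%:E) ->
  (\int[P]_x (h x * D x)%:E = 0)%E.
Proof.
move=> iD D0 mh ihD.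
have mD : measurable_fun setT D by exact/measurable_EFinP/(measurable_int P iD).
pose u x := `|D x| + D x; pose v x := `|D x|.
have mv : measurable_fun setT v by exact: measurableT_comp.
have mu : measurable_fun setT u by exact: measurable_funD.
have u0 x : 0 <= u x by rewrite /u; have := ler_norm (- D x); rewrite normrN; lra.
have v0 x : 0 <= v x by rewrite /v.
have iv : P.-integrable setT (EFin \o v) by exact: integrable_norm.
have uv A : <<s G >> A -> (\int[P]_(x in A) (u x)%:E = \int[P]_(x in A) (v x)%:E)%E.
  move=> GA; have mA := sub_measurable GA.
  under eq_integral do rewrite EFinD.
  rewrite integralD_EFin ?D0 ?adde0//.
  - exact: integrableS iv.
  - exact: integrableS iD.
have pos (k : Omega -> R) : measurable_fun (setT : set GT) k -> (forall x, 0 <= k x) ->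
    (forall x, k x <= `|h x|) -> (\int[P]_x (k x * D x)%:E = 0)%E.
  move=> mk k0 kh; have mk' := sub_measurable_fun mk.
  have ih : P.-integrable setT (fun x => `|h x * D x|%:E) by exact: integrable_norm.
  have ikv : P.-integrable setT (EFin \o (fun x => k x * v x)).
    apply: (integrable_le_real _ ih); first exact: measurable_funM.
    by move=> x; rewrite normrM normr_id normrM ler_wpM2r// ger0_norm.
  have ikD : P.-integrable setT (EFin \o (fun x => k x * D x)).
    apply: (integrable_le_real _ ih); first exact: measurable_funM.
    by move=> x; rewrite !normrM ler_wpM2r// ger0_norm.
  have : (\int[P]_x (k x * u x)%:E = \int[P]_x (k x * v x)%:E)%E.
    by apply/eqP; rewrite eq_le !pull_out_le// => A /uv ->.
  under eq_integral do rewrite mulrDr EFinD.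
  rewrite integralD_EFin//.
  have : (\int[P]_x (k x * v x)%:E)%E \is a fin_num by exact: (integrable_fin_num _ ikv).
  have : (\int[P]_x (k x * D x)%:E)%E \is a fin_num by exact: (integrable_fin_num _ ikD).
  case: (\int[P]_x (k x * v x)%:E)%E => // a; case: (\int[P]_x (k x * D x)%:E)%E => // b _ _.
  by rewrite -EFinD => -[ab]; congr EFin; lra.
have hp x : h^\+%R x <= `|h x|.
  by rewrite /funrpos; case: (leP (h x) 0) => h0; rewrite ?normr_ge0 ?ler_norm.
have hn x : h^\-%R x <= `|h x|.
  by rewrite /funrneg; case: (leP (- h x) 0) => h0; rewrite -normrN ?normr_ge0 ?ler_norm.
have mhp : measurable_fun (setT : set GT) h^\+%R by exact: measurable_funrpos.
have mhn : measurable_fun (setT : set GT) h^\-%R by exact: measurable_funrneg.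
have ik (k : Omega -> R) : measurable_fun (setT : set GT) k -> (forall x, 0 <= k x) ->
    (forall x, k x <= `|h x|) -> P.-integrable setT (EFin \o (fun x => k x * D x)).
  move=> mk k0 kh; have mk' := sub_measurable_fun mk.
  have ih : P.-integrable setT (fun x => `|h x * D x|%:E) by exact: integrable_norm.
  apply: (integrable_le_real _ ih); first exact: measurable_funM.
  by move=> x; rewrite !normrM ler_wpM2r// ger0_norm.
transitivity (\int[P]_x ((h^\+%R x * D x)%:E - (h^\-%R x * D x)%:E))%E.
  apply: eq_integral => x _; rewrite -EFinB -mulrBl.
  by rewrite -[in LHS](funrposBneg h).
rewrite integralB_EFin//; first by rewrite !pos ?sube0// => x; rewrite ?funrpos_ge0 ?funrneg_ge0.
- by apply: ik => // x; rewrite funrpos_ge0.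
- by apply: ik => // x; rewrite funrneg_ge0.
Qed.

End sub_sigma_algebra.

(** * Exponential potentials of vector-valued martingales *)

Section measurability_of_norms.
Context {d} {T : measurableType d} {R : realType}.

Lemma measurable_sqrt_comp (f : T -> R) :
  measurable_fun setT f -> measurable_fun setT (fun x => Num.sqrt (f x)).
Proof.
move=> mf.
have ms : measurable_fun setT (@Num.sqrt R).
  by apply: continuous_measurable_fun; exact: sqrt_continuous.
exact: (measurableT_comp ms mf).
Qed.

Lemma measurable_expR_comp (f : T -> R) :
  measurable_fun setT f -> measurable_fun setT (fun x => expR (f x)).
Proof. by move=> mf; apply: (measurableT_comp _ mf); exact: measurable_expR. Qed.

Lemma measurable_nrm (I : finType) (f : I -> T -> R) :
  (forall i, measurable_fun setT (f i)) ->
  measurable_fun setT (fun x => nrm (fun i => f i x)).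
Proof.
move=> mf; apply: measurable_sqrt_comp; apply: measurable_sum => i.
exact: measurable_funX.
Qed.

Lemma measurable_ch_comp (f : T -> R) :
  measurable_fun setT f -> measurable_fun setT (fun x => ch (f x)).
Proof.
move=> mf; rewrite /ch; apply: measurable_funM => //; apply: measurable_funD.
  exact: measurable_expR_comp.
by apply: measurable_expR_comp; exact: measurable_funN.
Qed.

Lemma measurable_ch_slope (I : finType) (f : I -> T -> R) i :
  (forall i, measurable_fun setT (f i)) ->
  measurable_fun setT (fun x => ch_slope (fun i => f i x) i).
Proof.
move=> mf; have mn := measurable_nrm mf.
rewrite /ch_slope /sh.
apply: measurable_funM => //; apply: measurable_funM.
  apply: measurable_funM => //; apply: measurable_funB.
    exact: measurable_expR_comp.
  by apply: measurable_expR_comp; exact: measurable_funN.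
rewrite (_ : (fun x => _) = (fun x => nrm (fun i => f i x) `^ (-1))).
  exact: (measurableT_comp (measurable_powR (-1)) mn).
by apply/funext => x; rewrite powR_inv1// nrm_ge0.
Qed.

End measurability_of_norms.

Section martingale_step.
Context {d} {Omega : measurableType d} {R : realType}.
Variable P : probability Omega R.
Variable G : set (set Omega).
Hypothesis Gm : G `<=` measurable.
Local Notation GT := (g_sigma_algebraType G).

Lemma ge0_le_integral_real (f g : Omega -> R) :
  measurable_fun setT f -> measurable_fun setT g ->
  (forall x, 0 <= f x) -> (forall x, f x <= g x) ->
  (\int[P]_x (f x)%:E <= \int[P]_x (g x)%:E)%E.
Proof.
move=> mf mg f0 fg; apply: ge0_le_integral => //.
- by move=> x _; rewrite lee_fin.
- exact/measurable_EFinP.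
- exact/measurable_EFinP.
- by move=> x _; rewrite lee_fin.
Qed.

Section step.
Variables (I : finType) (S D : I -> Omega -> R) (Z : Omega -> R).
Hypothesis mS : forall i, measurable_fun (setT : set GT) (S i).
Hypothesis iD : forall i, P.-integrable setT (EFin \o D i).
Hypothesis D0 : forall i A, <<s G >> A -> (\int[P]_(x in A) (D i x)%:E = 0)%E.
Hypothesis mZ : measurable_fun (setT : set GT) Z.
Hypothesis Z0 : forall x, 0 <= Z x.
Local Notation nS x := (nrm (fun i => S i x)).

(** The linear term of [ch_nrmD] integrates to zero, the increments being
    centred given [<<s G >>]. The bound holds trivially if its right-hand side is
    infinite; otherwise that side dominates the linear term, which is therefore
    integrable. *)
Lemma ch_martingale_step (b : Omega -> R) :
  measurable_fun setT b ->
  (forall x, nrm (fun i => D i x) <= b x) ->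
  (\int[P]_x (Z x * ch (nrm (fun i => (S i x + D i x)%R)))%:E <=
   \int[P]_x (Z x * ch (nS x) * (expR (b x) - b x))%:E)%E.
Proof.
move=> mb Db.
have mD i : measurable_fun setT (D i) by exact/measurable_EFinP/(measurable_int P (iD i)).
have mSO i := sub_measurable_fun Gm (mS i).
have mZO := sub_measurable_fun Gm mZ.
have mn := measurable_nrm mSO.
pose X x := Z x * ch (nS x) * (expR (b x) - b x).
have mX : measurable_fun setT X.
  apply: measurable_funM; first by apply: measurable_funM => //; exact: measurable_ch_comp.
  by apply: measurable_funB => //; exact: measurable_expR_comp.
have X0 x : 0 <= X x by rewrite !mulr_ge0 ?ch_ge0 ?expR_sub_ge0.
rewrite -/(X _).
have [Xoo|Xfin] := eqVneq (\int[P]_x (X x)%:E)%E +oo%E; first by rewrite Xoo leey.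
have iX : P.-integrable setT (EFin \o X).
  apply/integrableP; split; first exact/measurable_EFinP.
  under eq_integral do rewrite /= ger0_norm//.
  by rewrite ltey.
pose h i x := Z x * ch_slope (fun i => S i x) i.
have mh i : measurable_fun (setT : set GT) (h i).
  by apply: measurable_funM => //; exact: measurable_ch_slope.
have ihD i : P.-integrable setT (EFin \o (fun x => h i x * D i x)).
  apply: (integrable_le_real _ iX).
    by apply: measurable_funM => //; exact: (sub_measurable_fun Gm).
  move=> x; rewrite normrM /h normrM (ger0_norm (Z0 x)) /X.
  apply: ler_pM => //; first exact: mulr_ge0.
    by rewrite ler_wpM2l// ch_slope_le.
  apply: (le_trans (le_coord_nrm (fun i => D i x) i)).
  exact: le_trans (Db x) (expR_sub_ge _).
pose Y x := \sum_i h i x * D i x.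
have EY : (\int[P]_x (Y x)%:E = 0)%E.
  rewrite /Y; under eq_integral do rewrite -sumEFin.
  rewrite integral_sum// big1// => i _.
  by apply: (pull_out0 Gm (iD i) (D0 i) (mh i)); exact: ihD.
have iY : P.-integrable setT (EFin \o Y).
  rewrite (_ : EFin \o Y = fun x => (\sum_(i <- index_enum I) (h i x * D i x)%:E)%E).
    by apply: integrable_sum => // i _; exact: ihD.
  by apply/funext => x; rewrite /= -sumEFin.
have -> : (\int[P]_x (X x)%:E = \int[P]_x (X x + Y x)%:E)%E.
  under [RHS]eq_integral do rewrite EFinD.
  by rewrite integralD_EFin// EY adde0.
apply: ge0_le_integral_real.
- apply: measurable_funM => //; apply: measurable_ch_comp; apply: measurable_nrm => i.
  exact: measurable_funD.
- apply: measurable_funD => //; exact/measurable_EFinP/(measurable_int P iY).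
- by move=> x; rewrite mulr_ge0// ch_ge0.
- move=> x; rewrite /X /Y -mulrA.
  under eq_bigr do rewrite /h -mulrA.
  rewrite -mulr_sumr -mulrDr ler_wpM2l//.
  exact: (@ch_nrmD _ _ (fun i => S i x) (fun i => D i x)).
Qed.

Lemma ch_martingale_step_ae (b : Omega -> R) :
  measurable_fun setT b -> {ae P, forall x, nrm (fun i => D i x) <= b x} ->
  (\int[P]_x (Z x * ch (nrm (fun i => (S i x + D i x)%R)))%:E <=
   \int[P]_x (Z x * ch (nS x) * (expR (b x) - b x))%:E)%E.
Proof.
move=> mb Db.
have mD i : measurable_fun setT (D i) by exact/measurable_EFinP/(measurable_int P (iD i)).
have mSO i := sub_measurable_fun Gm (mS i).
have mZO := sub_measurable_fun Gm mZ.
have mn := measurable_nrm mSO.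
pose b' x := Num.max (b x) (nrm (fun i => D i x)).
have mb' : measurable_fun setT b' by apply: measurable_maxr => //; exact: measurable_nrm.
have mX c : measurable_fun setT c ->
    measurable_fun setT (fun x => (Z x * ch (nS x) * (expR (c x) - c x))%:E).
  move=> mc; apply/measurable_EFinP; apply: measurable_funM.
    by apply: measurable_funM => //; exact: measurable_ch_comp.
  by apply: measurable_funB => //; exact: measurable_expR_comp.
apply: (@le_trans _ _ (\int[P]_x (Z x * ch (nS x) * (expR (b' x) - b' x))%:E)%E).
  by apply: ch_martingale_step => // x; rewrite /b' le_max lexx orbT.
apply: ae_ge0_le_integral => //; [| exact: mX | | exact: mX |].
- by move=> x _; rewrite lee_fin !mulr_ge0 ?ch_ge0 ?expR_sub_ge0.
- by move=> x _; rewrite lee_fin !mulr_ge0 ?ch_ge0 ?expR_sub_ge0.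
apply: filterS Db => x Dbx _.
by rewrite /b' (max_idPl Dbx).
Qed.

(** If the conditional mean of the growth factor is at most [c], so is the growth
    of the potential. Only the conditional mean matters, so that the bound [b] on
    the increment may itself be random and unbounded. *)
Lemma ch_martingale_growth (b : Omega -> R) (c : R) :
  measurable_fun setT b -> {ae P, forall x, nrm (fun i => D i x) <= b x} ->
  0 <= c ->
  (forall A, <<s G >> A ->
    (\int[P]_(x in A) (expR (b x) - b x)%:E <= c%:E * P A)%E) ->
  (\int[P]_x (Z x * ch (nrm (fun i => (S i x + D i x)%R)))%:E <=
   c%:E * \int[P]_x (Z x * ch (nS x))%:E)%E.
Proof.
move=> mb Db c0 cb; apply: (le_trans (ch_martingale_step_ae mb Db)).
have mn := measurable_nrm mS.
have mW : measurable_fun (setT : set GT) (fun x => Z x * ch (nS x)).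
  by apply: measurable_funM => //; exact: measurable_ch_comp.
have W0 x : 0 <= Z x * ch (nS x) by rewrite mulr_ge0 ?ch_ge0.
rewrite -ge0_integralZl//; last 2 first.
- by apply/measurable_EFinP; exact: (sub_measurable_fun Gm).
- by move=> x _; rewrite lee_fin.
under [leRHS]eq_integral do rewrite -EFinM mulrC.
apply: (pull_out_le Gm) => //.
- by apply: measurable_funB => //; exact: measurable_expR_comp.
- by move=> x; rewrite expR_sub_ge0.
- move=> A GA; apply: (le_trans (cb A GA)); rewrite -[leRHS]/(\int[P]_(x in A) cst c%:E x)%E.
  by rewrite integral_cst//; exact: (sub_measurable Gm).
Qed.

End step.
End martingale_step.

Section independence.
Context {d} {Omega : measurableType d} {R : realType}.
Variable P : probability Omega R.

(** The function [\1_A - P A] integrates to zero over every event of the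
    sigma-algebra generated by [V], hence is orthogonal to [V]. *)
Lemma indep_integral (A : set Omega) (V : Omega -> R) :
  measurable A -> P.-integrable setT (EFin \o V) ->
  (forall B, measurable B -> P (A `&` V @^-1` B) = (P A * P (V @^-1` B))%E) ->
  (\int[P]_(x in A) (V x)%:E = P A * \int[P]_x (V x)%:E)%E.
Proof.
move=> mA iV ind.
have mV : measurable_fun setT V by exact/measurable_EFinP/(measurable_int P iV).
pose G := preimage_set_system setT V measurable.
have Gm : G `<=` measurable by move=> _ [B mB <-]; exact: mV.
have sG : <<s G >> = G.
  by apply: sigma_algebra_id; apply: sigma_algebra_preimage; exact: sigma_algebra_measurable.
pose p := fine (P A).
have pE : P A = p%:E by rewrite fineK// fin_num_measure.
pose D x := (\1_A x : R) - p.
have iA : P.-integrable setT (EFin \o (\1_A : Omega -> R)) by exact: integrable_indic.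
have ip : P.-integrable setT (EFin \o (cst p : Omega -> R)).
  exact: finite_measure_integrable_cst.
have iD : P.-integrable setT (EFin \o D).
  rewrite (_ : EFin \o D = (EFin \o (\1_A : Omega -> R)) \- (EFin \o cst p))%E.
    exact: integrableB.
  by apply/funext => x /=; rewrite EFinB.
have D0 B : <<s G >> B -> (\int[P]_(x in B) (D x)%:E = 0)%E.
  rewrite sG => -[C mC <-]; rewrite setTI.
  have mB : measurable (V @^-1` C) by rewrite -[X in measurable X]setTI; exact: mV.
  under eq_integral do rewrite EFinB.
  rewrite integralB_EFin//; [|exact: integrableS iA|exact: integrableS ip].
  rewrite integral_indic// [X in (X - _)%E](ind C mC) -[X in (_ - X)%E]/(\int[P]_(x in _) cst p%:E x)%E.
  by rewrite integral_cst// pE; apply: subee; rewrite fin_numM// fin_num_measure.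
have mVG : measurable_fun (setT : set (g_sigma_algebraType G)) V.
  exact: preimage_set_system_measurable_fun.
have iVD : P.-integrable setT (fun x => (V x * D x)%:E).
  pose g x := (1 + `|p|) * `|V x|.
  have ig : P.-integrable setT (EFin \o g).
    rewrite (_ : EFin \o g = fun x => ((1 + `|p|)%:E * `|V x|%R%:E)%E).
      by apply: (@integrableZl _ _ _ _ _ _ _ (fun x => `|V x|%:E)) => //; exact: integrable_norm.
    by apply/funext => x /=; rewrite EFinM.
  apply: (integrable_le_real _ ig).
    by apply: measurable_funM => //; apply: measurable_funB.
  move=> x; rewrite /g normrM mulrC ler_wpM2r// /D indicE.
  by case: (x \in A); rewrite ?(le_trans (ler_normB _ _))// ?normr1 ?normr0//; lra.
have := pull_out0 Gm iD D0 mVG iVD.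
have iVA : P.-integrable setT (EFin \o (fun x => V x * \1_A x)).
  apply: (integrable_le_real _ (integrable_norm iV)).
    by apply: measurable_funM => //; exact: measurable_indic.
  move=> x; rewrite normrM indicE /=.
  by case: (x \in A); rewrite ?normr1 ?normr0 ?mulr1 ?mulr0.
have iVp : P.-integrable setT (EFin \o (fun x => V x * p)).
  rewrite (_ : EFin \o _ = fun x => (p%:E * (EFin \o V) x)%E).
    exact: integrableZl.
  by apply/funext => y /=; rewrite EFinM muleC.
under eq_integral do rewrite /D mulrBr EFinB.
rewrite integralB_EFin// => e.
have -> : (\int[P]_(x in A) (V x)%:E = \int[P]_x (V x * \1_A x)%:E)%E.
  rewrite integral_mkcond; apply: eq_integral => x _.
  by rewrite epatch_indic EFinM.
have e2 : (\int[P]_x (V x * p)%:E = p%:E * \int[P]_x (V x)%:E)%E.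
  by rewrite -integralZl//; apply: eq_integral => x _; rewrite EFinM muleC.
rewrite pE -e2.
have : (\int[P]_x (V x * \1_A x)%:E)%E \is a fin_num by exact: (integrable_fin_num _ iVA).
have : (\int[P]_x (V x * p)%:E)%E \is a fin_num by exact: (integrable_fin_num _ iVp).
move: e; case: (\int[P]_x (V x * \1_A x)%:E)%E => // a.
case: (\int[P]_x (V x * p)%:E)%E => // b e _ _.
by move: e; rewrite -EFinB => -[ab]; congr EFin; lra.
Qed.

End independence.

(** * Measurability and independence along the trajectory *)

Section matrix_measurability.
Context {R : realType}.

Lemma measurable_entry m n (i : 'I_m) (j : 'I_n) :
  measurable_fun setT (fun A : 'M[R]_(m, n) => A i j).
Proof.
move=> _ B mB; apply: sub_sigma_algebra; exists (i, j) => //.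
by exists B.
Qed.

Lemma measurable_mx {d} {T : measurableType d} m n (f : T -> 'M[R]_(m, n)) :
  (forall i j, measurable_fun setT (fun x => f x i j)) ->
  measurable_fun setT f.
Proof.
move=> mf; apply: (measurability
  (\bigcup_ij preimage_set_system setT
     (fun A : 'M[R]_(m, n) => A ij.1 ij.2) measurable)) => //.
move=> _ [_ [[i j] _ [B mB <-]] <-]; rewrite setTI setTI.
by have := mf i j measurableT B mB; rewrite setTI.
Qed.

Lemma measurable_entry_comp {d} {T : measurableType d} m n (f : T -> 'M[R]_(m, n)) i j :
  measurable_fun setT f -> measurable_fun setT (fun x => f x i j).
Proof. by move=> mf; exact: (measurableT_comp (measurable_entry i j) mf). Qed.

Lemma measurable_mulmx {d} {T : measurableType d} m n p (A : 'M[R]_(m, n))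
    (f : T -> 'M[R]_(n, p)) :
  measurable_fun setT f -> measurable_fun setT (fun x => A *m f x).
Proof.
move=> mf; apply: measurable_mx => i j.
under eq_fun do rewrite mxE; apply: measurable_sum => k.
by apply: measurable_funM => //; exact: measurable_entry_comp.
Qed.

Lemma measurable_addmx {d} {T : measurableType d} m n (f g : T -> 'M[R]_(m, n)) :
  measurable_fun setT f -> measurable_fun setT g ->
  measurable_fun setT (fun x => f x + g x).
Proof.
move=> mf mg; apply: measurable_mx => i j.
under eq_fun do rewrite mxE.
by apply: measurable_funD; exact: measurable_entry_comp.
Qed.

Lemma measurable_oppmx {d} {T : measurableType d} m n (f : T -> 'M[R]_(m, n)) :
  measurable_fun setT f -> measurable_fun setT (fun x => - f x).
Proof.
move=> mf; apply: measurable_mx => i j.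
under eq_fun do rewrite mxE.
by apply: measurable_funN; exact: measurable_entry_comp.
Qed.

Lemma measurable_enorm_comp {d} {T : measurableType d} n (f : T -> 'cV[R]_n) :
  measurable_fun setT f -> measurable_fun setT (fun x => enorm (f x)).
Proof.
by move=> mf; apply: (@measurable_nrm _ _ _ _ (fun i x => f x i ord0)) => i;
  exact: measurable_entry_comp.
Qed.

Lemma measurable_lt {d} {T : measurableType d} (g : T -> R) :
  (forall a, measurable [set x | g x < a]) -> measurable_fun setT g.
Proof.
move=> mg mD; apply: (measurability _ (RGenInftyO.measurableE R)) => //.
move=> _ [_ [r ->] <-]; rewrite setTI.
rewrite (_ : _ @^-1` _ = [set x | g x < r]); first exact: mg.
by apply/seteqP; split => x /=; rewrite in_itv.
Qed.

Lemma rational_approx n (v : 'cV[R]_n) (e : R) : 0 < e ->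
  exists y : 'cV[rat]_n, \sum_i `|v i ord0 - ratr (y i ord0)| < e.
Proof.
move=> e0; have [r r0 rE] : exists2 r, 0 < r & r = e / n.+1%:R by exists (e / n.+1%:R) => //; rewrite divr_gt0.
have /choice[q hq] (i : 'I_n) : exists q : rat, `|v i ord0 - ratr q| < r.
  have [q] : exists q : rat, ratr q \in `](v i ord0 - r), (v i ord0 + r)[.
    by apply: rat_in_itvoo; lra.
  rewrite in_itv/= => /andP[q1 q2]; exists q.
  by rewrite ltr_norml; apply/andP; split; lra.
exists (\col_i q i).
apply: (@le_lt_trans _ _ (\sum_(i < n) r)).
  by apply: ler_sum => i _; rewrite mxE ltW.
rewrite sumr_const card_ord -mulr_natr rE -mulrA.
rewrite gtr_pMr// mulrC ltr_pdivrMr// mul1r ltr_nat ltnSn //.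
Qed.

(** A real Lipschitz function is the lower envelope of the cones of slope [L]
    with apexes at the rational points; there are countably many of these. *)
Lemma lipschitz_measurable n m (L : R) (phi : 'cV[R]_n -> 'cV[R]_m) :
  0 <= L -> elipschitz L phi -> measurable_fun setT phi.
Proof.
move=> L0 lip; apply: measurable_mx => i j.
rewrite (ord1 j) {j}; apply: measurable_lt => a.
pose rv (y : 'cV[rat]_n) : 'cV[R]_n := map_mx ratr y.
pose cone (y : 'cV[rat]_n) (v : 'cV[R]_n) : R :=
  phi (rv y) i ord0 + L * \sum_k `|v k ord0 - ratr (y k ord0)|.
have lip1 u v : phi u i ord0 <= phi v i ord0 + L * \sum_k `|u k ord0 - v k ord0|.
  rewrite -lerBlDl; apply: (le_trans (ler_norm _)).
  apply: (@le_trans _ _ (enorm (phi u - phi v))).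
    have := le_coord_nrm (fun k => (phi u - phi v) k ord0) i.
    by rewrite !mxE.
  apply: (le_trans (lip u v)); rewrite ler_wpM2l//.
  apply: (le_trans (enorm_sum_abs _)); apply: ler_sum => k _.
  by rewrite !mxE.
have -> : [set v | phi v i ord0 < a] =
    \bigcup_k (if (choice.unpickle k : option 'cV[rat]_n) is Some y
      then [set v | cone y v < a] else set0).
  apply/seteqP; split => [v /= va|v [k _]].
    have L1 : 0 < L + 1 by lra.
    have e0 : 0 < (a - phi v i ord0) / (2 * (L + 1)).
      by rewrite divr_gt0// ?mulr_gt0// subr_gt0.
    have [y hy] := rational_approx v e0.
    exists (choice.pickle y) => //; rewrite choice.pickleK /=.
    have h1 : phi (rv y) i ord0 <= phi v i ord0 + L * \sum_k `|v k ord0 - ratr (y k ord0)|.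
      apply: (le_trans (lip1 _ v)); rewrite lerD2l ler_wpM2l//.
      by apply: ler_sum => k _; rewrite mxE distrC.
    move: hy; rewrite ltr_pdivlMr ?mulr_gt0//; rewrite /cone.
    have : 0 <= \sum_k `|v k ord0 - ratr (y k ord0)| by apply: sumr_ge0.
    move: h1; set S := \sum_k _; nra.
  case: (choice.unpickle k : option 'cV[rat]_n) => [y /= h|//].
  apply: le_lt_trans h; apply: (le_trans (lip1 _ (rv y))).
  by rewrite lerD2l ler_wpM2l//; apply: ler_sum => l _; rewrite mxE.
apply: bigcupT_measurable => k; case: (choice.unpickle k : option 'cV[rat]_n) => [y|//].
have mc : measurable_fun setT (cone y).
  apply: measurable_funD => //; apply: measurable_funM => //.
  apply: measurable_sum => l; apply: measurableT_comp => //.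
  apply: measurable_funB => //; exact: measurable_entry.
rewrite (_ : [set v | _] = cone y @^-1` `]-oo, a[).
  by rewrite -[X in measurable X]setTI; exact: mc.
by apply/seteqP; split => v /=; rewrite in_itv.
Qed.

End matrix_measurability.

Section trajectory.
Context {d} {Omega : measurableType d} {R : realType}.
Variable P : probability Omega R.
Context {n m : nat} (T : nat).
Variables (phi : 'cV[R]_n -> 'cV[R]_m) (A : 'M[R]_(n, m)).
Variables (x w : nat -> {RV P >-> 'cV[R]_n}).
Hypothesis mphi : measurable_fun setT phi.
Hypothesis dyn : forall t, (t < T)%N -> forall om,
  x t.+1 om = A *m phi (x t om) + w t om.

Definition history t : set (set Omega) :=
  \bigcup_(s in [set s | (s <= t)%N])
    preimage_set_system setT (x s : Omega -> 'cV[R]_n) measurable.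

Local Notation GT t := (g_sigma_algebraType (history t)).

Lemma history_measurable t : history t `<=` measurable.
Proof.
move=> _ [s _ [B mB <-]].
exact: (measurable_funPT (x s)).
Qed.

Lemma history_mono s t : (s <= t)%N -> <<s history s >> `<=` <<s history t >>.
Proof.
move=> st; apply: smallest_sub; first exact: smallest_sigma_algebra.
move=> _ [r /= rs [B mB <-]]; apply: sub_sigma_algebra.
exists r => //=; first exact: leq_trans st.
by exists B.
Qed.

Lemma history_fun_mono s t d' (S : sigmaRingType d') (h : Omega -> S) : (s <= t)%N ->
  measurable_fun (setT : set (GT s)) h -> measurable_fun (setT : set (GT t)) h.
Proof. by move=> st mh _ B mB; apply: (history_mono st); exact: (mh measurableT B mB). Qed.

Lemma x_history s t : (s <= t)%N ->
  measurable_fun (setT : set (GT t)) (x s : Omega -> 'cV[R]_n).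
Proof.
move=> st _ B mB; apply: sub_sigma_algebra; exists s => //.
by exists B.
Qed.

Lemma phi_history s t : (s <= t)%N ->
  measurable_fun (setT : set (GT t)) (fun om => phi (x s om)).
Proof. by move=> st; exact: (measurableT_comp mphi (x_history st)). Qed.

Lemma w_history s t : (s < t)%N -> (s < T)%N ->
  measurable_fun (setT : set (GT t)) (w s : Omega -> 'cV[R]_n).
Proof.
move=> st sT.
rewrite (_ : (w s : Omega -> 'cV[R]_n) =
  fun om => x s.+1 om + - (A *m phi (x s om))); last first.
  by apply/funext => om; rewrite dyn// addrAC subrr add0r.
apply: measurable_addmx; first exact: x_history.
by apply: measurable_oppmx; apply: measurable_mulmx; apply: phi_history; exact: ltnW.
Qed.

(* The independent inputs, the initial state being the input number 0. *)
Let X k : Omega -> 'cV[R]_n := if k is t.+1 then w t else x 0%N.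
Hypothesis ind : mutually_independent P X.

Let mX k : measurable_fun setT (X k).
Proof. by case: k => [|k]; exact: measurable_funPT. Qed.

Let mem_upto k t : (k \in [fset j in iota 0 t.+1]%fset) = (k <= t)%N.
Proof. by rewrite in_fset (mem_iota 0 t.+1 k) add0n ltnS. Qed.

Let cyl t : set (set Omega) := [set E | exists2 B : nat -> set 'cV[R]_n,
  forall k, measurable (B k) &
  E = \bigcap_(k in [set` [fset k in iota 0 t.+1]%fset]) X k @^-1` B k].

Let cyl_sub t : cyl t `<=` measurable.
Proof.
move=> _ [B mB ->]; apply: fin_bigcap_measurable => // k _.
by rewrite -[X in measurable X]setTI; exact: mX.
Qed.

Let cyl_setI t : setI_closed (cyl t).
Proof.
move=> _ _ [B mB ->] [C mC ->]; exists (fun k => B k `&` C k).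
  by move=> k; exact: measurableI.
by rewrite -bigcapI; apply: eq_bigcapr => k _; rewrite preimage_setI.
Qed.

Let cyl_X k t : (k <= t)%N ->
  measurable_fun (setT : set (g_sigma_algebraType (cyl t))) (X k).
Proof.
move=> kt _ B mB; apply: sub_sigma_algebra; rewrite setTI.
exists (fun j => if j == k then B else setT) => [j|]; first by case: ifP.
apply/seteqP; split => [om Bom j _|om].
  by rewrite /preimage /=; case: eqP => [->|].
by move=> /(_ k); rewrite /preimage /= eqxx; apply; rewrite mem_upto.
Qed.

Let x_cyl s t : (s <= t)%N -> (s <= T)%N ->
  measurable_fun (setT : set (g_sigma_algebraType (cyl t))) (x s : Omega -> 'cV[R]_n).
Proof.
elim: s => [|s IH] st sT; first exact: (@cyl_X 0%N t st).
rewrite (_ : (x s.+1 : Omega -> 'cV[R]_n) =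
  fun om => (A *m phi (x s om)) + w s om); last first.
  by apply/funext => om; rewrite dyn.
apply: measurable_addmx; last exact: (@cyl_X s.+1 t st).
apply: measurable_mulmx; apply: (measurableT_comp mphi).
by apply: IH; exact: ltnW.
Qed.

(** The states up to time [t] are functions of [x 0], [w 0], ..., [w t.-1], and
    the cylinders over these form a pi-system on which the product rule is the
    assumed independence. *)
Lemma history_independent t (E : set Omega) (B : set 'cV[R]_n) :
  (t <= T)%N -> <<s history t >> E -> measurable B ->
  P (E `&` w t @^-1` B) = (P E * P (w t @^-1` B))%E.
Proof.
move=> tT hE mB.
have mW : measurable (w t @^-1` B).
  by rewrite -[X in measurable X]setTI; exact: (measurable_funPT (w t)).
have cE : <<s cyl t >> E.
  move: E hE; apply: smallest_sub; first exact: smallest_sigma_algebra.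
  move=> _ [s /= st [C mC <-]]; exact: (x_cyl st (leq_trans st tT)).
pose p := fine (P (w t @^-1` B)).
have pE : P (w t @^-1` B) = p%:E by rewrite fineK// fin_num_measure.
have p0 : 0 <= p by rewrite fine_ge0.
rewrite pE muleC.
apply: (@g_sigma_algebra_measure_unique _ R Omega (cyl t) (@cyl_sub t) (fun=> setT) _ _
  (mrestr P mW) (mscale (NngNum p0) P)) => //.
- move=> _; exists (fun=> setT) => //; apply/seteqP; split => // om _ k _ //.
- by rewrite bigcup_const//; exists 0%N.
- move=> _ [C mC ->]; rewrite /mrestr /mscale /=.
  set J := [fset k in iota 0 t.+1]%fset.
  have tJ : t.+1 \notin J by rewrite mem_upto ltnn.
  change (P ((\bigcap_(k in [set` J]) X k @^-1` C k) `&` (w t @^-1` B)) =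
    (p%:E * P (\bigcap_(k in [set` J]) X k @^-1` C k))%E).
  rewrite ind// -pE.
  pose C' k := if k == t.+1 then B else C k.
  have mC' k : measurable (C' k) by rewrite /C'; case: ifP.
  have := ind (t.+1 |` J)%fset mC'.
  rewrite big_fsetU1//= /C' eqxx.
  have -> : (\prod_(j <- J) P (X j @^-1` (if j == t.+1 then B else C j)) =
     \prod_(j <- J) P (X j @^-1` C j))%E.
    rewrite !big_seq; apply: eq_bigr => j jJ; case: ifPn => // /eqP jt.
    by rewrite -jt jJ in tJ.
  move=> <-; congr (P _); apply/seteqP; split => [om [h1 h2] k /=|om h].
    rewrite !inE; case: eqP => [-> _ //|_ /= kJ]; apply: h1.
    by rewrite /= !inE.
  split; last by have := h t.+1; rewrite eqxx; apply; rewrite /= !inE eqxx.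
  move=> k /= kJ; have := h k; case: eqP => [kt|_]; first by rewrite -kt kJ in tJ.
  by apply; rewrite /= in_fsetU kJ orbT.
- by move=> _; rewrite /= /mrestr setTI; exact: (le_lt_trans (probability_le1 P mW) (ltry 1)).
Qed.

Lemma history_integral t (E : set Omega) (f : 'cV[R]_n -> R) :
  (t <= T)%N -> <<s history t >> E -> measurable_fun setT f ->
  P.-integrable setT (fun om => (f (w t om))%:E) ->
  (\int[P]_(om in E) (f (w t om))%:E = P E * \int[P]_om (f (w t om))%:E)%E.
Proof.
move=> tT hE mf iw.
apply: (@indep_integral _ _ _ _ _ (fun om => f (w t om))) => //.
  exact: (sub_measurable (@history_measurable t)).
move=> B mB; rewrite (_ : _ @^-1` B = w t @^-1` (f @^-1` B))//.
apply: history_independent => //.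
by rewrite -[X in measurable X]setTI; exact: mf.
Qed.

End trajectory.

(** * Integrals of nonnegative functions and exponential moments *)

Section nonnegative_integrals.
Context {d} {Omega : measurableType d} {R : realType}.
Variable P : probability Omega R.
Variable E : set Omega.
Hypothesis mE : measurable E.

Lemma ge0_le_integral_on (f g : Omega -> R) :
  measurable_fun setT f -> measurable_fun setT g ->
  (forall om, 0 <= f om) -> (forall om, f om <= g om) ->
  (\int[P]_(om in E) (f om)%:E <= \int[P]_(om in E) (g om)%:E)%E.
Proof.
move=> mf mg f0 fg; apply: ge0_le_integral => //.
- by move=> om _; rewrite lee_fin.
- exact/measurable_funTS/measurable_EFinP.
- exact/measurable_funTS/measurable_EFinP.
- by move=> om _; rewrite lee_fin.
Qed.

Lemma ge0_integralZl_on (c : R) (f : Omega -> R) :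
  measurable_fun setT f -> (forall om, 0 <= f om) -> 0 <= c ->
  (\int[P]_(om in E) (c * f om)%:E = c%:E * \int[P]_(om in E) (f om)%:E)%E.
Proof.
move=> mf f0 c0; under eq_integral do rewrite EFinM.
apply: (ge0_integralZl_EFin P mE) => //.
- by move=> om _; rewrite lee_fin.
- exact/measurable_funTS/measurable_EFinP.
Qed.

Lemma ge0_integralD_on (f g : Omega -> R) :
  measurable_fun setT f -> measurable_fun setT g ->
  (forall om, 0 <= f om) -> (forall om, 0 <= g om) ->
  (\int[P]_(om in E) (f om + g om)%:E =
   \int[P]_(om in E) (f om)%:E + \int[P]_(om in E) (g om)%:E)%E.
Proof.
move=> mf mg f0 g0; under eq_integral do rewrite EFinD.
apply: (ge0_integralD P mE).
- by move=> om _; rewrite lee_fin.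
- exact/measurable_funTS/measurable_EFinP.
- by move=> om _; rewrite lee_fin.
- exact/measurable_funTS/measurable_EFinP.
Qed.

Lemma ge0_integral_sum_on (I : Type) (s : seq I) (f : I -> Omega -> R) :
  (forall i, measurable_fun setT (f i)) -> (forall i om, 0 <= f i om) ->
  (\int[P]_(om in E) (\sum_(i <- s) f i om)%:E =
   \sum_(i <- s) \int[P]_(om in E) (f i om)%:E)%E.
Proof.
move=> mf f0; under eq_integral do rewrite -sumEFin.
apply: (ge0_integral_sum P mE).
- by move=> i; exact/measurable_funTS/measurable_EFinP.
- by move=> i om _; rewrite lee_fin.
Qed.

Lemma integral_cst_on (c : R) : (\int[P]_(om in E) c%:E = c%:E * P E)%E.
Proof. exact: (integral_cst P mE). Qed.

End nonnegative_integrals.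

Section exponential_integrals.
Context {d} {Omega : measurableType d} {R : realType}.
Variable P : probability Omega R.

(** The infimum defining the norm is attained: the moment is at most [expR 1] for
    all parameters larger than [s], and these increase to it by monotone
    convergence when the parameter decreases to [s]. *)
Lemma psi2_norm_le (X : Omega -> R) (s : R) :
  measurable_fun setT X -> 0 < s -> (psi2_norm P X <= s%:E)%E ->
  (\int[P]_om (expR (X om ^+ 2 / s ^+ 2))%:E <= (expR 1)%:E)%E.
Proof.
move=> mX s0 Xs.
pose c (k : nat) : R := 1 - harmonic k.
have c01 k : 0 <= c k <= 1.
  by rewrite /c /harmonic /= subr_ge0 invf_le1// ler1n /= gerBl invr_ge0.
pose f k om := expR (c k * (X om ^+ 2 / s ^+ 2)).
have y0 om : 0 <= X om ^+ 2 / s ^+ 2 by rewrite divr_ge0 ?sqr_ge0.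
have mf k : measurable_fun setT (f k).
  apply: measurable_expR_comp; apply: measurable_funM => //.
  by apply: measurable_funM => //; exact: measurable_funX.
have fe k : (\int[P]_om (f k om)%:E <= (expR 1)%:E)%E.
  pose e : R := harmonic k / 2.
  have e0 : 0 < e by rewrite divr_gt0// harmonic_gt0.
  have : (psi2_norm P X < (s * (1 + e))%:E)%E.
    apply: (le_lt_trans Xs); rewrite lte_fin; nra.
  move=> /ereal_inf_lt[_ [v [v0 hv] <-]]; rewrite lte_fin => vs.
  apply: le_trans hv; rewrite unlock; apply: ge0_le_integral_real => //.
  - apply: measurable_expR_comp.
    by apply: measurable_funM => //; exact: measurable_funX.
  - by move=> om; exact: expR_ge0.
  move=> om; rewrite ler_expR mulrCA ler_wpM2l ?sqr_ge0//.
  rewrite ler_pdivrMr ?exprn_gt0// mulrC ler_pdivlMr ?exprn_gt0//.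
  have ck : c k = 1 - 2 * e by rewrite /c /e; field.
  have /andP[] := c01 k; rewrite ck => h1 h2.
  have v2 : v ^+ 2 <= (s * (1 + e)) ^+ 2 by rewrite lerXn2r ?nnegrE//; [lra|nra|lra].
  apply: (@le_trans _ _ ((1 - 2 * e) * (s * (1 + e)) ^+ 2)).
    by rewrite ler_wpM2l.
  have -> : (1 - 2 * e) * (s * (1 + e)) ^+ 2 = s ^+ 2 * (1 - e ^+ 2 * (3 + 2 * e)) by ring.
  rewrite ler_piMr ?sqr_ge0// gerBl mulr_ge0 ?sqr_ge0//; lra.
have -> : (\int[P]_om (expR (X om ^+ 2 / s ^+ 2))%:E)%E =
    (limn (fun k => \int[P]_om (f k om)%:E))%E.
  rewrite -monotone_convergence//; last 3 first.
  - by move=> k; exact/measurable_EFinP.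
  - by move=> k om _; rewrite lee_fin expR_ge0.
  - move=> om _ i j ij; rewrite lee_fin ler_expR ler_wpM2r// lerD2l lerN2.
    by rewrite /harmonic /= lef_pV2 ?posrE// ler_nat ltnS.
  apply: eq_integral => om _; apply/esym/cvg_lim => //.
  apply: cvg_EFin; first by near=> k.
  rewrite -[X in _ --> X]/(expR (X om ^+ 2 / s ^+ 2)).
  apply: continuous_cvg; first exact: continuous_expR.
  rewrite -[X in _ --> X]mul1r; apply: cvgM; last exact: cvg_cst.
  rewrite -[X in _ --> X]subr0; apply: cvgB; first exact: cvg_cst.
  exact: cvg_harmonic.
apply: lime_le; last by apply: nearW.
apply: ereal_nondecreasing_is_cvgn => i j ij.
apply: ge0_le_integral_real => // om; first exact: expR_ge0.
rewrite ler_expR ler_wpM2r// lerD2l lerN2.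
by rewrite /harmonic /= lef_pV2 ?posrE// ler_nat ltnS.
Unshelve. all: by end_near. Qed.

(** The minimum of [f] and [g] lies below [g] everywhere and equals [f] almost
    everywhere. *)
Lemma ae_le_integral (E : set Omega) (f g : Omega -> R) :
  measurable E -> P.-integrable setT (EFin \o f) -> P.-integrable setT (EFin \o g) ->
  {ae P, forall om, f om <= g om} ->
  (\int[P]_(om in E) (f om)%:E <= \int[P]_(om in E) (g om)%:E)%E.
Proof.
move=> mE i1 i2 fg.
have mf : measurable_fun setT f by exact/measurable_EFinP/(measurable_int P i1).
have mg : measurable_fun setT g by exact/measurable_EFinP/(measurable_int P i2).
pose h om := Num.min (f om) (g om).
have mh : measurable_fun setT h by exact: measurable_minr.
have ih : P.-integrable setT (EFin \o h).
  have ifg : P.-integrable setT (EFin \o (fun om => `|f om| + `|g om|)).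
    rewrite (_ : _ \o _ = (EFin \o (Num.norm \o f)) \+ (EFin \o (Num.norm \o g)))%E.
      by apply: integrableD => //; exact: integrable_norm.
    by apply/funext => om /=; rewrite EFinD.
  apply: (integrable_le_real mh ifg) => om; rewrite /h; case: (leP (f om) (g om)) => _; first by rewrite lerDl.
  by rewrite lerDr.
rewrite (ae_eq_integral (EFin \o h))//.
- apply: le_integral => //; [exact: integrableS ih|exact: integrableS i2|].
  by move=> om _; rewrite lee_fin ge_min lexx orbT.
- by apply/measurable_funTS/measurable_EFinP.
- by apply/measurable_funTS/measurable_EFinP.
- by apply: filterS fg => om fg _ /=; rewrite /h (min_idPl fg).
Qed.

Lemma cond_psi2_integral (G : set (set Omega)) (X : Omega -> R) (s : R) (E : set Omega) :
  G `<=` measurable -> cond_psi2_norm_le P G X s -> G E ->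
  (\int[P]_(om in E) (expR (X om ^+ 2 / s ^+ 2))%:E <= (expR 1)%:E * P E)%E.
Proof.
move=> Gm [g [i1 i2 _ cg] g1] GE; have mE := Gm _ GE.
rewrite -cg// -[leRHS](integral_cst P mE).
by apply: ae_le_integral => //; exact: finite_measure_integrable_cst.
Qed.

Lemma sqr_integrable_of_exp (X : Omega -> R) (a : R) :
  measurable_fun setT X -> 0 < a ->
  (\int[P]_om (expR (a * X om ^+ 2))%:E < +oo)%E ->
  P.-integrable setT (EFin \o X) /\
  P.-integrable setT (EFin \o (fun om => X om ^+ 2)).
Proof.
move=> mX a0 fin.
have ie : P.-integrable setT (EFin \o (fun om => expR (a * X om ^+ 2))).
  apply/integrableP; split.
    apply/measurable_EFinP; apply: measurable_expR_comp; apply: measurable_funM => //.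
    exact: measurable_funX.
  by under eq_integral do rewrite /= ger0_norm ?expR_ge0//.
have ie' : P.-integrable setT (EFin \o (fun om => (1 + a^-1) * expR (a * X om ^+ 2))).
  rewrite (_ : _ \o _ = fun om => ((1 + a^-1)%:E * (EFin \o (fun om => expR (a * X om ^+ 2)))%R om)%E).
    exact: integrableZl.
  by apply/funext => om /=; rewrite EFinM.
have key om : X om ^+ 2 <= a^-1 * expR (a * X om ^+ 2).
  rewrite ler_pdivlMl//.
  by have := expR_ge1Dx (a * X om ^+ 2); lra.
have e1 om : 1 <= expR (a * X om ^+ 2).
  rewrite -[leLHS]expR0 ler_expR; apply: mulr_ge0; [exact: ltW|exact: sqr_ge0].
have a1 : 0 < a^-1 by rewrite invr_gt0.
split; apply: (integrable_le_real _ ie') => //.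
- move=> om; have := key om; have := e1 om.
  rewrite -[X om ^+ 2](real_normK (num_real _)).
  move: (expR _) => e; have := sqr_ge0 (`|X om| - 1); nra.
- exact: measurable_funX.
- move=> om; rewrite ger0_norm ?sqr_ge0//; have := key om; have := e1 om; nra.
Qed.

End exponential_integrals.

Section convexity_of_exp.
Context {R : realType}.

Lemma expR_tangent (a b : R) : expR b * (1 + (a - b)) <= expR a.
Proof.
have -> : expR a = expR b * expR (a - b) by rewrite -expRD subrKC.
by rewrite ler_wpM2l ?expR_ge0// expR_ge1Dx.
Qed.

Lemma expR_convex (t a b : R) : 0 <= t <= 1 ->
  expR (t * a + (1 - t) * b) <= t * expR a + (1 - t) * expR b.
Proof.
move=> /andP[t0 t1]; set c := t * a + (1 - t) * b.
have h1 := expR_tangent a c; have h2 := expR_tangent b c.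
have t1' : 0 <= 1 - t by lra.
have := ler_wpM2l t0 h1; have := ler_wpM2l t1' h2; rewrite /c.
move: (expR _) => e; lra.
Qed.

(** Jensen's inequality for the uniform distribution on [n] points, from the
    tangent at the mean. *)
Lemma expR_mean n (a : 'I_n -> R) : (0 < n)%N ->
  expR ((\sum_i a i) / n%:R) <= (\sum_i expR (a i)) / n%:R.
Proof.
move=> n0; have n0' : (0 : R) < n%:R by rewrite ltr0n.
set c := (\sum_i a i) / n%:R.
rewrite ler_pdivlMr//.
apply: (@le_trans _ _ (\sum_i expR c * (1 + (a i - c)))); last first.
  by apply: ler_sum => i _; exact: expR_tangent.
rewrite -mulr_sumr ler_wpM2l ?expR_ge0// big_split/= sumrB !sumr_const card_ord.
by rewrite -mulr_natr mul1r -[X in _ <= _ + (_ - X)]mulr_natr /c divfK ?gt_eqF// subrr addr0.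
Qed.

Lemma sqr_convex (t a b : R) : 0 <= t <= 1 ->
  (t * a + (1 - t) * b) ^+ 2 <= t * a ^+ 2 + (1 - t) * b ^+ 2.
Proof.
move=> /andP[t0 t1]; rewrite -subr_ge0.
have -> : t * a ^+ 2 + (1 - t) * b ^+ 2 - (t * a + (1 - t) * b) ^+ 2 =
  t * (1 - t) * (a - b) ^+ 2 by ring.
by rewrite mulr_ge0 ?sqr_ge0// mulr_ge0//; lra.
Qed.

Lemma expR_scale (a y : R) : 0 <= a <= 1 -> expR (a * y) <= 1 - a + a * expR y.
Proof.
move=> a01; have := expR_convex y 0 a01.
by rewrite mulr0 addr0 expR0 mulr1 addrC.
Qed.

Lemma expR1_mul_le (y : R) : expR 1 * y <= expR y.
Proof. by have := expR_tangent y 1; rewrite addrCA subrr addr0. Qed.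

End convexity_of_exp.

(** * Energy of the trajectory *)

Record stable_system {d} {Omega : measurableType d} {R : realType}
    (P : probability Omega R) (n m T : nat) (phi : 'cV[R]_n -> 'cV[R]_m)
    (A : 'M[R]_(n, m)) (x w : nat -> {RV P >-> 'cV[R]_n}) (L sigma : R) : Prop :=
  StableSystem {
    sys_dyn : forall t, (t < T)%N -> forall om,
      x t.+1 om = A *m phi (x t om) + w t om;
    sys_lip : elipschitz L phi;
    sys_phi0 : phi 0 = 0;
    sys_L : 0 < L;
    sys_contr : opnorm A * L < 1;
    sys_n : (0 < n)%N;
    sys_sigma : 0 < sigma;
    sys_x0 : forall i, (psi2_norm P (fun om => x 0%N om i ord0) <= sigma%:E)%E;
    sys_w : forall t i, cond_psi2_norm_le P (natural_filtration x t)
      (fun om => w t om i ord0) sigma;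
    sys_ind : mutually_independent P
      (fun k : nat => if k is t.+1 then (w t : Omega -> 'cV[R]_n) else x 0%N)
  }.

Section system.
Context {d} {Omega : measurableType d} {R : realType}.
Variable P : probability Omega R.
Context {n m T : nat}.
Variables (phi : 'cV[R]_n -> 'cV[R]_m) (A : 'M[R]_(n, m)).
Variables (x w : nat -> {RV P >-> 'cV[R]_n}) (L sigma : R).
Hypothesis sys : stable_system T phi A x w L sigma.

Local Notation GT t := (g_sigma_algebraType (history x t)).
Local Notation r := (opnorm A * L).
Local Notation kap := (1 - opnorm A * L).
Local Notation V := (n%:R * sigma ^+ 2).

Lemma r_ge0 : 0 <= r.
Proof. by rewrite mulr_ge0 ?opnorm_ge0// ltW// (sys_L sys). Qed.

Lemma kap_gt0 : 0 < kap.
Proof. by rewrite subr_gt0 (sys_contr sys). Qed.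

Lemma kap_le1 : kap <= 1.
Proof. by rewrite gerBl r_ge0. Qed.

Lemma V_gt0 : 0 < V.
Proof. by rewrite mulr_gt0 ?ltr0n ?(sys_n sys)// exprn_gt0// (sys_sigma sys). Qed.

Lemma measurable_phi : measurable_fun setT phi.
Proof. exact: (lipschitz_measurable (ltW (sys_L sys)) (sys_lip sys)). Qed.

Lemma enorm_phi v : enorm (phi v) <= L * enorm v.
Proof. by have := sys_lip sys v 0; rewrite (sys_phi0 sys) !subr0. Qed.

Lemma enorm_next t om : (t < T)%N ->
  enorm (x t.+1 om) <= r * enorm (x t om) + enorm (w t om).
Proof.
move=> tT; rewrite (sys_dyn sys)//; apply: (le_trans (enormD _ _)).
rewrite lerD2r; apply: (le_trans (enorm_mulmx _ _)).
by rewrite -mulrA ler_wpM2l ?opnorm_ge0// enorm_phi.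
Qed.

(** With [kap = 1 - r], the state is [r * a + kap * (b / kap)], a convex
    combination. *)
Lemma sqr_enorm_next t om : (t < T)%N ->
  enorm (x t.+1 om) ^+ 2 <= r * enorm (x t om) ^+ 2 + enorm (w t om) ^+ 2 / kap.
Proof.
move=> tT; have k0 := kap_gt0; have r0 := r_ge0.
have r1 : 0 <= r <= 1 by rewrite r0 ltW// (sys_contr sys).
apply: (@le_trans _ _ ((r * enorm (x t om) + kap * (enorm (w t om) / kap)) ^+ 2)).
  rewrite lerXn2r ?nnegrE ?enorm_ge0//.
    by rewrite addr_ge0// mulr_ge0 ?enorm_ge0 ?divr_ge0 ?enorm_ge0// ltW.
  by rewrite [kap * _]mulrC divfK ?gt_eqF// enorm_next.
apply: (le_trans (sqr_convex _ _ r1)); rewrite lerD2l le_eqVlt; apply/orP; left.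
by apply/eqP; rewrite exprMn; field; rewrite gt_eqF.
Qed.

(** Energy balance: the contraction turns the squared norms of the states into
    a geometrically discounted sum of the squared norms of the inputs. *)
Lemma energy_balance N om : (N <= T)%N ->
  kap ^+ 2 * \sum_(0 <= t < N) enorm (x t om) ^+ 2 <=
  enorm (x 0%N om) ^+ 2 + \sum_(0 <= t < N) enorm (w t om) ^+ 2.
Proof.
have k0 := kap_gt0; have k1 := kap_le1.
move=> NT.
have : kap * \sum_(0 <= t < N) enorm (x t om) ^+ 2 + enorm (x N om) ^+ 2 <=
    enorm (x 0%N om) ^+ 2 + (\sum_(0 <= t < N) enorm (w t om) ^+ 2) / kap.
  elim: N NT => [|N IH] NT; first by rewrite !big_nil mulr0 mul0r add0r addr0.
  rewrite !big_nat_recr//= mulrDr [X in _ <= _ + X]mulrDl.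
  have := IH (ltnW NT); have := sqr_enorm_next om NT.
  move: (enorm (x N om) ^+ 2) (enorm (x N.+1 om) ^+ 2) (enorm (w N om) ^+ 2 / kap)=> a b c h1 h2.
  lra.
set Sx := \sum_(0 <= t < N) _; set Sw := \sum_(0 <= t < N) _ => h.
have : kap * (kap * Sx) <= kap * (enorm (x 0%N om) ^+ 2 + Sw / kap).
  rewrite ler_wpM2l//; first exact: ltW.
  by apply: le_trans h; rewrite lerDl sqr_ge0.
rewrite mulrA -expr2 => /le_trans; apply.
rewrite mulrDr [kap * (_ / _)]mulrC divfK ?gt_eqF// lerD2r.
by rewrite ler_piMl ?sqr_ge0.
Qed.

Lemma measurable_x t : measurable_fun setT (x t : Omega -> 'cV[R]_n).
Proof. exact: measurable_funPT. Qed.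

Lemma measurable_w t : measurable_fun setT (w t : Omega -> 'cV[R]_n).
Proof. exact: measurable_funPT. Qed.

Lemma expR_norm_mean (v : 'cV[R]_n) :
  expR (enorm v ^+ 2 / V) <= (\sum_i expR (v i ord0 ^+ 2 / sigma ^+ 2)) / n%:R.
Proof.
apply: le_trans (expR_mean _ (sys_n sys)).
by rewrite -mulr_suml -mulrA -invfM [sigma ^+ 2 * _]mulrC enormE sqr_nrm.
Qed.

Lemma vector_exp (y : Omega -> 'cV[R]_n) (E : set Omega) :
  measurable E -> measurable_fun setT y ->
  (forall i, \int[P]_(om in E) (expR (y om i ord0 ^+ 2 / sigma ^+ 2))%:E <=
    (expR 1)%:E * P E)%E ->
  (\int[P]_(om in E) (expR (enorm (y om) ^+ 2 / V))%:E <= (expR 1)%:E * P E)%E.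
Proof.
move=> mE my hy.
have n0 : (0 : R) < n%:R by rewrite ltr0n (sys_n sys).
pose e i om := expR (y om i ord0 ^+ 2 / sigma ^+ 2).
have e0 i om : 0 <= e i om by exact: expR_ge0.
have me i : measurable_fun setT (e i).
  apply: measurable_expR_comp; apply: measurable_funM => //; apply: measurable_funX.
  exact: measurable_entry_comp.
apply: (@le_trans _ _ (\int[P]_(om in E) (n%:R^-1 * \sum_i e i om)%:E)%E).
  apply: ge0_le_integral_on => //.
  - apply/measurable_expR_comp; apply: measurable_funM => //; apply: measurable_funX.
    exact: measurable_enorm_comp.
  - by apply: measurable_funM => //; exact: measurable_sum.
  - by move=> om; rewrite [leRHS]mulrC expR_norm_mean.
rewrite ge0_integralZl_on; [|exact: mE|exact: measurable_sum|
  by move=> om; apply: sumr_ge0|by rewrite invr_ge0 ltW].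
rewrite ge0_integral_sum_on// lee_pdivrMl//.
apply: (@le_trans _ _ (\sum_(i < n) (expR 1)%:E * P E)%E).
  by apply: lee_sum => i _; exact: hy.
have -> : P E = (fine (P E))%:E by rewrite fineK// fin_num_measure.
by rewrite -EFinM sumEFin sumr_const card_ord -EFinM mulr_natl.
Qed.

Lemma noise_exp t (E : set Omega) : <<s history x t >> E ->
  (\int[P]_(om in E) (expR (enorm (w t om) ^+ 2 / V))%:E <= (expR 1)%:E * P E)%E.
Proof.
move=> hE; have hs := sub_measurable (@history_measurable _ _ _ P n x t).
apply: (vector_exp (hs _ hE) (measurable_w t)) => i.
by apply: (cond_psi2_integral _ (sys_w sys t i)) => // F; exact: hs.
Qed.

Lemma noise_exp_total t :
  (\int[P]_om (expR (enorm (w t om) ^+ 2 / V))%:E <= (expR 1)%:E)%E.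
Proof.
have := @noise_exp t setT; rewrite probability_setT mule1; apply.
exact: (@measurableT _ (GT t)).
Qed.

Lemma initial_exp :
  (\int[P]_om (expR (enorm (x 0%N om) ^+ 2 / V))%:E <= (expR 1)%:E)%E.
Proof.
have := vector_exp measurableT (measurable_x 0).
rewrite probability_setT mule1; apply => i.
apply: psi2_norm_le (sys_sigma sys) (sys_x0 sys i).
exact/measurable_entry_comp/measurable_x.
Qed.

(** The normalised states are convex combinations of the normalised inputs, so
    they inherit the exponential moment of the inputs. *)
Lemma state_exp t : (t <= T)%N ->
  (\int[P]_om (expR (kap ^+ 2 / V * enorm (x t om) ^+ 2))%:E <= (expR 1)%:E)%E.
Proof.
have k0 := kap_gt0; have k1 := kap_le1; have v0 := V_gt0; have r0 := r_ge0.
have r1 : 0 <= r <= 1 by rewrite r0 ltW// (sys_contr sys).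
have mexp (c : R) (y : Omega -> 'cV[R]_n) : measurable_fun setT y ->
    measurable_fun setT (fun om => expR (c * enorm (y om) ^+ 2)).
  move=> my; apply: measurable_expR_comp; apply: measurable_funM => //.
  by apply: measurable_funX; exact: measurable_enorm_comp.
elim: t => [_|t IH tT].
  apply: le_trans initial_exp; apply: ge0_le_integral_real.
  - exact/mexp/measurable_x.
  - under eq_fun do rewrite mulrC; exact/mexp/measurable_x.
  - by move=> om; exact: expR_ge0.
  move=> om; rewrite ler_expR mulrAC -mulrA ler_piMl ?divr_ge0 ?sqr_ge0 ?(ltW v0)//.
  by rewrite expr_le1// ltW.
apply: (@le_trans _ _ (\int[P]_om (r * expR (kap ^+ 2 / V * enorm (x t om) ^+ 2) +
   kap * expR (V^-1 * enorm (w t om) ^+ 2))%:E)%E).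
  apply: ge0_le_integral_real.
  - exact/mexp/measurable_x.
  - apply: measurable_funD; apply: measurable_funM => //.
      exact/mexp/measurable_x.
    exact/mexp/measurable_w.
  - by move=> om; exact: expR_ge0.
  move=> om.
  apply: le_trans (expR_convex _ _ r1); rewrite ler_expR.
  apply: (@le_trans _ _ (kap ^+ 2 / V * (r * enorm (x t om) ^+ 2 + enorm (w t om) ^+ 2 / kap))).
    by rewrite ler_wpM2l ?sqr_enorm_next// divr_ge0 ?sqr_ge0// ltW.
  rewrite le_eqVlt; apply/orP; left; apply/eqP; field.
  by rewrite gt_eqF ?(sys_sigma sys)// gt_eqF ?ltr0n ?(sys_n sys)// gt_eqF.
have pexp (c : R) (y : Omega -> 'cV[R]_n) om : 0 <= expR (c * enorm (y om) ^+ 2).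
  exact: expR_ge0.
rewrite ge0_integralD_on; [|exact: measurableT
  |by apply: measurable_funM => //; exact/mexp/measurable_x
  |by apply: measurable_funM => //; exact/mexp/measurable_w
  |by move=> om; rewrite mulr_ge0|by move=> om; rewrite mulr_ge0// ltW].
rewrite [X in (X + _)%E]ge0_integralZl_on; [|exact: measurableT
  |exact/mexp/measurable_x|exact: pexp|exact: r0].
rewrite [X in (_ + X)%E]ge0_integralZl_on; [|exact: measurableT
  |exact/mexp/measurable_w|exact: pexp|exact: ltW].
have -> : (expR 1)%:E = (r%:E * (expR 1)%:E + kap%:E * (expR 1)%:E)%E :> \bar R.
  by rewrite -!EFinM -EFinD; congr EFin; ring.
apply: leeD; apply: lee_wpmul2l; rewrite ?lee_fin//.
- exact/IH/ltnW.
- exact: ltW.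
- by under eq_integral do rewrite mulrC; exact: noise_exp_total.
Qed.

Lemma state_sqr_integrable t : (t <= T)%N ->
  P.-integrable setT (EFin \o (fun om => enorm (x t om))) /\
  P.-integrable setT (EFin \o (fun om => enorm (x t om) ^+ 2)).
Proof.
move=> tT; apply: (@sqr_integrable_of_exp _ _ _ _ _ (kap ^+ 2 / V)).
- exact/measurable_enorm_comp/measurable_x.
- by rewrite divr_gt0 ?V_gt0// exprn_gt0// kap_gt0.
- by apply: le_lt_trans (state_exp tT) _; exact: ltry.
Qed.

Lemma noise_sqr_integrable t :
  P.-integrable setT (EFin \o (fun om => enorm (w t om))) /\
  P.-integrable setT (EFin \o (fun om => enorm (w t om) ^+ 2)).
Proof.
apply: (@sqr_integrable_of_exp _ _ _ _ _ V^-1).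
- exact/measurable_enorm_comp/measurable_w.
- by rewrite invr_gt0 V_gt0.
- under eq_integral do rewrite mulrC.
  by apply: le_lt_trans (noise_exp_total t) _; exact: ltry.
Qed.

(** Conditionally on the past each disturbance multiplies the exponential moment
    by at most [expR 1]. *)
Lemma energy_exp t : (t <= T)%N ->
  (\int[P]_om (expR ((enorm (x 0%N om) ^+ 2 +
      \sum_(0 <= s < t) enorm (w s om) ^+ 2) / V))%:E <= (expR t.+1%:R)%:E)%E.
Proof.
elim: t => [_|t IH tT].
  by under eq_integral do rewrite big_nil addr0; exact: initial_exp.
pose h om := expR ((enorm (x 0%N om) ^+ 2 + \sum_(0 <= s < t) enorm (w s om) ^+ 2) / V).
have mh : measurable_fun (setT : set (GT t)) h.
  apply: measurable_expR_comp; apply: measurable_funM => //; apply: measurable_funD.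
    by apply: measurable_funX; apply: measurable_enorm_comp; exact: x_history.
  rewrite (_ : (fun _ => _) = (fun om => \sum_(s < t) enorm (w s om) ^+ 2)); last first.
    by apply/funext => om; rewrite big_mkord.
  apply: measurable_sum => s; apply: measurable_funX; apply: measurable_enorm_comp.
  by apply: (w_history measurable_phi (sys_dyn sys)) => //; exact: ltn_trans (ltn_ord s) tT.
have mho : measurable_fun setT h := sub_measurable_fun (@history_measurable _ _ _ P n x t) mh.
have -> : (\int[P]_om (expR ((enorm (x 0%N om) ^+ 2 +
      \sum_(0 <= s < t.+1) enorm (w s om) ^+ 2) / V))%:E =
  \int[P]_om (h om * expR (enorm (w t om) ^+ 2 / V))%:E)%E.
  apply: eq_integral => om _; rewrite /h -expRD; congr (expR _)%:E.
  by rewrite big_nat_recr//= addrA -mulrDl.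
have h0 om : 0 <= h om by exact: expR_ge0.
apply: (@le_trans _ _ (\int[P]_om (h om * expR 1)%:E)%E).
  apply: (pull_out_le (@history_measurable _ _ _ P n x t)) => //.
  - apply: measurable_expR_comp; apply: measurable_funM => //; apply: measurable_funX.
    exact/measurable_enorm_comp/measurable_w.
  - move=> E hE; apply: (le_trans (noise_exp hE)).
    by rewrite -(integral_cst P (sub_measurable (@history_measurable _ _ _ P n x t) hE)).
under eq_integral do rewrite mulrC.
rewrite ge0_integralZl_on ?expR_ge0//.
apply: (@le_trans _ _ ((expR 1)%:E * (expR t.+1%:R)%:E)%E).
  by rewrite lee_wpmul2l ?lee_fin ?expR_ge0// IH// ltnW.
by rewrite -EFinM -expRD [t.+2%:R]mulrS.
Qed.

End system.

(** * The gradient of the loss at the true parameter *)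

Section gradient.
Context {d} {Omega : measurableType d} {R : realType}.
Variable P : probability Omega R.
Context {n m T : nat}.
Variables (phi : 'cV[R]_n -> 'cV[R]_m) (A : 'M[R]_(n, m)).
Variables (x w : nat -> {RV P >-> 'cV[R]_n}) (L sigma : R).
Hypothesis sys : stable_system T phi A x w L sigma.

Local Notation GT t := (g_sigma_algebraType (history x t)).
Local Notation r := (opnorm A * L).
Local Notation kap := (1 - opnorm A * L).
Local Notation V := (n%:R * sigma ^+ 2).

Lemma history_sub t : history x t `<=` measurable.
Proof. exact: (@history_measurable _ _ _ P n x t). Qed.

(** The form in which the independence of [w t] and the history enters all
    martingale arguments. *)
Lemma cond_centered t (f : 'cV[R]_n -> R) (c : R) (h : Omega -> R) (E : set Omega) :
  (t <= T)%N -> measurable_fun setT f ->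
  P.-integrable setT (fun om => (f (w t om))%:E) ->
  (\int[P]_om (f (w t om))%:E = c%:E)%E ->
  measurable_fun (setT : set (GT t)) h ->
  P.-integrable setT (EFin \o (fun om => h om * (f (w t om) - c))) ->
  <<s history x t >> E ->
  (\int[P]_(om in E) (h om * (f (w t om) - c))%:E = 0)%E.
Proof.
move=> tT mf iw wc mh ih hE.
have mE := sub_measurable (@history_sub t) hE.
have ic : P.-integrable setT (EFin \o cst c) by exact: finite_measure_integrable_cst.
have iD : P.-integrable setT (EFin \o (fun om => f (w t om) - c)).
  rewrite (_ : _ \o _ = (fun om => (f (w t om))%:E) \- (EFin \o cst c))%E.
    exact: integrableB.
  by apply/funext => om /=; rewrite EFinB.
have m1 : measurable_fun (setT : set (GT t)) (\1_E : GT t -> R).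
  exact: measurable_indic.
have ->: (\int[P]_(om in E) (h om * (f (w t om) - c))%:E =
    \int[P]_om ((\1_E om * h om) * (f (w t om) - c))%:E)%E.
  rewrite integral_mkcond; apply: eq_integral => om _.
  by rewrite epatch_indic -EFinM mulrC mulrA.
apply: (pull_out0 (@history_sub t) (D := fun om => f (w t om) - c)) => //.
- move=> F hF; have mF := sub_measurable (@history_sub t) hF.
  under eq_integral do rewrite EFinB.
  rewrite integralB_EFin//; [|exact: integrableS iw|exact: integrableS ic].
  rewrite (history_integral (measurable_phi sys) (sys_dyn sys) (sys_ind sys))// wc.
  rewrite integral_cst_on// muleC subee// fin_numM// fin_num_measure//.
- exact: measurable_funM.
- apply: (integrable_le_real _ (integrable_norm ih)) => [|om /=].
    apply: measurable_funM; first by apply: (sub_measurable_fun (@history_sub t)); exact: measurable_funM.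
    exact/measurable_EFinP/(measurable_int P iD).
  rewrite -mulrA normrM indicE; case: (om \in E); rewrite ?normr1 ?normr0 ?mul1r ?mul0r//.
Qed.

Section centered_part.
Variables (mu theta : R) (i : 'I_n) (c : nat -> R).
Hypothesis mu0 : 0 < mu.
Hypothesis theta0 : 0 < theta.
Hypothesis c_mean : forall t, (\int[P]_om (clip mu (w t om i ord0))%:E = (c t)%:E)%E.
Hypothesis c_bound : forall t, `|c t| <= mu.

Definition centered_increment t j om : R :=
  theta * (clip mu (w t om i ord0) - c t) * phi (x t om) j ord0.

Definition centered_sum t j om : R := \sum_(0 <= s < t) centered_increment s j om.

(** Discounts the accumulated squared lengths of the increments, each of length
    at most [theta * (2 * mu) * enorm (phi (x s))]; the factor 8 is that of
    [expR_sub_le_sqr] times [2 ^+ 2]. *)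
Definition centered_weight t om : R :=
  expR (- (8 * (theta * mu) ^+ 2 * \sum_(0 <= s < t) enorm (phi (x s om)) ^+ 2)).

Lemma measurable_clip : measurable_fun setT (fun v : 'cV[R]_n => clip mu (v i ord0)).
Proof.
apply: measurable_maxr => //; apply: measurable_minr => //.
exact: measurable_entry.
Qed.

Lemma phi_integrable t j : (t <= T)%N ->
  P.-integrable setT (EFin \o (fun om => phi (x t om) j ord0)).
Proof.
move=> tT; have [ix _] := state_sqr_integrable sys tT.
have ix' : P.-integrable setT (EFin \o (fun om => L * enorm (x t om))).
  rewrite (_ : _ \o _ = fun om => (L%:E * (EFin \o (fun om => enorm (x t om))) om)%E).
    exact: integrableZl.
  by apply/funext => om /=; rewrite EFinM.
apply: (integrable_le_real _ ix').
  by apply: measurable_entry_comp; exact: (measurableT_comp (measurable_phi sys) (measurable_x x t)).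
move=> om; apply: le_trans (enorm_phi sys _).
exact: (le_coord_nrm (fun j => phi (x t om) j ord0)).
Qed.

Lemma clip_integrable t : P.-integrable setT (fun om => (clip mu (w t om i ord0))%:E).
Proof.
have mc : measurable_fun setT (fun om => clip mu (w t om i ord0)).
  exact: (measurableT_comp measurable_clip (measurable_w w t)).
have ic : P.-integrable setT (EFin \o cst mu) by exact: finite_measure_integrable_cst.
by apply: (integrable_le_real mc ic) => om; exact: clip_bound.
Qed.

Lemma measurable_centered_increment t j :
  measurable_fun setT (centered_increment t j).
Proof.
apply: measurable_funM; last first.
  by apply: measurable_entry_comp; exact: (measurableT_comp (measurable_phi sys) (measurable_x x t)).
apply: measurable_funM => //; apply: measurable_funB => //.
exact: (measurableT_comp measurable_clip (measurable_w w t)).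
Qed.

Lemma clip_sub_bound t om : `|clip mu (w t om i ord0) - c t| <= 2 * mu.
Proof.
apply: (le_trans (ler_normB _ _)).
by have := clip_bound (w t om i ord0) mu0; have := c_bound t; lra.
Qed.

Lemma centered_increment_integrable t j : (t <= T)%N ->
  P.-integrable setT (EFin \o centered_increment t j).
Proof.
move=> tT.
have ip : P.-integrable setT (EFin \o (fun om => theta * (2 * mu) * `|phi (x t om) j ord0|)).
  rewrite (_ : _ \o _ = fun om => ((theta * (2 * mu))%:E *
      (EFin \o (Num.norm \o (fun om => phi (x t om) j ord0))) om)%E).
    by apply: integrableZl => //; apply: integrable_norm; exact: phi_integrable.
  by apply/funext => om /=; rewrite EFinM.
apply: (integrable_le_real (measurable_centered_increment t j) ip) => om.
rewrite !normrM ler_wpM2r// (gtr0_norm theta0) ler_wpM2l ?(ltW theta0)//.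
exact: clip_sub_bound.
Qed.

(** The increments are bounded by multiples of [enorm (phi (x t))], which are
    known one step in advance; the weight discounts their squares. *)
Lemma centered_exp t : (t <= T)%N ->
  (\int[P]_om (centered_weight t om * ch (nrm (fun j => centered_sum t j om)))%:E <= 1)%E.
Proof.
have mphix s u : (s <= u)%N -> measurable_fun (setT : set (GT u)) (fun om => enorm (phi (x s om))).
  by move=> su; apply: measurable_enorm_comp; exact: (phi_history (measurable_phi sys)).
have mweight u v : (u <= v.+1)%N -> measurable_fun (setT : set (GT v)) (centered_weight u).
  move=> uv; apply: measurable_expR_comp; apply: measurable_funN; apply: measurable_funM => //.
  rewrite (_ : (fun _ => _) = (fun om => \sum_(s < u) enorm (phi (x s om)) ^+ 2)).
    apply: measurable_sum => s; apply: measurable_funX; apply: mphix.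
    by rewrite -ltnS; exact: leq_trans (ltn_ord s) uv.
  by apply/funext => om; rewrite big_mkord.
have msum u j : (u <= T)%N -> measurable_fun (setT : set (GT u)) (centered_sum u j).
  move=> uT.
  rewrite (_ : centered_sum u j = (fun om => \sum_(s < u) centered_increment s j om)).
    apply: measurable_sum => s; apply: measurable_funM.
      apply: measurable_funM => //; apply: measurable_funB => //.
      apply: (measurableT_comp measurable_clip).
      apply: (w_history (measurable_phi sys) (sys_dyn sys)) => //.
      exact: leq_trans uT.
    by apply: measurable_entry_comp; apply: (phi_history (measurable_phi sys)); exact: ltnW.
  by apply/funext => om; rewrite /centered_sum big_mkord.
elim: t => [_|t IH tT].
  under eq_integral do rewrite /centered_weight /centered_sum big_nil mulr0 oppr0 expR0 mul1r.
  under eq_integral do under eq_fun do rewrite big_nil.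
  under eq_integral do rewrite nrm0 ch0.
  by rewrite integral_cst_on// probability_setT mule1.
pose b om := theta * (2 * mu) * enorm (phi (x t om)).
have mb : measurable_fun setT b.
  by apply: measurable_funM => //; apply: (sub_measurable_fun (@history_sub t)); exact: mphix.
have weightS om : centered_weight t.+1 om = centered_weight t om * expR (- (2 * b om ^+ 2)).
  rewrite /centered_weight -expRD; congr expR.
  by rewrite big_nat_recr//= /b; ring.
apply: (@le_trans _ _ (\int[P]_om (centered_weight t.+1 om *
    ch (nrm (fun j => centered_sum t j om)) * (expR (b om) - b om))%:E)%E).
  rewrite [leLHS](_ : _ = \int[P]_om (centered_weight t.+1 om *
     ch (nrm (fun j => centered_sum t j om + centered_increment t j om)))%:E)%E; last first.
    apply: eq_integral => om _; congr (_ * ch _)%:E; apply: nrm_eq => j.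
    by rewrite /centered_sum big_nat_recr.
  apply: (ch_martingale_step (@history_sub t)) => //.
  - by move=> j; apply: msum; exact: ltnW.
  - by move=> j; apply: centered_increment_integrable; exact: ltnW.
  - move=> j E hE.
    have ie : P.-integrable setT (EFin \o (fun om => (theta * phi (x t om) j ord0) *
        (clip mu (w t om i ord0) - c t))).
      rewrite (_ : _ \o _ = EFin \o centered_increment t j).
        by apply: centered_increment_integrable; exact: ltnW.
      by apply/funext => om /=; rewrite /centered_increment mulrAC.
    rewrite -[RHS](@cond_centered t (fun v => clip mu (v i ord0)) (c t)
      (fun om => theta * phi (x t om) j ord0) E (ltnW tT) measurable_clip (clip_integrable t)
      (c_mean t) _ ie hE).
      by apply: eq_integral => om _; rewrite /centered_increment mulrAC.
    apply: measurable_funM => //; apply: measurable_entry_comp.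
    exact: (phi_history (measurable_phi sys)).
  - by apply: mweight.
  - by move=> om; exact: expR_ge0.
  - move=> om; rewrite /centered_increment nrmZ normrM (gtr0_norm theta0) /b.
    by rewrite ler_wpM2r ?nrm_ge0// ler_wpM2l ?(ltW theta0)// clip_sub_bound.
apply: le_trans (IH (ltnW tT)).
have mch : measurable_fun setT (fun om => ch (nrm (fun j => centered_sum t j om))).
  apply: measurable_ch_comp; apply: measurable_nrm => j.
  by apply: (sub_measurable_fun (@history_sub t)); apply: msum; exact: ltnW.
have mW u : (u <= t.+1)%N -> measurable_fun setT (centered_weight u).
  by move=> ut; apply: (sub_measurable_fun (@history_sub t)); exact: mweight.
apply: ge0_le_integral_real.
- apply: measurable_funM; first by apply: measurable_funM => //; exact: mW.
  by apply: measurable_funB => //; exact: measurable_expR_comp.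
- by apply: measurable_funM => //; exact: mW.
- by move=> om; rewrite !mulr_ge0 ?expR_ge0 ?ch_ge0 ?expR_sub_ge0.
move=> om; rewrite weightS.
set W := centered_weight t om; set C := ch _.
have -> : W * expR (- (2 * b om ^+ 2)) * C * (expR (b om) - b om) =
  (W * C) * ((expR (b om) - b om) * expR (- (2 * b om ^+ 2))) by ring.
rewrite ler_piMr ?mulr_ge0 ?expR_ge0 ?ch_ge0//.
have b0 : 0 <= b om by rewrite !mulr_ge0 ?enorm_ge0 ?(ltW theta0)// ltW.
by rewrite expRN ler_pdivrMr ?expR_gt0// mul1r expR_sub_le_sqr.
Qed.

End centered_part.

Section drift_part.
Variables (B : 'M[R]_(m, n)) (c : nat -> R) (mu theta : R).
Hypothesis phiB : forall v, phi v = B *m v.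
Hypothesis B_L : opnorm B <= L.
Hypothesis w_mean : forall t k, (\int[P]_om (w t om k ord0)%:E = 0)%E.
Hypothesis c_bound : forall t, `|c t| <= mu.
Hypothesis mu0 : 0 < mu.
Hypothesis theta0 : 0 < theta.

Local Notation gam := (mu * L / kap).

(** The total weight with which the state at time [T - k] enters the sum of
    [c t *: phi (x t)] over [T - k <= t < T]. *)
Fixpoint tail_mx k : 'M[R]_(m, n) :=
  if k is k'.+1 then c (T - k) *: B + tail_mx k' *m A *m B else 0.

Lemma gam_ge0 : 0 <= gam.
Proof.
by rewrite divr_ge0 ?(ltW (kap_gt0 sys))// mulr_ge0 ?(ltW mu0)// ltW// (sys_L sys).
Qed.

Lemma tail_mx_bound k v : enorm (tail_mx k *m v) <= gam * enorm v.
Proof.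
have k0 := kap_gt0 sys.
elim: k v => [|k IH] v /=; first by rewrite mul0mx enorm0 mulr_ge0 ?gam_ge0 ?enorm_ge0.
rewrite mulmxDl; apply: (le_trans (enormD _ _)).
rewrite -scalemxAl enormZ -!mulmxA.
have Bv : enorm (B *m v) <= L * enorm v.
  by apply: (le_trans (enorm_mulmx _ _)); rewrite ler_wpM2r ?enorm_ge0.
have h1 : `|c (T - k.+1)| * enorm (B *m v) <= mu * (L * enorm v).
  by rewrite ler_pM ?enorm_ge0.
have h2 : enorm (tail_mx k *m (A *m (B *m v))) <= gam * (r * enorm v).
  apply: (le_trans (IH _)); rewrite ler_wpM2l ?gam_ge0// -mulrA.
  by apply: (le_trans (enorm_mulmx _ _)); rewrite ler_wpM2l ?opnorm_ge0.
apply: (le_trans (lerD h1 h2)); rewrite le_eqVlt; apply/orP; left; apply/eqP.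
by field; rewrite gt_eqF.
Qed.

(** In the linear case the mean [c s] of the clipped noise does not vanish, but
    [c s *: phi (x s)] is a linear function of the past inputs. Counting with each
    input its whole effect on the sum over all [T] steps makes the partial sums a
    martingale: the matrix [tail_mx (T - t)] carries the effect of [x t] on the
    steps that are still to come. *)
Definition drift_sum t j om : R :=
  theta * (\sum_(0 <= s < t) c s * phi (x s om) j ord0 +
           (tail_mx (T - t) *m x t om) j ord0).

Definition drift_increment t j om : R :=
  theta * (tail_mx (T - t.+1) *m w t om) j ord0.

Lemma drift_sumS t j om : (t < T)%N ->
  drift_sum t.+1 j om = drift_sum t j om + drift_increment t j om.
Proof.
move=> tT; rewrite /drift_sum /drift_increment -mulrDr; congr (_ * _).
have Tt : (T - t = (T - t.+1).+1)%N by rewrite subnSK.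
have tT' : (T - (T - t.+1).+1 = t)%N by rewrite -Tt subKn// ltnW.
rewrite Tt /= tT' big_nat_recr//= (sys_dyn sys)// phiB.
by rewrite mulmxDr mulmxDl -scalemxAl !mulmxA !mxE; ring.
Qed.

Lemma measurable_tail k j : measurable_fun setT (fun v : 'cV[R]_n => theta * (tail_mx k *m v) j ord0).
Proof.
by apply: measurable_funM => //; apply: measurable_entry_comp; exact: measurable_mulmx.
Qed.

Lemma w_entry_integrable t k : P.-integrable setT (EFin \o (fun om => w t om k ord0)).
Proof.
have [iw _] := noise_sqr_integrable sys t.
apply: (integrable_le_real _ iw).
  by apply: measurable_entry_comp; exact: measurable_w.
by move=> om; exact: (le_coord_nrm (fun k => w t om k ord0)).
Qed.

Lemma drift_increment_integrable t j : P.-integrable setT (EFin \o drift_increment t j).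
Proof.
have [iw _] := noise_sqr_integrable sys t.
have iw' : P.-integrable setT (EFin \o (fun om => theta * gam * enorm (w t om))).
  rewrite (_ : _ \o _ = fun om => ((theta * gam)%:E * (EFin \o (fun om => enorm (w t om))) om)%E).
    exact: integrableZl.
  by apply/funext => om /=; rewrite EFinM.
apply: (integrable_le_real _ iw').
  exact: (measurableT_comp (measurable_tail _ _) (measurable_w w t)).
move=> om; rewrite normrM (gtr0_norm theta0) -mulrA ler_wpM2l ?(ltW theta0)//.
apply: le_trans (tail_mx_bound _ _).
exact: (le_coord_nrm (fun j => (tail_mx (T - t.+1) *m w t om) j ord0)).
Qed.

Lemma drift_increment_mean t j : (\int[P]_om (drift_increment t j om)%:E = 0)%E.
Proof.
rewrite /drift_increment.
transitivity (\int[P]_om (\sum_k ((theta * tail_mx (T - t.+1) j k)%:E * (w t om k ord0)%:E)))%E.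
  apply: eq_integral => om _; rewrite mxE mulr_sumr -sumEFin; apply: eq_bigr => k _.
  by rewrite -EFinM mulrA.
rewrite integral_sum//.
  by apply: big1 => k _; rewrite integralZl ?w_mean ?mule0//; exact: w_entry_integrable.
by move=> k; apply: integrableZl => //; exact: w_entry_integrable.
Qed.

Local Notation alpha := (2 * (theta * gam) ^+ 2 * V).

Definition drift_growth : R := 1 - alpha + alpha * expR 1.

Hypothesis alpha1 : alpha <= 1.

Lemma drift_factor (v : 'cV[R]_n) :
  expR (theta * (gam * enorm v)) - theta * (gam * enorm v) <=
  1 - alpha + alpha * expR (enorm v ^+ 2 / V).
Proof.
set b := theta * (gam * enorm v).
have b0 : 0 <= b by rewrite mulr_ge0 ?(ltW theta0)// mulr_ge0 ?gam_ge0 ?enorm_ge0.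
apply: (le_trans (expR_sub_le_sqr b0)).
have a01 : 0 <= alpha <= 1.
  by rewrite alpha1 andbT mulr_ge0 ?(ltW (V_gt0 sys))// mulr_ge0// sqr_ge0.
apply: le_trans (expR_scale _ a01); rewrite ler_expR le_eqVlt; apply/orP; left; apply/eqP.
have n0 : n%:R != 0 :> R by rewrite pnatr_eq0 -lt0n (sys_n sys).
rewrite /b; field.
by rewrite n0 (gt_eqF (kap_gt0 sys)) (gt_eqF (sys_sigma sys)).
Qed.

(** The initial state is itself an input, so that [t] steps involve [t.+1] growth
    factors. *)
Lemma drift_exp t : (t <= T)%N ->
  (\int[P]_om (ch (nrm (fun j => drift_sum t j om)))%:E <= (drift_growth ^+ t.+1)%:E)%E.
Proof.
have e1 : 1 <= expR 1 :> R by rewrite -[leLHS]expR0 ler_expR.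
have a0 : 0 <= alpha by rewrite mulr_ge0 ?(ltW (V_gt0 sys))// mulr_ge0// sqr_ge0.
have g0 : 0 <= drift_growth by rewrite /drift_growth; nra.
have mb (y : Omega -> 'cV[R]_n) : measurable_fun setT y ->
    measurable_fun setT (fun om => theta * (gam * enorm (y om))).
  by move=> my; apply: measurable_funM => //; apply: measurable_funM => //; exact: measurable_enorm_comp.
have mb' (y : Omega -> 'cV[R]_n) : measurable_fun setT y -> measurable_fun setT
    (fun om => expR (theta * (gam * enorm (y om))) - theta * (gam * enorm (y om))).
  by move=> my; apply: measurable_funB; [apply: measurable_expR_comp|]; exact: mb.
have factor_int (y : Omega -> 'cV[R]_n) (E : set Omega) : measurable E -> measurable_fun setT y ->
    (\int[P]_(om in E) (expR (enorm (y om) ^+ 2 / V))%:E <= (expR 1)%:E * P E)%E ->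
    (\int[P]_(om in E) (expR (theta * (gam * enorm (y om))) - theta * (gam * enorm (y om)))%:E
      <= drift_growth%:E * P E)%E.
  move=> mE my hy.
  have me : measurable_fun setT (fun om => expR (enorm (y om) ^+ 2 / V)).
    apply: measurable_expR_comp; apply: measurable_funM => //; apply: measurable_funX.
    exact: measurable_enorm_comp.
  apply: (@le_trans _ _ (\int[P]_(om in E) ((1 - alpha) + alpha * expR (enorm (y om) ^+ 2 / V))%:E)%E).
    apply: ge0_le_integral_on => //; [exact: mb'| |by move=> om; rewrite expR_sub_ge0|by move=> om; exact: drift_factor].
    by apply: measurable_funD => //; exact: measurable_funM.
  have a1 : 0 <= 1 - alpha by rewrite subr_ge0.
  rewrite ge0_integralD_on; [|exact: mE|exact: measurable_cst|exact: measurable_funM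
    |by []|by move=> om; rewrite mulr_ge0 ?expR_ge0].
  rewrite integral_cst_on// ge0_integralZl_on; [|exact: mE|exact: me|by move=> om; exact: expR_ge0|exact: a0].
  apply: (@le_trans _ _ ((1 - alpha)%:E * P E + alpha%:E * ((expR 1)%:E * P E))%E).
    by rewrite leeD2l// lee_wpmul2l ?lee_fin.
  have -> : P E = (fine (P E))%:E by rewrite fineK// fin_num_measure.
  by rewrite -!EFinM -EFinD lee_fin /drift_growth; lra.
elim: t => [_|t IH tT].
  rewrite expr1.
  have := factor_int (x 0%N) setT measurableT (measurable_x x 0).
  rewrite probability_setT !mule1 => /(_ (initial_exp sys)); apply: le_trans.
  apply: ge0_le_integral_real; [| exact/mb'/measurable_x | by move=> om; exact: ch_ge0 |].
    apply: measurable_ch_comp; apply: measurable_nrm => j; rewrite /drift_sum.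
    under eq_fun do rewrite big_nil add0r.
    exact: (measurableT_comp (measurable_tail _ _) (measurable_x x 0)).
  move=> om.
  have hb : nrm (fun j => drift_sum 0 j om) <= theta * (gam * enorm (x 0%N om)).
    rewrite [leLHS](_ : _ = theta * enorm (tail_mx (T - 0) *m x 0%N om)).
      by rewrite ler_wpM2l ?(ltW theta0)// tail_mx_bound.
    rewrite enormE -[in RHS](gtr0_norm theta0) -nrmZ; apply: nrm_eq => j.
    by rewrite /drift_sum big_nil add0r.
  have := ch_nrmD (fun=> 0) hb.
  rewrite nrm0 ch0 mul1r big1 ?addr0; last by move=> j _; rewrite /ch_slope !mul0r.
  by rewrite (nrm_eq (g := fun j => drift_sum 0 j om))// => j; rewrite add0r.
pose b om := theta * (gam * enorm (w t om)).
have msum j : measurable_fun (setT : set (GT t)) (drift_sum t j).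
  apply: measurable_funM => //; apply: measurable_funD.
    rewrite (_ : (fun _ => _) = (fun om => \sum_(s < t) c s * phi (x s om) j ord0)).
      apply: measurable_sum => s; apply: measurable_funM => //; apply: measurable_entry_comp.
      by apply: (phi_history (measurable_phi sys)); exact: ltnW.
    by apply/funext => om; rewrite big_mkord.
  by apply: measurable_entry_comp; apply: measurable_mulmx; exact: x_history.
have -> : (\int[P]_om (ch (nrm (fun j => drift_sum t.+1 j om)))%:E =
    \int[P]_om (cst 1 om * ch (nrm (fun j => drift_sum t j om + drift_increment t j om)))%:E)%E.
  apply: eq_integral => om _; rewrite mul1r; congr (ch _)%:E; apply: nrm_eq => j.
  exact: drift_sumS.
have := @ch_martingale_growth _ _ _ P _ (@history_sub t) _ (drift_sum t) (drift_increment t) (cst 1)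
  msum (drift_increment_integrable t) _ _ _ b drift_growth _ _ g0 _.
rewrite exprS EFinM => h.
apply: (@le_trans _ _ (drift_growth%:E * \int[P]_om (cst 1 om * ch (nrm (fun j => drift_sum t j om)))%:E)%E); last first.
  rewrite lee_wpmul2l ?lee_fin//; under eq_integral do rewrite mul1r.
  exact/IH/ltnW.
apply: h => //.
- move=> j E hE.
  have := @cond_centered t (fun v => theta * (tail_mx (T - t.+1) *m v) j ord0) 0 (cst 1) E
    (ltnW tT) (measurable_tail _ _) (drift_increment_integrable t j) (drift_increment_mean t j).
  have -> : (EFin \o (fun om => cst 1 om * (theta * (tail_mx (T - t.+1) *m w t om) j ord0 - 0))) =
    EFin \o drift_increment t j.
    by apply/funext => om /=; rewrite mul1r subr0.
  move=> /(_ (measurable_cst _) (drift_increment_integrable t j) hE) <-.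
  by apply: eq_integral => om _; rewrite /drift_increment mul1r subr0.
- exact/mb/measurable_w.
- apply: aeW => om; rewrite /drift_increment nrmZ (gtr0_norm theta0) /b.
  by rewrite ler_wpM2l ?(ltW theta0)// tail_mx_bound.
- move=> E hE; apply: factor_int; [exact: (sub_measurable (@history_sub t))|exact: measurable_w|].
  exact: (noise_exp sys hE).
Qed.

End drift_part.
End gradient.

Section real_integrable.
Context {d} {Omega : measurableType d} {R : realType}.
Variable P : probability Omega R.

Lemma integrableZl_real (c : R) (f : Omega -> R) :
  P.-integrable setT (EFin \o f) -> P.-integrable setT (EFin \o (fun om => c * f om)).
Proof.
move=> jf; rewrite (_ : EFin \o _ = (fun om => c%:E * (EFin \o f) om)%E).
  exact: integrableZl.
by apply/funext => om /=; rewrite EFinM.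
Qed.

Lemma integrableB_real (f g : Omega -> R) :
  P.-integrable setT (EFin \o f) -> P.-integrable setT (EFin \o g) ->
  P.-integrable setT (EFin \o (fun om => f om - g om)).
Proof.
move=> jf jg; rewrite (_ : EFin \o _ = (EFin \o f) \- (EFin \o g))%E.
  exact: integrableB.
by apply/funext => om /=; rewrite EFinB.
Qed.

Lemma integrable_cst_real (c : R) : P.-integrable setT (EFin \o (fun=> c)).
Proof. exact: finite_measure_integrable_cst. Qed.

End real_integrable.

(** * Excitation at odd times *)

Section excitation.
Context {d} {Omega : measurableType d} {R : realType}.
Variable P : probability Omega R.
Context {n m T : nat}.
Variables (phi : 'cV[R]_n -> 'cV[R]_m) (A : 'M[R]_(n, m)).
Variables (x w : nat -> {RV P >-> 'cV[R]_n}) (L sigma : R).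
Hypothesis sys : stable_system T phi A x w L sigma.

Local Notation GT t := (g_sigma_algebraType (history x t)).
Local Notation r := (opnorm A * L).
Local Notation kap := (1 - opnorm A * L).
Local Notation V := (n%:R * sigma ^+ 2).
Local Notation K2 := (L ^+ 2 * V / kap ^+ 2).

Variables (mu eta : R) (i : 'I_n) (p : nat -> R) (M : nat -> Omega -> 'M[R]_m).
Hypothesis eta_gt0 : 0 < eta.
Hypothesis eta_le : eta <= 4^-1.

Definition small_noise : set 'cV[R]_n := [set v | `|v i ord0| <= mu / 2].

Hypothesis p_mean : forall t, (\int[P]_om (\1_small_noise (w t om) : R)%:E = (p t)%:E)%E.
Hypothesis p01 : forall t, 0 <= p t <= 1.
Hypothesis M_cond : forall j, (j.*2.+1 < T)%N -> forall a b,
  is_cond_expectation P (natural_filtration x j.*2)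
    (fun om => (phi (x j.*2.+1 om) *m (phi (x j.*2.+1 om))^T) a b)
    (fun om => M j om a b).

(** Half of the steps being even, the energy bound leaves a positive fraction of
    the even times with states of this size. The curvature is collected at the
    odd time that follows, whose feature is excited given the even time. *)
Definition moderate j : set Omega := [set om | enorm (x j.*2 om) ^+ 2 <= 24 * V / kap ^+ 2].

Definition outer j (ab : 'I_m * 'I_m) om : R :=
  phi (x j.*2.+1 om) ab.1 ord0 * phi (x j.*2.+1 om) ab.2 ord0.

(** Normalised by [K2], the scale of the squared norms of the features. *)
Definition excitation_increment j (ab : 'I_m * 'I_m) om : R :=
  eta / K2 * (\1_(moderate j) om *
    (\1_small_noise (w j.*2.+1 om) * outer j ab om - p j.*2.+1 * M j om ab.1 ab.2)).

Definition excitation_sum j ab om : R := \sum_(0 <= s < j) excitation_increment s ab om.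

Let hs t : history x t `<=` measurable := @history_measurable _ _ _ P n x t.

Lemma K2_gt0 : 0 < K2.
Proof.
by rewrite divr_gt0 ?exprn_gt0 ?(kap_gt0 sys)// mulr_gt0 ?(V_gt0 sys)// exprn_gt0// (sys_L sys).
Qed.

Lemma moderate_history j : <<s history x j.*2 >> (moderate j).
Proof.
have mf : measurable_fun (setT : set (GT j.*2)) (fun om => enorm (x j.*2 om) ^+ 2).
  by apply: measurable_funX; apply: measurable_enorm_comp; exact: x_history.
have := mf measurableT `]-oo, 24 * V / kap ^+ 2]%classic (measurable_itv _).
by rewrite setTI.
Qed.

Lemma outer_measurable j ab t : (j.*2 < t)%N ->
  measurable_fun (setT : set (GT t)) (outer j ab).
Proof.
by move=> jt; apply: measurable_funM; apply: measurable_entry_comp;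
  exact: (phi_history (measurable_phi sys)).
Qed.

Lemma nrm_outer_x j om : nrm (fun ab => outer j ab om) = enorm (phi (x j.*2.+1 om)) ^+ 2.
Proof. exact: (nrm_outer (fun a => phi (x j.*2.+1 om) a ord0)). Qed.

(** One step of [sqr_enorm_next] from a moderate state. *)
Lemma outer_bound j om : (j.*2.+1 < T)%N -> moderate j om ->
  nrm (fun ab => outer j ab om) <= K2 * (24 + enorm (w j.*2 om) ^+ 2 / V).
Proof.
move=> jT mo; rewrite nrm_outer_x.
have k0 := kap_gt0 sys; have k1 := kap_le1 sys; have v0 := V_gt0 sys.
apply: (@le_trans _ _ ((L * enorm (x j.*2.+1 om)) ^+ 2)).
  rewrite lerXn2r ?nnegrE ?enorm_ge0 ?(enorm_phi sys)//.
  by rewrite mulr_ge0 ?enorm_ge0// ltW// (sys_L sys).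
rewrite exprMn -mulrA -mulrA ler_wpM2l ?sqr_ge0//.
apply: (le_trans (sqr_enorm_next sys om (ltnW jT))).
have h1 : r * enorm (x j.*2 om) ^+ 2 <= 24 * V / kap ^+ 2.
  apply: le_trans mo; rewrite ler_piMl ?sqr_ge0//; exact/ltW/(sys_contr sys).
have h2 : enorm (w j.*2 om) ^+ 2 / kap <= enorm (w j.*2 om) ^+ 2 / kap ^+ 2.
  rewrite ler_wpM2l ?sqr_ge0// lef_pV2 ?posrE ?exprn_gt0//.
  by rewrite expr2 ler_piMl// ltW.
apply: (le_trans (lerD h1 h2)); rewrite le_eqVlt; apply/orP; left; apply/eqP.
have n0 : n%:R != 0 :> R by rewrite pnatr_eq0 -lt0n (sys_n sys).
by field; rewrite n0 (gt_eqF k0) (gt_eqF (sys_sigma sys)).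
Qed.

Lemma M_integrable j a b : (j.*2.+1 < T)%N ->
  P.-integrable setT (EFin \o (fun om => M j om a b)).
Proof. by move=> jT; have [] := M_cond jT a b. Qed.

Lemma M_history j a b : (j.*2.+1 < T)%N ->
  measurable_fun (setT : set (GT j.*2)) (fun om => M j om a b).
Proof. by move=> jT _ B mB; have [_ _ h _] := M_cond jT a b; apply: h; exists B. Qed.

Lemma outerE j ab : (fun om => (phi (x j.*2.+1 om) *m (phi (x j.*2.+1 om))^T) ab.1 ab.2) =
  outer j ab.
Proof. by apply/funext => om; rewrite mxE big_ord1 mxE. Qed.

Lemma outer_integrable j ab : (j.*2.+1 < T)%N -> P.-integrable setT (EFin \o outer j ab).
Proof. by move=> jT; have [+ _ _ _] := M_cond jT ab.1 ab.2; rewrite outerE. Qed.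

Lemma outer_sub_M_mean j ab E : (j.*2.+1 < T)%N -> <<s history x j.*2 >> E ->
  (\int[P]_(om in E) (outer j ab om - M j om ab.1 ab.2)%:E = 0)%E.
Proof.
move=> jT hE; have mE := sub_measurable (@hs j.*2) hE.
have h : (\int[P]_(om in E) (M j om ab.1 ab.2)%:E = \int[P]_(om in E) (outer j ab om)%:E)%E.
  have [_ _ _ ->//] := M_cond jT ab.1 ab.2.
  by apply: eq_integral => om _; rewrite mxE big_ord1 mxE.
under eq_integral do rewrite EFinB.
rewrite integralB_EFin//; [|exact: integrableS (outer_integrable ab jT)|
  exact: integrableS (M_integrable ab.1 ab.2 jT)].
rewrite -h subee//.
exact: (integrable_fin_num _ (integrableS measurableT mE (@subsetT _ _) (M_integrable ab.1 ab.2 jT))).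
Qed.

Lemma outer_sub_M_integrable j ab : (j.*2.+1 < T)%N ->
  P.-integrable setT (EFin \o (fun om => outer j ab om - M j om ab.1 ab.2)).
Proof.
by move=> jT; apply: integrableB_real; [exact: outer_integrable|exact: M_integrable].
Qed.

Lemma normalised_noise_integrable t :
  P.-integrable setT (EFin \o (fun om => enorm (w t om) ^+ 2 / V)).
Proof.
have [_ iw] := noise_sqr_integrable sys t.
rewrite (_ : (fun _ => _) = (fun om => V^-1 * enorm (w t om) ^+ 2)).
  exact: integrableZl_real.
by apply/funext => om; rewrite mulrC.
Qed.

Lemma normalised_noise_mean t E : <<s history x t >> E ->
  (\int[P]_(om in E) (enorm (w t om) ^+ 2 / V)%:E <= P E)%E.
Proof.
move=> hE; have mE := sub_measurable (@hs t) hE.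
have e0 : 0 < expR 1 :> R by exact: expR_gt0.
have mw : measurable_fun setT (fun om => enorm (w t om) ^+ 2 / V).
  apply: measurable_funM => //; apply: measurable_funX.
  exact/measurable_enorm_comp/measurable_w.
have w0 om : 0 <= enorm (w t om) ^+ 2 / V by rewrite divr_ge0 ?sqr_ge0// ltW// (V_gt0 sys).
have : (\int[P]_(om in E) (expR 1 * (enorm (w t om) ^+ 2 / V))%:E <= (expR 1)%:E * P E)%E.
  apply: le_trans (noise_exp sys hE); apply: ge0_le_integral_on => //.
  - exact: measurable_funM.
  - exact: measurable_expR_comp.
  - by move=> om; rewrite mulr_ge0// ltW.
  - by move=> om; exact: expR1_mul_le.
rewrite ge0_integralZl_on// ?(ltW e0)//.
have -> : P E = (fine (P E))%:E by rewrite fineK// fin_num_measure.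
by rewrite lee_pmul2l ?lte_fin.
Qed.

(** Tested against its own direction on the event where the bound fails, the
    conditional second moment is at most the conditional mean of the bound of
    [outer_bound], in which the normalised disturbance has mean at most 1. *)
Lemma M_bound j : (j.*2.+1 < T)%N ->
  {ae P, forall om, moderate j om -> nrm (fun ab : 'I_m * 'I_m => M j om ab.1 ab.2) <= 25 * K2}.
Proof.
move=> jT.
pose nM om := nrm (fun ab : 'I_m * 'I_m => M j om ab.1 ab.2).
have mnM : measurable_fun (setT : set (GT j.*2)) nM.
  by apply: measurable_nrm => ab; exact: M_history.
pose E := moderate j `&` [set om | 25 * K2 < nM om].
have hE : <<s history x j.*2 >> E.
  apply: (@measurableI _ (GT j.*2)); first exact: moderate_history.
  have := mnM measurableT `]25 * K2, +oo[%classic (measurable_itv _).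
  rewrite setTI; congr (<<s _ >> _).
  by apply/seteqP; split => om /=; rewrite in_itv/= andbT.
have mE := sub_measurable (@hs j.*2) hE.
have m1E : measurable_fun (setT : set (GT j.*2)) (\1_E : GT j.*2 -> R) by exact: measurable_indic.
pose h (ab : 'I_m * 'I_m) om : R := \1_E om * (M j om ab.1 ab.2 * nM om `^ (-1)).
have mh ab : measurable_fun (setT : set (GT j.*2)) (h ab).
  apply: measurable_funM => //; apply: measurable_funM; first exact: M_history.
  exact: (measurableT_comp (measurable_powR (-1)) mnM).
have nM0 om : 0 <= nM om by exact: nrm_ge0.
have h1 ab om : `|h ab om| <= 1.
  rewrite /h normrM indicE; case: (om \in E); last by rewrite normr0 mul0r.
  rewrite normr1 mul1r powR_inv1// normrM normfV (ger0_norm (nM0 om)).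
  have [->|n0] := eqVneq (nM om) 0; first by rewrite invr0 mulr0.
  rewrite ler_pdivrMr ?lt0r ?n0 ?nM0// mul1r.
  exact: (le_coord_nrm (fun ab : 'I_m * 'I_m => M j om ab.1 ab.2) ab).
pose Df (ab : 'I_m * 'I_m) om := outer j ab om - M j om ab.1 ab.2.
have ihD ab : P.-integrable setT (EFin \o (fun om => h ab om * Df ab om)).
  apply: (integrable_le_real _ (integrable_norm (outer_sub_M_integrable ab jT))).
    apply: measurable_funM; first exact: (sub_measurable_fun (@hs j.*2)).
    exact/measurable_EFinP/(measurable_int P (outer_sub_M_integrable ab jT)).
  by move=> om; rewrite normrM ler_piMl.
pose Y om := \sum_ab h ab om * Df ab om.
have iY : P.-integrable setT (EFin \o Y).
  rewrite (_ : EFin \o Y = fun om => (\sum_(ab <- index_enum _) (h ab om * Df ab om)%:E)%E).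
    by apply: integrable_sum => // ab _; exact: ihD.
  by apply/funext => om /=; rewrite sumEFin.
have EY : (\int[P]_om (Y om)%:E = 0)%E.
  rewrite /Y; under eq_integral do rewrite -sumEFin.
  rewrite integral_sum//; apply: big1 => ab _.
  apply: (pull_out0 (@hs j.*2) (outer_sub_M_integrable ab jT)) => //.
    by move=> F hF; exact: outer_sub_M_mean.
  exact: ihD.
pose ome om := enorm (w j.*2 om) ^+ 2 / V.
pose X om : R := \1_E om * (nM om - 25 * K2).
pose Z om : R := \1_E om * (K2 * (ome om - 1)) - Y om.
have XZ om : X om <= Z om.
  rewrite /X /Z /Y; have [oE|oE] := boolP (om \in E); last first.
    rewrite indicE (negbTE oE) !mul0r sub0r big1 ?oppr0// => ab _.
    by rewrite /h indicE (negbTE oE) !mul0r.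
  rewrite indicE oE !mul1r.
  move: (oE); rewrite inE => -[mo big].
  have ngt0 : 0 < nM om by apply: lt_trans big; rewrite mulr_gt0// K2_gt0.
  have hE1 ab : h ab om = M j om ab.1 ab.2 / nM om.
    by rewrite /h indicE oE mul1r powR_inv1.
  have -> : \sum_ab h ab om * Df ab om =
      dot (fun ab : 'I_m * 'I_m => M j om ab.1 ab.2) (fun ab => outer j ab om) / nM om - nM om.
    have e2 : nM om = (\sum_(ab : 'I_m * 'I_m) M j om ab.1 ab.2 ^+ 2) / nM om.
      by rewrite -(@sqr_nrm _ _ (fun ab : 'I_m * 'I_m => M j om ab.1 ab.2)) expr2 mulfK ?gt_eqF.
    rewrite [X in _ - X]e2 /dot -mulrBl -sumrB mulr_suml; apply: eq_bigr => ab _.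
    by rewrite hE1 /Df; ring.
  have cs := cauchy_schwarz (fun ab : 'I_m * 'I_m => M j om ab.1 ab.2) (fun ab => outer j ab om).
  have h2 : dot (fun ab : 'I_m * 'I_m => M j om ab.1 ab.2) (fun ab => outer j ab om) / nM om <=
      nrm (fun ab => outer j ab om).
    by rewrite ler_pdivrMr// mulrC; apply: le_trans cs; exact: ler_norm.
  have := outer_bound jT mo; rewrite -/(ome om); lra.
have X0 om : 0 <= X om.
  rewrite /X indicE; have [|] := boolP (om \in E); last by rewrite mul0r.
  by rewrite inE => -[_ /ltW big]; rewrite mul1r subr_ge0.
have mnMo := sub_measurable_fun (@hs j.*2) mnM.
have mX : measurable_fun setT X.
  by apply: measurable_funM; [exact: measurable_indic|exact: measurable_funB].
have ioE : P.-integrable setT (EFin \o (fun om => \1_E om * (K2 * (ome om - 1)))).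
  have i1 : P.-integrable setT (EFin \o (fun om => K2 * (ome om - 1))).
    apply: integrableZl_real; apply: integrableB_real; last exact: integrable_cst_real.
    exact: normalised_noise_integrable.
  apply: (integrable_le_real _ (integrable_norm i1)).
    apply: measurable_funM; first exact: measurable_indic.
    exact/measurable_EFinP/(measurable_int P i1).
  move=> om /=; rewrite normrM indicE; case: (om \in E); rewrite ?normr1 ?normr0 ?mul1r ?mul0r//.
have Xle0 : (\int[P]_om (X om)%:E <= 0)%E.
  apply: (@le_trans _ _ (\int[P]_om (Z om)%:E)%E).
    apply: ge0_le_integral_real => //.
    apply: measurable_funB; first exact/measurable_EFinP/(measurable_int P ioE).
    exact/measurable_EFinP/(measurable_int P iY).
  under eq_integral do rewrite EFinB.
  rewrite integralB_EFin// EY sube0.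
  have -> : (\int[P]_om (\1_E om * (K2 * (ome om - 1)))%:E =
     K2%:E * (\int[P]_(om in E) (ome om)%:E - P E))%E.
    have iome := integrableS measurableT mE (@subsetT _ _) (normalised_noise_integrable j.*2).
    have icst : P.-integrable E (EFin \o cst (1 : R)) by exact: finite_measure_integrable_cst.
    have -> : P E = (\int[P]_(om in E) (cst 1 om)%:E)%E by rewrite integral_cst_on// mul1e.
    rewrite -integralB_EFin// -integralZl//; last exact: integrableB.
    rewrite [RHS]integral_mkcond; apply: eq_integral => om _.
    by rewrite epatch_indic muleC -EFinB -EFinM.
  apply: mule_ge0_le0; first by rewrite lee_fin ltW// K2_gt0.
  by rewrite sube_le0 normalised_noise_mean.
have Xz : (\int[P]_om `|(X om)%:E| = 0)%E.
  apply/eqP; rewrite eq_le integral_ge0// andbT.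
  by under eq_integral do rewrite gee0_abs ?lee_fin//.
have mXE : measurable_fun setT (EFin \o X) by exact/measurable_EFinP.
have /(ae_eq_integral_abs P measurableT mXE) := Xz.
apply: filterS => om /(_ Logic.I) /= [Xom] mo.
rewrite leNgt; apply/negP => big.
have : X om = nM om - 25 * K2 by rewrite /X indicE mem_set ?mul1r.
by rewrite Xom => /esym/eqP; rewrite subr_eq0 => /eqP e; rewrite /nM in e; rewrite e ltxx in big.
Qed.

(** The summands 24 and 25 of [outer_bound] and [M_bound]. *)
Definition excitation_bound j om : R := eta * (49 + enorm (w j.*2 om) ^+ 2 / V).

Lemma indic01 (E : set Omega) om : 0 <= (\1_E om : R) <= 1.
Proof. by rewrite indicE; case: (om \in E); rewrite ?ler01 ?lexx. Qed.

Lemma nrm_excitation_increment j : (j.*2.+1 < T)%N ->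
  {ae P, forall om, nrm (fun ab => excitation_increment j ab om) <= excitation_bound j om}.
Proof.
move=> jT; apply: filterS (M_bound jT) => om hM.
have K0 := K2_gt0.
have w0 : 0 <= enorm (w j.*2 om) ^+ 2 / V by rewrite divr_ge0 ?sqr_ge0// ltW// (V_gt0 sys).
rewrite /excitation_increment /excitation_bound nrmZ (gtr0_norm (divr_gt0 eta_gt0 K0)).
set N := nrm _; have -> : eta / K2 * N = eta * (N / K2) by ring.
rewrite ler_wpM2l ?(ltW eta_gt0)// ler_pdivrMr// /N nrmZ.
have [mo|nmo] := pselect (moderate j om); last first.
  by rewrite indicE memNset// normr0 mul0r mulr_ge0 ?(ltW K0)// addr_ge0.
rewrite indicE mem_set// normr1 mul1r.
have /andP[p0 p1] := p01 j.*2.+1.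
apply: (@le_trans _ _ (nrm (fun ab => \1_small_noise (w j.*2.+1 om) * outer j ab om)
    + nrm (fun ab : 'I_m * 'I_m => - p j.*2.+1 * M j om ab.1 ab.2))).
  apply: le_trans (nrmD _ _); rewrite le_eqVlt; apply/orP; left; apply/eqP.
  by apply: nrm_eq => ab; rewrite mulNr.
rewrite !nrmZ normrN (ger0_norm p0).
have s1 : `|\1_small_noise (w j.*2.+1 om) : R| <= 1.
  by rewrite indicE; case: (_ \in _); rewrite ?normr1 ?normr0.
have h1 : `|\1_small_noise (w j.*2.+1 om) : R| * nrm (fun ab => outer j ab om) <=
    K2 * (24 + enorm (w j.*2 om) ^+ 2 / V).
  apply: le_trans (outer_bound jT mo); by rewrite ler_piMl ?nrm_ge0.
have h2 : p j.*2.+1 * nrm (fun ab : 'I_m * 'I_m => M j om ab.1 ab.2) <= 25 * K2.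
  by apply: le_trans (hM mo); rewrite ler_piMl ?nrm_ge0.
lra.
Qed.

Definition excitation_growth : R := 1 + 64 * expR 26 * eta ^+ 2.

(** Since [eta <= 4^-1], one factor [expR (y / 4)] with [y = 49 + u] majorises the
    exponential in [expR_sub_le_1D] and another one its quadratic factor; 25 is
    [49 / 2] rounded up. *)
Lemma excitation_factor om j :
  expR (excitation_bound j om) - excitation_bound j om <=
  1 + 64 * expR 25 * eta ^+ 2 * expR (enorm (w j.*2 om) ^+ 2 / V).
Proof.
have w0 : 0 <= enorm (w j.*2 om) ^+ 2 / V by rewrite divr_ge0 ?sqr_ge0// ltW// (V_gt0 sys).
rewrite /excitation_bound; move: w0; set u := _ / V => w0; have [y yE] : exists y, y = 49 + u by exists (49 + u).
rewrite -yE; have y0 : 0 <= y by rewrite yE; lra.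
have b0 : 0 <= eta * y by rewrite mulr_ge0// ltW.
apply: (le_trans (expR_sub_le_1D b0)); rewrite lerD2l.
have z2 : (y / 4) ^+ 2 / 2 <= expR (y / 4).
  have h0 : 0 <= y / 4 by lra.
  have := expR_ge1Dxn 1 h0; rewrite (_ : 2`!%:R = 2 :> R)//.
  by apply: le_trans; rewrite lerDr.
have e1 : expR (eta * y) <= expR (y / 4) by rewrite ler_expR [leRHS]mulrC ler_wpM2r.
have e2 : expR (y / 4) * expR (y / 4) <= expR 25 * expR u.
  by rewrite -!expRD ler_expR yE; lra.
have -> : 2 * (eta * y) ^+ 2 * expR (eta * y) =
  64 * eta ^+ 2 * ((y / 4) ^+ 2 / 2 * expR (eta * y)) by field.
have -> : 64 * expR 25 * eta ^+ 2 * expR u = 64 * eta ^+ 2 * (expR 25 * expR u) by ring.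
apply: ler_wpM2l; first by rewrite mulr_ge0 ?sqr_ge0.
apply: le_trans _ e2; apply: ler_pM => //.
by rewrite divr_ge0 ?sqr_ge0.
Qed.

Lemma moderate_indic j t : (j.*2 <= t)%N ->
  measurable_fun (setT : set (GT t)) (\1_(moderate j) : Omega -> R).
Proof.
move=> jt; apply: (history_fun_mono jt).
by apply: (@measurable_indic _ (GT j.*2)); exact: moderate_history.
Qed.

Lemma measurable_small_noise : measurable_fun setT (\1_small_noise : 'cV[R]_n -> R).
Proof.
apply: measurable_indic.
rewrite (_ : small_noise = (fun v => `|v i ord0|) @^-1` `]-oo, mu / 2]%classic).
  rewrite -[X in measurable X]setTI.
  have mf : measurable_fun setT (fun v : 'cV[R]_n => `|v i ord0|).
    by apply: measurableT_comp => //; exact: measurable_entry.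
  exact: mf.
by apply/seteqP; split => v /=; rewrite in_itv.
Qed.

Lemma excitation_increment_history j ab t : (j.*2.+1 < t)%N -> (j.*2.+1 < T)%N ->
  measurable_fun (setT : set (GT t)) (excitation_increment j ab).
Proof.
move=> jt jT; apply: measurable_funM => //; apply: measurable_funM.
  by apply: moderate_indic; rewrite ltnW// ltnW.
apply: measurable_funB; apply: measurable_funM => //.
- apply: (measurableT_comp measurable_small_noise).
  exact: (w_history (measurable_phi sys) (sys_dyn sys)).
- by apply: outer_measurable; exact: ltnW.
- apply: (@history_fun_mono _ _ _ P n x j.*2 t); first by rewrite ltnW// ltnW.
  exact: M_history.
Qed.

Lemma bounded_mul_integrable (g f : Omega -> R) :
  measurable_fun setT g -> (forall om, `|g om| <= 1) ->
  P.-integrable setT (EFin \o f) -> P.-integrable setT (EFin \o (fun om => g om * f om)).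
Proof.
move=> mg g1 jf; apply: (integrable_le_real _ (integrable_norm jf)).
  by apply: measurable_funM => //; exact/measurable_EFinP/(measurable_int P jf).
by move=> om; rewrite normrM ler_piMl.
Qed.

Lemma norm_indic_le1 {T'} (E : set T') om : `|(\1_E om : R)| <= 1.
Proof. by rewrite indicE; case: (om \in E); rewrite ?normr1 ?normr0. Qed.

(** The two summands are centred for different reasons: the first one by the
    independence of the disturbance at the odd time and the history, the second
    one by the choice of [M]. *)
Lemma excitation_increment_split j ab : excitation_increment j ab =
  (fun om => (eta / K2 * (\1_(moderate j) om * outer j ab om)) *
               (\1_small_noise (w j.*2.+1 om) - p j.*2.+1) +
             (eta / K2 * p j.*2.+1 * \1_(moderate j) om) *
               (outer j ab om - M j om ab.1 ab.2)).
Proof. by apply/funext => om; rewrite /excitation_increment; ring. Qed.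

Lemma excitation_fluct1_integrable j ab : (j.*2.+1 < T)%N ->
  P.-integrable setT (EFin \o (fun om => (eta / K2 * (\1_(moderate j) om * outer j ab om)) *
               (\1_small_noise (w j.*2.+1 om) - p j.*2.+1))).
Proof.
move=> jT.
rewrite (_ : (fun _ => _) = fun om => (\1_small_noise (w j.*2.+1 om) - p j.*2.+1) *
   (eta / K2 * (\1_(moderate j) om * outer j ab om))); last first.
  by apply/funext => om; rewrite mulrC.
apply: bounded_mul_integrable.
- apply: measurable_funB => //.
  exact: (measurableT_comp measurable_small_noise (measurable_w w _)).
- move=> om; have /andP[p0 p1] := p01 j.*2.+1.
  by rewrite indicE; case: (_ \in _); rewrite ler_norml; apply/andP; split=> /=; lra.
apply: integrableZl_real; apply: bounded_mul_integrable.
- exact: (sub_measurable_fun (@hs j.*2) (moderate_indic (leqnn _))).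
- by move=> om; exact: norm_indic_le1.
- exact: outer_integrable.
Qed.

Lemma excitation_fluct2_integrable j ab : (j.*2.+1 < T)%N ->
  P.-integrable setT (EFin \o (fun om => (eta / K2 * p j.*2.+1 * \1_(moderate j) om) *
               (outer j ab om - M j om ab.1 ab.2))).
Proof.
move=> jT.
rewrite (_ : (fun _ => _) = fun om => eta / K2 * p j.*2.+1 * (\1_(moderate j) om *
               (outer j ab om - M j om ab.1 ab.2))); last first.
  by apply/funext => om; ring.
apply: integrableZl_real; apply: bounded_mul_integrable.
- exact: (sub_measurable_fun (@hs j.*2) (moderate_indic (leqnn _))).
- by move=> om; exact: norm_indic_le1.
- exact: outer_sub_M_integrable.
Qed.

Lemma excitation_increment_integrable j ab : (j.*2.+1 < T)%N ->
  P.-integrable setT (EFin \o excitation_increment j ab).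
Proof.
move=> jT; rewrite excitation_increment_split.
have := integrableD measurableT (excitation_fluct1_integrable ab jT) (excitation_fluct2_integrable ab jT).
by apply: eq_integrable => // om _ /=; rewrite EFinD.
Qed.

Lemma excitation_increment_mean j ab E : (j.*2.+1 < T)%N -> <<s history x j.*2 >> E ->
  (\int[P]_(om in E) (excitation_increment j ab om)%:E = 0)%E.
Proof.
move=> jT hE; have mE := sub_measurable (@hs j.*2) hE.
rewrite excitation_increment_split.
under eq_integral do rewrite EFinD.
rewrite integralD_EFin//; [|exact: integrableS (excitation_fluct1_integrable ab jT)
  |exact: integrableS (excitation_fluct2_integrable ab jT)].
have -> : (\int[P]_(om in E) (eta / K2 * (\1_(moderate j) om * outer j ab om) *
   (\1_small_noise (w j.*2.+1 om) - p j.*2.+1))%:E = 0)%E.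
  apply: (@cond_centered _ _ _ P _ _ _ _ _ _ _ _ _ sys j.*2.+1 (\1_small_noise)) => //.
  - exact: ltnW.
  - exact: measurable_small_noise.
  - apply: (integrable_le_real _ (integrable_cst_real P 1)).
      exact: (measurableT_comp measurable_small_noise (measurable_w w _)).
    by move=> om; exact: norm_indic_le1.
  - apply: measurable_funM => //; apply: measurable_funM; first exact: moderate_indic.
    exact: outer_measurable.
  - exact: excitation_fluct1_integrable.
  - exact: (history_mono (leqnSn _) hE).
rewrite add0e integral_mkcond.
transitivity (\int[P]_om ((\1_E om * (eta / K2 * p j.*2.+1 * \1_(moderate j) om)) *
    (outer j ab om - M j om ab.1 ab.2))%:E)%E.
  apply: eq_integral => om _; rewrite epatch_indic -EFinM; congr EFin; ring.
have mE1 : measurable_fun (setT : set (GT j.*2)) (\1_E : Omega -> R).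
  exact: (@measurable_indic _ (GT j.*2)).
apply: (pull_out0 (@hs j.*2) (outer_sub_M_integrable ab jT)) => //.
- by move=> F hF; exact: outer_sub_M_mean.
- by apply: measurable_funM => //; apply: measurable_funM => //; exact: moderate_indic.
- rewrite (_ : (fun _ => _) = EFin \o (fun om => \1_E om *
     (eta / K2 * p j.*2.+1 * \1_(moderate j) om * (outer j ab om - M j om ab.1 ab.2)))).
    apply: bounded_mul_integrable; [exact: measurable_indic|by move=> om; exact: norm_indic_le1|].
    exact: excitation_fluct2_integrable.
  by apply/funext => om /=; congr EFin; ring.
Qed.

(** Two time steps form one step of the martingale: the increment involves the
    feature and the disturbance at time [J.*2.+1] and is centred given the history
    up to time [J.*2]. *)
Lemma excitation_exp J : (J.*2 <= T)%N ->
  (\int[P]_om (ch (nrm (fun ab => excitation_sum J ab om)))%:E <= (excitation_growth ^+ J)%:E)%E.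
Proof.
have g0 : 0 <= excitation_growth.
  apply: addr_ge0 => //; apply: mulr_ge0; last exact: sqr_ge0.
  by apply: mulr_ge0 => //; exact: expR_ge0.
elim: J => [_|J IH JT].
  under eq_integral do under eq_fun do rewrite /excitation_sum big_nil.
  under eq_integral do rewrite nrm0 ch0.
  by rewrite integral_cst_on// probability_setT mule1.
have jT : (J.*2.+1 < T)%N by rewrite doubleS in JT.
have msum ab : measurable_fun (setT : set (GT J.*2)) (excitation_sum J ab).
  rewrite (_ : excitation_sum J ab = (fun om => \sum_(s < J) excitation_increment s ab om)).
    apply: measurable_sum => s.
    have sJ : (s.*2.+1 < J.*2)%N by rewrite -doubleS leq_double ltn_ord.
    apply: excitation_increment_history => //; apply: (ltn_trans sJ).
    exact: ltnW.
  by apply/funext => om; rewrite /excitation_sum big_mkord.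
have -> : (\int[P]_om (ch (nrm (fun ab => excitation_sum J.+1 ab om)))%:E =
    \int[P]_om (cst 1 om * ch (nrm (fun ab => excitation_sum J ab om + excitation_increment J ab om)))%:E)%E.
  apply: eq_integral => om _; rewrite mul1r; congr (ch _)%:E; apply: nrm_eq => ab.
  by rewrite /excitation_sum big_nat_recr.
apply: (@le_trans _ _ (excitation_growth%:E *
    \int[P]_om (cst 1 om * ch (nrm (fun ab => excitation_sum J ab om)))%:E)%E); last first.
  rewrite exprS EFinM lee_wpmul2l ?lee_fin//; under eq_integral do rewrite mul1r.
  by apply: IH; rewrite ltnW// ltnW.
have mb : measurable_fun setT (excitation_bound J).
  apply: measurable_funM => //; apply: measurable_funD => //; apply: measurable_funM => //.
  by apply: measurable_funX; exact/measurable_enorm_comp/measurable_w.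
apply: (ch_martingale_growth (@hs J.*2)) (nrm_excitation_increment jT) _ _ => //.
- by move=> ab; exact: excitation_increment_integrable.
- by move=> ab E hE; exact: excitation_increment_mean.
- move=> E hE; have mE := sub_measurable (@hs J.*2) hE.
  have me : measurable_fun setT (fun om => expR (enorm (w J.*2 om) ^+ 2 / V)).
    apply: measurable_expR_comp; apply: measurable_funM => //; apply: measurable_funX.
    exact/measurable_enorm_comp/measurable_w.
  have c0 : 0 <= 64 * expR 25 * eta ^+ 2.
    by apply: mulr_ge0; [apply: mulr_ge0 => //; exact: expR_ge0|exact: sqr_ge0].
  apply: (@le_trans _ _ (\int[P]_(om in E)
     (1 + 64 * expR 25 * eta ^+ 2 * expR (enorm (w J.*2 om) ^+ 2 / V))%:E)%E).
    apply: ge0_le_integral_on => //.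
    - by apply: measurable_funB => //; exact: measurable_expR_comp.
    - by apply: measurable_funD => //; exact: measurable_funM.
    - by move=> om; exact: expR_sub_ge0.
    - by move=> om; exact: excitation_factor.
  rewrite ge0_integralD_on; [|exact: mE|exact: measurable_cst|exact: measurable_funM
    |by []|by move=> om; rewrite mulr_ge0 ?expR_ge0].
  rewrite integral_cst_on// ge0_integralZl_on; [|exact: mE|exact: me|by move=> om; exact: expR_ge0|exact: c0].
  apply: (@le_trans _ _ (1 * P E + (64 * expR 25 * eta ^+ 2)%:E * ((expR 1)%:E * P E))%E).
    by rewrite leeD2l// lee_wpmul2l ?lee_fin// (noise_exp sys hE).
  have -> : P E = (fine (P E))%:E by rewrite fineK// fin_num_measure.
  rewrite -!EFinM -EFinD lee_fin /excitation_growth.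
  have -> : expR 26 = expR 25 * expR 1 :> R by rewrite -expRD; congr expR; lra.
  by rewrite le_eqVlt; apply/orP; left; apply/eqP; ring.
Qed.

(** Pair the excitation sum with the matrix [v *m v^T], whose Frobenius norm is
    [enorm v ^+ 2]. *)
Lemma excitation_lower J om (l2 : R) (v : 'cV[R]_m) :
  (forall j, (j < J)%N -> loewner_le (l2%:M) (M j om)) ->
  \sum_(0 <= j < J) \1_(moderate j) om * (p j.*2.+1 * (l2 * enorm v ^+ 2)) <=
  \sum_(0 <= j < J) \1_small_noise (w j.*2.+1 om) * (v^T *m phi (x j.*2.+1 om)) ord0 ord0 ^+ 2 +
  K2 / eta * nrm (fun ab => excitation_sum J ab om) * enorm v ^+ 2.
Proof.
move=> hM; have K0 := K2_gt0.
have dq (Q : 'I_m * 'I_m -> R) : dot Q (fun ab => v ab.1 ord0 * v ab.2 ord0) =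
    \sum_a \sum_b Q (a, b) * (v a ord0 * v b ord0).
  by rewrite /dot pair_big /=; apply: eq_bigr => -[a b].
have qf (Q : 'M[R]_m) : (v^T *m Q *m v) ord0 ord0 =
    \sum_a \sum_b Q a b * (v a ord0 * v b ord0).
  rewrite mxE exchange_big /=; apply: eq_bigr => b _; rewrite mxE mulr_suml.
  by apply: eq_bigr => a _; rewrite mxE; ring.
have qM j : (j < J)%N -> l2 * enorm v ^+ 2 <=
    dot (fun ab => M j om ab.1 ab.2) (fun ab => v ab.1 ord0 * v ab.2 ord0).
  move=> jJ; have := hM j jJ v; rewrite mulmxBr mulmxBl mxE [X in _ + X]mxE subr_ge0 (qf (M j om)) dq.
  move=> /= h; apply: le_trans h; rewrite enormE sqr_nrm mul_mx_scalar -scalemxAl mxE mulr_sumr mxE mulr_sumr.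
  by rewrite le_eqVlt; apply/orP; left; apply/eqP; apply: eq_bigr => a _; rewrite mxE expr2.
have qO j : dot (fun ab => outer j ab om) (fun ab => v ab.1 ord0 * v ab.2 ord0) =
    (v^T *m phi (x j.*2.+1 om)) ord0 ord0 ^+ 2.
  rewrite dq mxE expr2 mulr_suml; apply: eq_bigr => a _; rewrite mulr_sumr.
  by apply: eq_bigr => b _; rewrite /outer !mxE /=; ring.
have cs : - (nrm (fun ab => excitation_sum J ab om) * enorm v ^+ 2) <=
    dot (fun ab => excitation_sum J ab om) (fun ab => v ab.1 ord0 * v ab.2 ord0).
  have := cauchy_schwarz (fun ab => excitation_sum J ab om) (fun ab => v ab.1 ord0 * v ab.2 ord0).
  by rewrite (nrm_outer (fun a => v a ord0)) -enormE ler_norml => /andP[].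
have dS : dot (fun ab => excitation_sum J ab om) (fun ab => v ab.1 ord0 * v ab.2 ord0) =
  eta / K2 * \sum_(0 <= j < J) \1_(moderate j) om *
    (\1_small_noise (w j.*2.+1 om) * (v^T *m phi (x j.*2.+1 om)) ord0 ord0 ^+ 2 -
     p j.*2.+1 * dot (fun ab => M j om ab.1 ab.2) (fun ab => v ab.1 ord0 * v ab.2 ord0)).
  rewrite /dot /excitation_sum.
  under eq_bigr do rewrite mulr_suml.
  rewrite exchange_big /= mulr_sumr; apply: eq_bigr => j _.
  rewrite -qO /dot !mulr_sumr -sumrB !mulr_sumr; apply: eq_bigr => ab _.
  by rewrite /excitation_increment; ring.
have main : - (K2 / eta * nrm (fun ab => excitation_sum J ab om) * enorm v ^+ 2) <=
  \sum_(0 <= j < J) \1_(moderate j) om *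
    (\1_small_noise (w j.*2.+1 om) * (v^T *m phi (x j.*2.+1 om)) ord0 ord0 ^+ 2 -
     p j.*2.+1 * dot (fun ab => M j om ab.1 ab.2) (fun ab => v ab.1 ord0 * v ab.2 ord0)).
  move: cs; rewrite dS; set S := \sum_(_ <= _ < _) _; set N := nrm _; set v2 := enorm v ^+ 2.
  move=> cs; have ek : 0 < K2 / eta by rewrite divr_gt0.
  have := ler_wpM2l (ltW ek) cs.
  have -> : K2 / eta * (eta / K2 * S) = S.
    by rewrite mulrA mulrA divfK ?gt_eqF// divff ?gt_eqF// mul1r.
  by have -> : K2 / eta * - (N * v2) = - (K2 / eta * N * v2) by ring.
apply: (@le_trans _ _ (\sum_(0 <= j < J) \1_small_noise (w j.*2.+1 om) *
   (v^T *m phi (x j.*2.+1 om)) ord0 ord0 ^+ 2 -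
  \sum_(0 <= j < J) \1_(moderate j) om *
    (\1_small_noise (w j.*2.+1 om) * (v^T *m phi (x j.*2.+1 om)) ord0 ord0 ^+ 2 -
     p j.*2.+1 * dot (fun ab => M j om ab.1 ab.2) (fun ab => v ab.1 ord0 * v ab.2 ord0)))); last first.
  by rewrite lerD2l lerNl.
rewrite -sumrB !big_nat; apply: ler_sum => j /andP[_ jJ].
have /andP[m0 m1] := indic01 (moderate j) om.
have /andP[q0 q1] := p01 j.*2.+1.
have s0 : 0 <= \1_small_noise (w j.*2.+1 om) * (v^T *m phi (x j.*2.+1 om)) ord0 ord0 ^+ 2.
  by rewrite mulr_ge0 ?sqr_ge0// indicE.
have h := qM j jJ.
have h2 : \1_(moderate j) om * (p j.*2.+1 * (l2 * enorm v ^+ 2)) <= \1_(moderate j) om *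
   (p j.*2.+1 * dot (fun ab => M j om ab.1 ab.2) (fun ab => v ab.1 ord0 * v ab.2 ord0)).
  by rewrite ler_wpM2l// ler_wpM2l.
move: s0 h2; set a := \1_small_noise _ * _; set b := p _ * dot _ _ => s0 h2.
have : \1_(moderate j) om * a <= a by rewrite ler_piMl.
lra.
Qed.

End excitation.

(** * Intersections of events and laws *)

Section high_probability.
Context {d} {Omega : measurableType d} {R : realType}.
Variable P : probability Omega R.

Lemma wp_sub (e : R) (A B : set Omega) : A `<=` B ->
  with_probability_ge P e A -> with_probability_ge P e B.
Proof. by move=> AB [E [mE pE EA]]; exists E; split => // om /EA/AB. Qed.

Lemma wp_le (e e' : R) (A : set Omega) : e' <= e ->
  with_probability_ge P e A -> with_probability_ge P e' A.
Proof.
move=> ee [E [mE pE EA]]; exists E; split => //.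
by apply: le_trans pE; rewrite lee_fin.
Qed.

Lemma wp_and (e1 e2 : R) (A B : set Omega) :
  with_probability_ge P (1 - e1) A -> with_probability_ge P (1 - e2) B ->
  with_probability_ge P (1 - (e1 + e2)) (A `&` B).
Proof.
move=> [E [mE pE EA]] [F [mF pF FB]]; exists (E `&` F); split.
- exact: measurableI.
- have pD : (P (F `\` E) <= 1 - P E)%E.
    rewrite -(probability_setC P mE); apply: le_measure; rewrite ?inE.
    + exact: measurableD.
    + exact: measurableC.
    + by move=> om [].
  have : P F = (P (F `\` E) + P (E `&` F))%E.
    rewrite setIC -measureU//; first by rewrite setUC setUIDK.
    - exact: measurableD.
    - exact: measurableI.
    - by apply/seteqP; split => om // -[[_ nE] [_ /nE]].
  move: pD pE pF.
  have f1 : P E \is a fin_num by exact: fin_num_measure.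
  have f2 : P F \is a fin_num by exact: fin_num_measure.
  have f3 : P (F `\` E) \is a fin_num by apply: fin_num_measure; exact: measurableD.
  have f4 : P (E `&` F) \is a fin_num by apply: fin_num_measure; exact: measurableI.
  rewrite -(fineK f1) -(fineK f2) -(fineK f3) -(fineK f4).
  rewrite -EFinB -EFinD !lee_fin => h1 h2 h3 [h4]; lra.
- by move=> om [/EA ? /FB ?].
Qed.

Lemma wp_forall n (e : R) (A : 'I_n -> set Omega) :
  (forall i, with_probability_ge P (1 - e) (A i)) ->
  with_probability_ge P (1 - n%:R * e) [set om | forall i, A i om].
Proof.
elim: n A => [|n IH] A hA.
  exists setT; split => //; first by rewrite mul0r subr0 probability_setT.
  by move=> om _ [].
have := wp_and (hA ord0) (IH _ (fun i => hA (lift ord0 i))).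
have -> : e + n%:R * e = n.+1%:R * e by rewrite -natr1; ring.
apply: wp_sub => om [h0 h] i /=; have [j ->|->//] := unliftP ord0 i.
exact: h.
Qed.

Lemma wp_ae (A : Omega -> Prop) :
  {ae P, forall om, A om} -> with_probability_ge P (1 - 0) [set om | A om].
Proof.
move=> [N [mN PN NA]]; exists (~` N); split.
- exact: measurableC.
- by rewrite probability_setC// PN sube0 subr0.
- by move=> om nN; apply: contrapT => nA; apply: nN; exact: NA.
Qed.

Lemma wp_markov (e : R) (f : Omega -> R) :
  measurable_fun setT f -> (forall om, 0 <= f om) ->
  (\int[P]_om (f om)%:E <= e%:E)%E ->
  with_probability_ge P (1 - e) [set om | f om < 1].
Proof.
move=> mf f0 fe.
have mE : measurable [set om | f om < 1].
  have := mf measurableT `]-oo, 1[%classic (measurable_itv _).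
  by rewrite setTI; congr (measurable _); apply/seteqP; split => om /=; rewrite in_itv.
exists [set om | f om < 1]; split => //.
have PC : (P (~` [set om | (f om < 1)%R]) <= e%:E)%E.
  apply: le_trans fe; have mC := measurableC mE.
  rewrite -[leLHS]mul1e -(integral_cst_on P mC 1) integral_mkcond.
  apply: ge0_le_integral => //.
  - by move=> om _; rewrite epatch_indic mule_ge0// lee_fin.
  - apply/(measurable_restrictT _ mC); exact: measurable_cst.
  - exact/measurable_EFinP.
  - move=> om _; rewrite epatch_indic mul1e lee_fin indicE.
    have [|] := boolP (om \in _); last by [].
    by rewrite inE /= => /negP; rewrite -leNgt.
rewrite probability_setC// in PC.
have f1 : P [set om | f om < 1] \is a fin_num by exact: fin_num_measure.
move: PC; rewrite -(fineK f1) -EFinB !lee_fin; lra.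
Qed.

Lemma eq_law_integral d' (S : measurableType d') (X Y : Omega -> S) (f : S -> R) :
  measurable_fun setT X -> measurable_fun setT Y ->
  (forall B, measurable B -> P (X @^-1` B) = P (Y @^-1` B)) ->
  measurable_fun setT f -> (forall s, 0 <= f s) ->
  (\int[P]_om (f (X om))%:E = \int[P]_om (f (Y om))%:E)%E.
Proof.
move=> mX mY XY mf f0.
have mf' : measurable_fun setT (EFin \o f) by exact/measurable_EFinP.
have f0' : {in setT, forall s, (0 <= (EFin \o f) s)%E} by move=> s _; rewrite lee_fin.
rewrite -[LHS](ge0_integral_pushforward mX P measurableT mf' f0').
rewrite -[RHS](ge0_integral_pushforward mY P measurableT mf' f0').
apply: eq_measure_integral => B mB _; exact: XY.
Qed.

(** Test the matrix inequality on the coordinate vector [a]. *)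
Lemma cond_second_moment_coord m (G : set (set Omega)) (Y : Omega -> 'cV[R]_m) (c : R) a :
  G setT -> cond_second_moment_ge P G Y c ->
  (c%:E <= \int[P]_om (Y om a ord0 ^+ 2)%:E)%E.
Proof.
move=> GT [M hM hl].
have [_ iM _ h] := hM a a.
have -> : (\int[P]_om (Y om a ord0 ^+ 2)%:E = \int[P]_om (M om a a)%:E)%E.
  rewrite h//; apply: eq_integral => om _; congr EFin.
  by rewrite mxE big_ord1 mxE expr2.
apply: (@le_trans _ _ (\int[P]_om c%:E)%E).
  by rewrite integral_cst_on// probability_setT mule1.
apply: (@ae_le_integral _ _ _ P setT (fun=> c) (fun om => M om a a)) => //.
  exact: integrable_cst_real.
apply: filterS hl => om /(_ (delta_mx a ord0)).
have e (Q : 'M[R]_m) : ((delta_mx a ord0 : 'cV[R]_m)^T *m Q *m delta_mx a ord0) ord0 ord0 = Q a a.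
  rewrite trmx_delta -rowE mxE (bigD1 a)//= big1 => [|b ba].
    by rewrite !mxE !eqxx mulr1 addr0.
  by rewrite !mxE (negbTE ba) mulr0.
by rewrite e !mxE eqxx mulr1n subr_ge0.
Qed.

End high_probability.

(** * The deterministic error bound *)

Section deterministic_error.
Context {R : realType}.

(** [D] is the error of the minimizer. If it were longer than [R0], the curvature of
    the loss on the segment up to length [R0], collected at the times with a small
    disturbance, would exceed the gain from the gradient, so that the minimizer
    would have a larger loss than the true parameter. *)
Lemma huber_error m T (mu R0 g k0 : R) (f : nat -> 'cV[R]_m) (w : nat -> R) (D : 'cV[R]_m) :
  0 < mu -> 0 < R0 ->
  \sum_(0 <= t < T) huber mu (w t - (D^T *m f t) ord0 ord0) <=
    \sum_(0 <= t < T) huber mu (w t) ->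
  enorm (\sum_(0 <= t < T) clip mu (w t) *: f t) <= g ->
  (forall v : 'cV[R]_m, k0 * enorm v ^+ 2 <=
    \sum_(0 <= t < T) (`|w t| <= mu / 2)%R%:R * (v^T *m f t) ord0 ord0 ^+ 2) ->
  (forall t, (t < T)%N -> R0 * enorm (f t) <= mu / 2) ->
  2 * g < R0 * k0 -> enorm D <= R0.
Proof.
move=> mu0 R00 hmin hg hk hmax hgk; rewrite leNgt; apply/negP => big.
have D0 : 0 < enorm D by exact: lt_trans big.
have dotE (u v : 'cV[R]_m) : (u^T *m v) ord0 ord0 = dot (fun a => u a ord0) (fun a => v a ord0).
  by rewrite mxE /dot; apply: eq_bigr => a _; rewrite mxE.
pose z t := (D^T *m f t) ord0 ord0.
pose tau := R0 / enorm D.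
have tau01 : 0 <= tau <= 1.
  by rewrite divr_ge0 ?(ltW R00) ?(ltW D0)//= ler_pdivrMr// mul1r ltW.
have cur t : (t < T)%N -> (`|w t| <= mu / 2)%R%:R * (tau * z t ^+ 2 / 2) <=
    huber mu (w t - z t) - huber mu (w t) + clip mu (w t) * z t.
  move=> tT; have [hw|_] := boolP (`|w t| <= mu / 2); last by rewrite mul0r huber_tangent.
  rewrite mul1r huber_curvature//.
  have zb : `|z t| <= enorm D * enorm (f t) by rewrite /z dotE cauchy_schwarz.
  have /andP[tau0 _] := tau01; rewrite normrM ger0_norm//.
  apply: le_trans (hmax t tT); apply: (le_trans (ler_wpM2l tau0 zb)).
  by rewrite mulrA /tau divfK ?gt_eqF.
have sum_cur : tau / 2 * (k0 * enorm D ^+ 2) <=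
   \sum_(0 <= t < T) (huber mu (w t - z t) - huber mu (w t) + clip mu (w t) * z t).
  have /andP[tau0 _] := tau01.
  apply: (@le_trans _ _ (tau / 2 * \sum_(0 <= t < T) (`|w t| <= mu / 2)%R%:R * z t ^+ 2)).
    by apply: ler_wpM2l; [rewrite divr_ge0|exact: hk].
  rewrite mulr_sumr !big_nat; apply: ler_sum => t /andP[_ tT].
  apply: le_trans (cur t tT); rewrite le_eqVlt; apply/orP; left; apply/eqP; ring.
have lin : \sum_(0 <= t < T) clip mu (w t) * z t <= g * enorm D.
  have -> : \sum_(0 <= t < T) clip mu (w t) * z t =
     (D^T *m (\sum_(0 <= t < T) clip mu (w t) *: f t)) ord0 ord0.
    rewrite mulmx_sumr summxE; apply: eq_bigr => t _.
    by rewrite -scalemxAr mxE.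
  rewrite dotE; apply: (le_trans (ler_norm _)); apply: (le_trans (cauchy_schwarz _ _)).
  by rewrite mulrC ler_wpM2r ?enorm_ge0.
move: sum_cur; rewrite big_split/= sumrB.
have -> : tau / 2 * (k0 * enorm D ^+ 2) = R0 * k0 / 2 * enorm D.
  by rewrite /tau; field; rewrite gt_eqF.
have : (2 * g) * enorm D < R0 * k0 * enorm D by rewrite ltr_pM2r.
move: hmin lin; rewrite /z; lra.
Qed.

Lemma huber_minimizer_row n m T (mu : R) (phi : 'cV[R]_n -> 'cV[R]_m) (x : nat -> 'cV[R]_n)
    (a : 'I_n -> 'cV[R]_m) (i : 'I_n) (b : 'cV[R]_m) :
  huber_minimizer T mu phi x a ->
  \sum_(0 <= t < T) huber mu (x t.+1 i ord0 - ((a i)^T *m phi (x t)) ord0 ord0) <=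
  \sum_(0 <= t < T) huber mu (x t.+1 i ord0 - (b^T *m phi (x t)) ord0 ord0).
Proof.
move=> /(_ (fun k => if k == i then b else a k)); rewrite /huber_loss.
rewrite exchange_big /= [leRHS]exchange_big /= (bigD1 i)//= [leRHS](bigD1 i)//= eqxx.
have -> : \sum_(k < n | k != i) \sum_(0 <= t < T) huber mu
    (x t.+1 k ord0 - ((if k == i then b else a k)^T *m phi (x t)) ord0 ord0) =
  \sum_(k < n | k != i) \sum_(0 <= t < T) huber mu
    (x t.+1 k ord0 - ((a k)^T *m phi (x t)) ord0 ord0).
  by apply: eq_bigr => k /negbTE ->.
by rewrite lerD2r.
Qed.

Lemma sum_odd_le (F : nat -> R) J T : (J.*2 <= T)%N -> (forall t, 0 <= F t) ->
  \sum_(0 <= j < J) F j.*2.+1 <= \sum_(0 <= t < T) F t.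
Proof.
move=> JT F0; apply: (@le_trans _ _ (\sum_(0 <= t < J.*2) F t)).
  elim: J {JT} => [|J IH]; first by rewrite !big_nil.
  rewrite doubleS !big_nat_recr//= -addrA lerD// lerDr//.
by rewrite [leRHS](big_cat_nat _ JT)//= lerDl sumr_ge0.
Qed.

Lemma sum_even_le (F : nat -> R) J T : (J.*2 <= T)%N -> (forall t, 0 <= F t) ->
  \sum_(0 <= j < J) F j.*2 <= \sum_(0 <= t < T) F t.
Proof.
move=> JT F0; apply: (@le_trans _ _ (\sum_(0 <= t < J.*2) F t)).
  elim: J {JT} => [|J IH]; first by rewrite !big_nil.
  rewrite doubleS !big_nat_recr//= -addrA lerD// lerDl//.
by rewrite [leRHS](big_cat_nat _ JT)//= lerDl sumr_ge0.
Qed.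

End deterministic_error.

(** * Absolute constants *)

Section constants.
Context {R : realType}.
Variable c0 : R.
Hypothesis c0_gt0 : 0 < c0.

(** [log_const] absorbs the numerical factor in [ln (16 * n / delta)]. *)
Definition log_const : R := 1 + ln 16 / c0.
(** The quadratic coefficient of the conditional growth of the excitation
    potential. *)
Definition growth_const : R := 64 * expR 26.
(** The bounds [24 + log] and [4 * expR 1 + log] for the centred and the drift
    part, with the numerical summands absorbed into [ell >= c0]. *)
Definition grad_const : R := (24 + 4 * expR 1) / c0 + 2 * log_const.
(** Twice the gradient over the curvature [q * lambda ^+ 2 * T / 8] is 16 times the
    scale of the gradient; 17 makes the inequality strict. *)
Definition error_const : R := 17 * grad_const.
Definition max_const : R := 4 * error_const ^+ 2.
Definition exponent_const : R := 2 * ln (8 * expR 1) / c0 + 10.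
(** One summand for each lower bound that the sample size has to satisfy; the last
    two serve [sample_ge_max]. *)
Definition time_part1 : R := 2 * log_const / c0 ^+ 2.
Definition time_part2 : R := 8 / c0 ^+ 3.
Definition time_part3 : R := 512 * growth_const * log_const / c0 ^+ 2.
Definition time_part4 : R := 4 * max_const * exponent_const.
Definition time_part5 : R := 8 * max_const * `|ln (4 * max_const)| / c0.
Definition time_const : R :=
  time_part1 + time_part2 + time_part3 + time_part4 + time_part5.

Lemma log_const_gt0 : 0 < log_const.
Proof. by rewrite /log_const addr_gt0// divr_gt0// ln_gt0// ltr1n. Qed.

Lemma growth_const_gt0 : 0 < growth_const.
Proof. by rewrite /growth_const mulr_gt0// expR_gt0. Qed.

Lemma grad_const_gt0 : 0 < grad_const.
Proof.
have e0 := expR_gt0 (1 : R); have l0 := log_const_gt0.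
by rewrite /grad_const addr_gt0// ?mulr_gt0// ?invr_gt0// addr_gt0// mulr_gt0.
Qed.

Lemma error_const_gt0 : 0 < error_const.
Proof. by rewrite /error_const mulr_gt0// grad_const_gt0. Qed.

Lemma max_const_gt0 : 0 < max_const.
Proof. by rewrite /max_const mulr_gt0// exprn_gt0// error_const_gt0. Qed.

Lemma ln8e_gt0 : 0 < ln (8 * expR 1) :> R.
Proof.
rewrite ln_gt0//; have : 1 <= expR 1 :> R by rewrite -[leLHS]expR0 ler_expR.
lra.
Qed.

Lemma exponent_const_gt0 : 0 < exponent_const.
Proof.
by rewrite /exponent_const addr_gt0// divr_gt0// mulr_gt0// ln8e_gt0.
Qed.

Lemma time_parts_ge0 :
  [/\ 0 < time_part1, 0 < time_part2, 0 < time_part3, 0 < time_part4 & 0 <= time_part5].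
Proof.
have l0 := log_const_gt0; have g0 := growth_const_gt0.
have m0 := max_const_gt0; have x0 := exponent_const_gt0.
rewrite /time_part1 /time_part2 /time_part3 /time_part4 /time_part5.
have c00 := c0_gt0.
move: (`|_|) (normr_ge0 (ln (4 * max_const))) => N N0.
move: log_const growth_const max_const exponent_const l0 g0 m0 x0 => a b c e a0 b0 m0 e0.
have c2 : 0 < c0 ^+ 2 by rewrite exprn_gt0.
have c3 : 0 < c0 ^+ 3 by rewrite exprn_gt0.
have n2 : (0 : R) < 2 by rewrite ltr0n.
have n4 : (0 : R) < 4 by rewrite ltr0n.
have n8 : (0 : R) < 8 by rewrite ltr0n.
have n512 : (0 : R) < 512 by rewrite ltr0n.
split.
- exact: (divr_gt0 (mulr_gt0 n2 a0) c2).
- exact: (divr_gt0 n8 c3).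
- exact: (divr_gt0 (mulr_gt0 (mulr_gt0 n512 b0) a0) c2).
- exact: (mulr_gt0 (mulr_gt0 n4 m0) e0).
- exact: (divr_ge0 (mulr_ge0 (ltW (mulr_gt0 n8 m0)) N0) (ltW c00)).
Qed.

Lemma time_parts_le : [/\ time_part1 <= time_const, time_part2 <= time_const,
  time_part3 <= time_const, time_part4 <= time_const & time_part5 <= time_const].
Proof.
have [] := time_parts_ge0; rewrite /time_const.
move: time_part1 time_part2 time_part3 time_part4 time_part5 => a b c d e *.
by split; lra.
Qed.

Lemma time_const_gt0 : 0 < time_const.
Proof.
have [h _ _ _ _] := time_parts_ge0; have [h' _ _ _ _] := time_parts_le.
exact: lt_le_trans h h'.
Qed.

(** In the application [Q = (K2 / (q * lambda ^+ 2)) ^+ 2], [ell = ln (n / delta)],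
    [ellm = ln (m * n / delta)], and [Lam] is the last logarithm of the sample
    size. *)
Record sample_regime (T Q ell ellm Lam delta : R) : Prop := SampleRegime {
  regime_Q : 1 <= Q;
  regime_ell : c0 <= ell;
  regime_ellm : ell <= ellm;
  regime_Lam : ellm <= 2 * Lam;
  regime_lnQ : ln Q <= 4 * Lam;
  regime_delta : 0 < delta;
  regime_ln_delta : ln delta^-1 <= ell;
  regime_T : time_const * (Q * ellm ^+ 2 * Lam) <= T
}.

Section sample_size.
Variables (T Q ell ellm Lam delta : R).
Hypothesis reg : sample_regime T Q ell ellm Lam delta.

Lemma regime_basic : [/\ 0 < Q, 0 < ell, 0 < ellm & 0 < Lam].
Proof.
have := regime_Q reg; have := regime_ell reg; have := regime_ellm reg.
have := regime_Lam reg; have := c0_gt0.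
by move=> h1 h2 h3 h4 h5; split; lra.
Qed.

Definition regime_base : R := Q * ellm ^+ 2 * Lam.

Lemma regime_base_ge (c : R) : 0 <= c -> c <= time_const -> c * regime_base <= T.
Proof.
have [Q0 l0 lm0 L0] := regime_basic.
move=> c_ge0 cC; apply: le_trans (regime_T reg); apply: ler_wpM2r => //.
by rewrite mulr_ge0 ?(ltW L0)// mulr_ge0 ?sqr_ge0// ltW.
Qed.

(** Trades the logarithms [Lam] and one [ellm] for the constant [c0]. *)
Lemma regime_base_ge_ell : c0 ^+ 2 * (Q * ell) / 2 <= regime_base.
Proof.
have [Q0 l0 lm0 L0] := regime_basic; have c00 := c0_gt0.
have e1 := regime_ell reg; have e2 := regime_ellm reg; have e3 := regime_Lam reg.
have h1 : c0 * ell <= ellm ^+ 2.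
  by rewrite expr2; apply: ler_pM => //; [exact: ltW|exact: ltW|exact: le_trans e2].
have h2 : c0 / 2 <= Lam by lra.
have -> : c0 ^+ 2 * (Q * ell) / 2 = Q * (c0 * ell) * (c0 / 2) by field.
have c0' : 0 <= c0 * ell by apply: mulr_ge0; exact: ltW.
rewrite /regime_base; apply: ler_pM => //.
- by apply: mulr_ge0 => //; exact: ltW.
- by rewrite divr_ge0// ltW.
- by apply: ler_wpM2l => //; exact: ltW.
Qed.

Lemma sample_ge (c X : R) : 0 <= c -> c <= time_const ->
  X <= c * (c0 ^+ 2 * (Q * ell) / 2) -> X <= T.
Proof.
move=> c_ge0 cC h; apply: le_trans (regime_base_ge c_ge0 cC).
by apply: (le_trans h); apply: ler_wpM2l => //; exact: regime_base_ge_ell.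
Qed.

Lemma sample_ge4 : 4 <= T.
Proof.
have [_ p2 _ _ _] := time_parts_ge0; have [_ q2 _ _ _] := time_parts_le.
have Q1 := regime_Q reg; have e1 := regime_ell reg.
apply: (sample_ge (ltW p2) q2).
have -> : time_part2 * (c0 ^+ 2 * (Q * ell) / 2) = 4 * (Q * (ell / c0)).
  by rewrite /time_part2; field; rewrite gt_eqF.
have h : 1 <= ell / c0 by rewrite ler_pdivlMr// mul1r.
have : 1 <= Q * (ell / c0) by rewrite -[1]mulr1; apply: ler_pM.
by move: (Q * _) => z; lra.
Qed.

Lemma sample_ge_log : log_const * ell <= T.
Proof.
have [p1 _ _ _ _] := time_parts_ge0; have [q1 _ _ _ _] := time_parts_le.
have [Q0 l0 lm0 L0] := regime_basic.
apply: (sample_ge (ltW p1) q1).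
have -> : time_part1 * (c0 ^+ 2 * (Q * ell) / 2) = log_const * (Q * ell).
  by rewrite /time_part1; field; rewrite gt_eqF.
rewrite ler_wpM2l ?(ltW log_const_gt0)// ler_peMl ?(regime_Q reg)//; exact: ltW.
Qed.

Lemma sample_ge_growth : 256 * growth_const * (Q * (log_const * ell)) <= T.
Proof.
have [_ _ p3 _ _] := time_parts_ge0; have [_ _ q3 _ _] := time_parts_le.
apply: (sample_ge (ltW p3) q3).
rewrite le_eqVlt; apply/orP; left; apply/eqP; rewrite /time_part3; field.
by rewrite gt_eqF.
Qed.

(** The logarithm of [T] on the left is absorbed: [ln T] is the sum of [ln (T / (Q * ellm ^+ 2))],
    which is dominated by its argument, and of [ln (Q * ellm ^+ 2)], which is
    dominated by [Lam]. *)
Lemma sample_ge_max :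
  max_const * (Q * ell ^+ 2 * ln (8 * expR 1 * T / delta)) <= T.
Proof.
have [_ _ _ p4 p5] := time_parts_ge0; have [_ _ _ q4 q5] := time_parts_le.
have B0 := max_const_gt0; have T4 := sample_ge4.
have [Q0 l0 lm0 L0] := regime_basic; have d0 := regime_delta reg.
have T0 : 0 < T by apply: lt_le_trans T4.
have c2L : 1 <= 2 * Lam / c0.
  rewrite ler_pdivlMr// mul1r; apply: le_trans (regime_ell reg) _.
  exact: le_trans (regime_ellm reg) (regime_Lam reg).
have ell2L : ln delta^-1 <= 2 * Lam.
  apply: le_trans (regime_ln_delta reg) _.
  exact: le_trans (regime_ellm reg) (regime_Lam reg).
pose a1 := Q * ellm ^+ 2.
have a10 : 0 < a1 by rewrite mulr_gt0 ?exprn_gt0.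
have [y yE] : exists y, y = T / a1 by exists (T / a1).
have y0 : 0 < y by rewrite yE divr_gt0.
have TE : T = a1 * y by rewrite yE mulrC divfK ?gt_eqF.
have yC (c : R) : 0 <= c -> c <= time_const -> c * Lam <= y.
  move=> c_ge0 cC; rewrite yE ler_pdivlMr// mulrAC -mulrA.
  exact: (regime_base_ge c_ge0 cC).
have lnT : ln (8 * expR 1 * T / delta) <= exponent_const * Lam + ln y.
  have e1 := expR_gt0 (1 : R); have e8 := ln8e_gt0.
  have -> : ln (8 * expR 1 * T / delta) =
     ln (8 * expR 1) + (ln Q + 2 * ln ellm + ln y) + ln delta^-1.
    rewrite lnM ?posrE ?invr_gt0 ?mulr_gt0//; congr (_ + _).
    rewrite lnM ?posrE ?mulr_gt0//; congr (_ + _).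
    rewrite TE lnM ?posrE//; congr (_ + _).
    by rewrite lnM ?posrE ?exprn_gt0// lnXn// mulr_natl.
  have h1 := ln_sublinear lm0; have h2 := regime_Lam reg; have h3 := regime_lnQ reg.
  have h4 : ln (8 * expR 1) <= 2 * ln (8 * expR 1) / c0 * Lam.
    have -> : 2 * ln (8 * expR 1) / c0 * Lam = ln (8 * expR 1) * (2 * Lam / c0).
      by field; rewrite gt_eqF.
    by rewrite ler_peMr// ltW.
  rewrite /exponent_const (mulrDl (2 * ln (8 * expR 1) / c0) 10 Lam).
  move: h4; move: (2 * ln (8 * expR 1) / c0 * Lam) => X h4.
  move: (ln (8 * expR 1)) (ln Q) (ln ellm) (ln y) (ln delta^-1) h1 h2 h3 h4 ell2L => *; lra.
have part : max_const * (exponent_const * Lam + ln y) <= y.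
  have h1 : max_const * (exponent_const * Lam) <= y / 4.
    have := yC _ (ltW p4) q4.
    have -> : time_part4 * Lam = 4 * (max_const * (exponent_const * Lam)).
      by rewrite /time_part4; ring.
    by move: (max_const * _) => z; lra.
  have h2 : max_const * `|ln (4 * max_const)| <= y / 4.
    have h5 : 4 * (max_const * `|ln (4 * max_const)|) <= time_part5 * Lam.
      have -> : time_part5 * Lam = 4 * (max_const * `|ln (4 * max_const)|) * (2 * Lam / c0).
        by rewrite /time_part5; field; rewrite gt_eqF.
      by rewrite ler_peMr// mulr_ge0// mulr_ge0// ltW.
    have := le_trans h5 (yC _ p5 q5).
    by move: (max_const * _) => z; lra.
  have h3 : ln y <= y / (4 * max_const) + ln (4 * max_const).
    have m4 : 0 < 4 * max_const by rewrite mulr_gt0.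
    have h5 : ln (y / (4 * max_const)) < y / (4 * max_const).
      by apply: ln_sublinear; rewrite divr_gt0.
    move: h5; rewrite ln_div ?posrE// => h5.
    by rewrite -lerBlDr ltW.
  have h5 : max_const * ln y <= y / 4 + max_const * ln (4 * max_const).
    have -> : y / 4 = max_const * (y / (4 * max_const)) by field; rewrite gt_eqF.
    by rewrite -mulrDr ler_wpM2l// ltW.
  have h6 : max_const * ln (4 * max_const) <= max_const * `|ln (4 * max_const)|.
    by rewrite ler_wpM2l ?(ltW B0)// ler_norm.
  rewrite mulrDr.
  move: (max_const * _) (max_const * ln y) (max_const * ln (4 * max_const))
    (max_const * `|_|) h1 h2 h5 h6 y0 => *; lra.
have [neg|pos] := leP (ln (8 * expR 1 * T / delta)) 0.
  apply: (@le_trans _ _ 0); last exact: ltW.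
  rewrite mulr_ge0_le0 ?(ltW B0)// mulr_ge0_le0// mulr_ge0 ?sqr_ge0//; exact: ltW.
have h4 : ell ^+ 2 <= ellm ^+ 2 by rewrite lerXn2r ?nnegrE ?(regime_ellm reg)// ltW.
have [l lE] : exists l, l = ln (8 * expR 1 * T / delta) by exists (ln (8 * expR 1 * T / delta)).
rewrite -lE in pos lnT *.
rewrite [leRHS]TE; apply: (@le_trans _ _ (a1 * (max_const * l))).
  rewrite mulrCA; apply: ler_wpM2r; first by rewrite mulr_ge0// ltW.
  by apply: ler_wpM2l => //; exact: ltW.
apply: ler_wpM2l; first exact: ltW.
by apply: le_trans part; apply: ler_wpM2l => //; exact: ltW.
Qed.

End sample_size.
End constants.

(** * Events of high probability for the trajectory *)

Section estimation.
Context {d} {Omega : measurableType d} {R : realType}.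
Variable P : probability Omega R.
Context {n m T : nat}.
Variables (phi : 'cV[R]_n -> 'cV[R]_m) (A : 'M[R]_(n, m)).
Variables (x w : nat -> {RV P >-> 'cV[R]_n}) (L sigma : R).
Hypothesis sys : stable_system T phi A x w L sigma.

Local Notation kap := (1 - opnorm A * L).
Local Notation V := (n%:R * sigma ^+ 2).
Local Notation K2 := (L ^+ 2 * V / kap ^+ 2).

Lemma wp_markov_scaled (C eps : R) (f : Omega -> R) :
  0 < C -> 0 < eps -> measurable_fun setT f -> (forall om, 0 <= f om) ->
  (\int[P]_om (f om)%:E <= C%:E)%E ->
  with_probability_ge P (1 - eps) [set om | f om < C / eps].
Proof.
move=> C0 e0 mf f0 fC.
have k0 : 0 < eps / C by rewrite divr_gt0.
apply: (@wp_sub _ _ _ _ _ [set om | eps / C * f om < 1]) => [om /=|].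
  by rewrite -ltr_pdivlMl// invf_div mulr1.
apply: wp_markov.
- exact: measurable_funM.
- by move=> om; rewrite mulr_ge0// ltW.
rewrite ge0_integralZl_on//; last exact: ltW.
apply: (@le_trans _ _ ((eps / C)%:E * C%:E)%E).
  by rewrite lee_wpmul2l ?lee_fin// ltW.
by rewrite -EFinM divfK// gt_eqF.
Qed.

Lemma ch_lt_ln (N X : R) : ch N < X -> N < ln (2 * X).
Proof.
move=> h; have X0 : 0 < X by apply: lt_trans h; exact: ch_gt0.
rewrite -ltr_expR lnK ?posrE ?mulr_gt0//.
by apply: (le_lt_trans (expR_le_2ch N)); rewrite ltr_pM2l.
Qed.

(** Markov's inequality for [energy_exp]; the exponential moment over [T] steps
    costs only a term linear in [T]. *)
Lemma energy_event (eps : R) : 0 < eps ->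
  with_probability_ge P (1 - eps) [set om |
    kap ^+ 2 * \sum_(0 <= t < T) enorm (x t om) ^+ 2 < V * (T.+1%:R + ln eps^-1)].
Proof.
move=> e0.
pose f om := expR ((enorm (x 0%N om) ^+ 2 + \sum_(0 <= s < T) enorm (w s om) ^+ 2) / V).
have mf : measurable_fun setT f.
  apply: measurable_expR_comp; apply: measurable_funM => //; apply: measurable_funD.
    by apply: measurable_funX; apply: measurable_enorm_comp; exact: measurable_x.
  by apply: measurable_sum => s; apply: measurable_funX; apply: measurable_enorm_comp; exact: measurable_w.
apply: wp_sub (wp_markov_scaled (expR_gt0 T.+1%:R) e0 mf _ (energy_exp sys (leqnn T))).
  move=> om /= h; apply: le_lt_trans (energy_balance sys om (leqnn T)) _.
  rewrite mulrC -ltr_pdivrMr ?(V_gt0 sys)// -ltr_expR expRD lnK ?posrE ?invr_gt0//.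
by move=> om; exact: expR_ge0.
Qed.

(** Markov's inequality for the sum over [t] of the exponential moments
    [state_exp]. *)
Lemma feature_event (eps : R) : 0 < eps -> (0 < T)%N ->
  with_probability_ge P (1 - eps) [set om | forall t, (t < T)%N ->
    enorm (phi (x t om)) ^+ 2 <= K2 * ln (expR 1 * T%:R / eps)].
Proof.
move=> e0 T0.
pose f (t : nat) om := expR (kap ^+ 2 / V * enorm (x t om) ^+ 2).
have f0 t om : 0 <= f t om by exact: expR_ge0.
have mf t : measurable_fun setT (f t).
  apply: measurable_expR_comp; apply: measurable_funM => //.
  by apply: measurable_funX; apply: measurable_enorm_comp; exact: measurable_x.
have T0' : (0 : R) < T%:R by rewrite ltr0n.
have fT : (\int[P]_om (\sum_(t < T) f t om)%:E <= (expR 1 * T%:R)%:E)%E.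
  rewrite ge0_integral_sum_on//.
  apply: (@le_trans _ _ (\sum_(t < T) (expR 1)%:E)%E).
    by apply: lee_sum => t _; apply: (state_exp sys); exact: ltnW.
  by rewrite sumEFin sumr_const card_ord mulr_natr.
have C0 : 0 < expR 1 * T%:R :> R by rewrite mulr_gt0// expR_gt0.
have mfs : measurable_fun setT (fun om => \sum_(t < T) f t om).
  by apply: measurable_sum => t; exact: mf.
have fs0 om : 0 <= \sum_(t < T) f t om by apply: sumr_ge0.
have := wp_markov_scaled C0 e0 mfs fs0 fT; apply: wp_sub.
  move=> om /= h t tT.
  have : f t om < expR 1 * T%:R / eps.
    apply: le_lt_trans h; rewrite (bigD1 (Ordinal tT))//= lerDl.
    by apply: sumr_ge0.
  rewrite -[X in _ < X]lnK ?posrE ?divr_gt0// /f ltr_expR => h'.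
  apply: (@le_trans _ _ ((L * enorm (x t om)) ^+ 2)).
    rewrite lerXn2r ?nnegrE ?enorm_ge0 ?(enorm_phi sys)//.
    by rewrite mulr_ge0 ?enorm_ge0// ltW// (sys_L sys).
  have -> : (L * enorm (x t om)) ^+ 2 = K2 * (kap ^+ 2 / V * enorm (x t om) ^+ 2).
    have n0 : n%:R != 0 :> R by rewrite pnatr_eq0 -lt0n (sys_n sys).
    field.
    by rewrite n0 (gt_eqF (kap_gt0 sys)) (gt_eqF (sys_sigma sys)).
  by rewrite ler_wpM2l ?ltW// (K2_gt0 sys).
Qed.

Section row.
Variables (mu q lambda ell : R) (i : 'I_n).
Hypothesis mu0 : 0 < mu.
Hypothesis T2 : (2 <= T)%N.

(** With this exponent the discount of [centered_weight] is of order one on the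
    event that the features have energy at most [3 * K2 * T]. *)
Definition grad_scale : R := (mu * Num.sqrt (K2 * T%:R))^-1.

Let KT0 : 0 < K2 * T%:R.
Proof. by rewrite mulr_gt0 ?(K2_gt0 sys)// ltr0n ltnW. Qed.

Lemma grad_scale_gt0 : 0 < grad_scale.
Proof. by rewrite invr_gt0 mulr_gt0// sqrtr_gt0. Qed.

Lemma grad_scale_sqr : (grad_scale * mu) ^+ 2 = (K2 * T%:R)^-1.
Proof.
have s0 : 0 < Num.sqrt (K2 * T%:R) by rewrite sqrtr_gt0.
rewrite /grad_scale invfM mulrAC mulVf ?mul1r ?gt_eqF// exprVn.
by rewrite sqr_sqrtr// ltW.
Qed.

Lemma centered_event (c : nat -> R) (eps : R) :
  (forall t, (\int[P]_om (clip mu (w t om i ord0))%:E = (c t)%:E)%E) ->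
  (forall t, `|c t| <= mu) -> 0 < eps ->
  with_probability_ge P (1 - eps) [set om |
    kap ^+ 2 * \sum_(0 <= t < T) enorm (x t om) ^+ 2 <= V * (3 * T%:R) ->
    grad_scale * enorm (\sum_(0 <= t < T) (clip mu (w t om i ord0) - c t) *: phi (x t om))
      < 24 + ln (2 / eps)].
Proof.
move=> cm cb e0; have g0 := grad_scale_gt0.
have int := centered_exp sys mu0 g0 cm cb (leqnn T).
pose W := centered_weight phi x mu grad_scale T.
pose N om := nrm (fun j => centered_sum phi x w mu grad_scale i c T j om).
have mW : measurable_fun setT W.
  apply: measurable_expR_comp; apply: measurable_funN; apply: measurable_funM => //.
  apply: measurable_sum => s; apply: measurable_funX; apply: measurable_enorm_comp.
  exact: (measurableT_comp (measurable_phi sys) (measurable_x x s)).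
have mN : measurable_fun setT N.
  apply: measurable_nrm => j; apply: measurable_sum => s.
  exact: (measurable_centered_increment sys).
have mf : measurable_fun setT (fun om => W om * ch (N om)).
  by apply: measurable_funM => //; exact: measurable_ch_comp.
have f0 om : 0 <= W om * ch (N om) by rewrite mulr_ge0 ?expR_ge0 ?ch_ge0.
have := wp_markov_scaled ltr01 e0 mf f0 int; apply: wp_sub => om /= h en.
have NE : N om = grad_scale * enorm (\sum_(0 <= t < T) (clip mu (w t om i ord0) - c t) *: phi (x t om)).
  rewrite enormE -[grad_scale in RHS](gtr0_norm g0) -nrmZ; apply: nrm_eq => j.
  rewrite /centered_sum summxE mulr_sumr; apply: eq_bigr => t _.
  by rewrite /centered_increment mxE mulrA.
rewrite -NE.
have phi_en : \sum_(0 <= t < T) enorm (phi (x t om)) ^+ 2 <= 3 * (K2 * T%:R).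
  apply: (@le_trans _ _ (L ^+ 2 * \sum_(0 <= t < T) enorm (x t om) ^+ 2)).
    rewrite mulr_sumr; apply: ler_sum => t _; rewrite -exprMn.
    rewrite lerXn2r ?nnegrE ?enorm_ge0 ?(enorm_phi sys)//.
    by rewrite mulr_ge0 ?enorm_ge0// ltW// (sys_L sys).
  have k2 : 0 < kap ^+ 2 by rewrite exprn_gt0// (kap_gt0 sys).
  have -> : 3 * (K2 * T%:R) = L ^+ 2 * (V * (3 * T%:R) / kap ^+ 2) by ring.
  by rewrite ler_wpM2l ?sqr_ge0// ler_pdivlMr// mulrC.
have W24 : expR (- 24) <= W om.
  rewrite /W /centered_weight ler_expR lerN2 grad_scale_sqr.
  have e24 (z : R) : 0 < z -> 8 * z^-1 * (3 * z) = 24 by move=> z0; field; rewrite gt_eqF.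
  rewrite -[leRHS](e24 _ KT0); apply: ler_wpM2l => //.
  by apply: mulr_ge0 => //; rewrite invr_ge0 ltW.
have chN : ch (N om) < expR 24 * (1 / eps).
  rewrite -ltr_pdivrMl ?expR_gt0// -expRN; apply: le_lt_trans h.
  by rewrite ler_wpM2r ?ch_ge0.
apply: (lt_le_trans (ch_lt_ln chN)).
have -> : 2 * (expR 24 * (1 / eps)) = expR 24 * (2 / eps) by ring.
by rewrite lnM ?posrE ?expR_gt0 ?divr_gt0// expRK.
Qed.

Lemma drift_event (B : 'M[R]_(m, n)) (c : nat -> R) (eps : R) :
  (forall v, phi v = B *m v) -> opnorm B <= L ->
  (forall t k, (\int[P]_om (w t om k ord0)%:E = 0)%E) ->
  (forall t, `|c t| <= mu) -> 0 < eps ->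
  with_probability_ge P (1 - eps) [set om |
    grad_scale * enorm (\sum_(0 <= t < T) c t *: phi (x t om)) < 4 * expR 1 + ln (2 / eps)].
Proof.
move=> phiB BL wm cb e0; have g0 := grad_scale_gt0.
have T0 : (0 : R) < T%:R by rewrite ltr0n ltnW.
have alphaE : 2 * (grad_scale * (mu * L / kap)) ^+ 2 * V = 2 / T%:R.
  have -> : 2 * (grad_scale * (mu * L / kap)) ^+ 2 * V = 2 * ((grad_scale * mu) ^+ 2 * K2).
    by field; rewrite (gt_eqF (kap_gt0 sys)).
  rewrite grad_scale_sqr invfM mulrAC mulVf ?mul1r//.
  by rewrite gt_eqF// (K2_gt0 sys).
have alpha1 : 2 * (grad_scale * (mu * L / kap)) ^+ 2 * V <= 1.
  by rewrite alphaE ler_pdivrMr// mul1r ler_nat.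
have int := drift_exp sys phiB BL wm cb mu0 g0 alpha1 (leqnn T).
pose N om := nrm (fun j => drift_sum (T := T) phi A x B c grad_scale T j om).
have NE om : N om = grad_scale * enorm (\sum_(0 <= t < T) c t *: phi (x t om)).
  rewrite enormE -[grad_scale in RHS](gtr0_norm g0) -nrmZ; apply: nrm_eq => j.
  rewrite /drift_sum subnn /= mul0mx mxE addr0 summxE; congr (_ * _).
  by apply: eq_bigr => t _; rewrite mxE.
have mN : measurable_fun setT N.
  rewrite (_ : N = fun om => grad_scale * enorm (\sum_(0 <= t < T) c t *: phi (x t om))); last first.
    by apply/funext => om; exact: NE.
  apply: measurable_funM => //; apply: measurable_enorm_comp; apply: measurable_mx => j k.
  under eq_fun do rewrite summxE; apply: measurable_sum => t.
  under eq_fun do rewrite mxE; apply: measurable_funM => //; apply: measurable_entry_comp.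
  exact: (measurableT_comp (measurable_phi sys) (measurable_x x t)).
have f0 om : 0 <= ch (N om) by exact: ch_ge0.
have growth : drift_growth A L sigma mu grad_scale ^+ T.+1 <= expR (4 * expR 1).
  have e1 : 1 <= expR 1 :> R by rewrite -[leLHS]expR0 ler_expR.
  have -> : drift_growth A L sigma mu grad_scale = 1 + 2 / T%:R * (expR 1 - 1).
    by rewrite /drift_growth alphaE; ring.
  have y0 : 0 <= 2 / T%:R * (expR 1 - 1) :> R by rewrite mulr_ge0 ?divr_ge0// subr_ge0.
  apply: (@le_trans _ _ (expR (2 / T%:R * (expR 1 - 1)) ^+ T.+1)).
    rewrite lerXn2r ?nnegrE ?expR_ge0 ?expR_ge1Dx// addr_ge0//.
  rewrite -expRM_natl ler_expR.
  have -> : T.+1%:R * (2 / T%:R * (expR 1 - 1)) = 2 * (T.+1%:R / T%:R) * (expR 1 - 1) :> R by ring.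
  apply: (@le_trans _ _ (2 * 2 * (expR 1 - 1))); last by lra.
  apply: ler_wpM2r; first by rewrite subr_ge0.
  by rewrite ler_wpM2l// ler_pdivrMr// -natrM ler_nat mul2n -addnn -addn1 leq_add2l ltnW.
have int' := le_trans int (_ : _ <= (expR (4 * expR 1))%:E)%E.
have := wp_markov_scaled (expR_gt0 (4 * expR 1)) e0 (measurable_ch_comp mN) f0 (int' _).
rewrite lee_fin => /(_ growth); apply: wp_sub => om /= h.
rewrite -NE; apply: (lt_le_trans (ch_lt_ln h)).
have -> : 2 * (expR (4 * expR 1) / eps) = expR (4 * expR 1) * (2 / eps) by ring.
by rewrite lnM ?posrE ?expR_gt0 ?divr_gt0// expRK.
Qed.

Lemma excitation_event (eta : R) (p : nat -> R) (M : nat -> Omega -> 'M[R]_m) (J : nat) (eps : R) :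
  0 < eta -> eta <= 4^-1 ->
  (forall t, (\int[P]_om (\1_(small_noise mu i) (w t om) : R)%:E = (p t)%:E)%E) ->
  (forall t, 0 <= p t <= 1) ->
  (forall j, (j.*2.+1 < T)%N -> forall a b,
    is_cond_expectation P (natural_filtration x j.*2)
      (fun om => (phi (x j.*2.+1 om) *m (phi (x j.*2.+1 om))^T) a b)
      (fun om => M j om a b)) ->
  (J.*2 <= T)%N -> 0 < eps ->
  with_probability_ge P (1 - eps) [set om |
    nrm (fun ab => excitation_sum phi A x w L sigma mu eta i p M J ab om) <
    growth_const * eta ^+ 2 * T%:R + ln (2 / eps)].
Proof.
move=> eta0 eta1 pm p01 hM JT e0.
have int := excitation_exp sys eta0 eta1 pm p01 hM JT.
pose N om := nrm (fun ab => excitation_sum phi A x w L sigma mu eta i p M J ab om).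
have mN : measurable_fun setT N.
  apply: measurable_nrm => ab.
  rewrite (_ : excitation_sum _ _ _ _ _ _ _ _ _ _ _ J ab =
    (fun om => \sum_(s < J) excitation_increment phi A x w L sigma mu eta i p M s ab om)).
    apply: measurable_sum => s.
    have sT : (s.*2.+1 < T)%N by apply: leq_trans JT; rewrite -doubleS leq_double ltn_ord.
    exact/measurable_EFinP/(measurable_int P (excitation_increment_integrable A w L sigma mu eta i p01 hM ab sT)).
  by apply/funext => om; rewrite /excitation_sum big_mkord.
have f0 om : 0 <= ch (N om) by exact: ch_ge0.
have growth : excitation_growth eta ^+ J <= expR (growth_const * eta ^+ 2 * T%:R).
  have y0 : 0 <= growth_const * eta ^+ 2 :> R by rewrite mulr_ge0 ?sqr_ge0// ltW// growth_const_gt0.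
  rewrite /excitation_growth -/growth_const.
  apply: (@le_trans _ _ (expR (growth_const * eta ^+ 2) ^+ J)).
    by rewrite lerXn2r ?nnegrE ?expR_ge0 ?expR_ge1Dx// addr_ge0.
  rewrite -expRM_natl ler_expR mulrC; apply: ler_wpM2l => //.
  by rewrite ler_nat; apply: leq_trans JT; rewrite -addnn leq_addr.
have int' := le_trans int (_ : _ <= (expR (growth_const * eta ^+ 2 * T%:R))%:E)%E.
have := wp_markov_scaled (expR_gt0 (growth_const * eta ^+ 2 * T%:R)) e0 (measurable_ch_comp mN) f0 (int' _).
rewrite lee_fin => /(_ growth); apply: wp_sub => om /= h.
rewrite -/(N om); apply: (lt_le_trans (ch_lt_ln h)).
move: (growth_const * _ * _) => z.
have -> : 2 * (expR z / eps) = expR z * (2 / eps) by ring.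
by rewrite lnM ?posrE ?expR_gt0 ?divr_gt0// expRK.
Qed.

Section bound_on_good_event.
Variables (c0 Q ellm Lam delta : R) (om : Omega).
Hypothesis c0_gt0 : 0 < c0.
Hypothesis reg : sample_regime c0 T%:R Q ell ellm Lam delta.
Hypothesis q0 : 0 < q.
Hypothesis lambda0 : 0 < lambda.
Hypothesis QE : Q = K2 ^+ 2 / (q * lambda ^+ 2) ^+ 2.
Local Notation l2 := (lambda ^+ 2).

Definition grad_bound : R := grad_const c0 * (mu * Num.sqrt (K2 * T%:R) * ell).

Definition error_radius : R :=
  error_const c0 * (mu * Num.sqrt K2 * ell / (Num.sqrt T%:R * (q * l2))).

Definition curvature : R := q * l2 * T%:R / 8.

(** Balances the two parts of the fluctuation bound: the growth contributes
    [q * l2 * T / 16], and the logarithm at most as much once [T] is large. *)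
Definition excitation_scale : R := q * l2 / (16 * K2 * growth_const).

Lemma excitation_scale_gt0 : 0 < excitation_scale.
Proof.
have g0 := @growth_const_gt0 R; have K0 := K2_gt0 sys.
have n16 : (0 : R) < 16 by rewrite ltr0n.
exact: (divr_gt0 (mulr_gt0 q0 (exprn_gt0 2 lambda0)) (mulr_gt0 (mulr_gt0 n16 K0) g0)).
Qed.

Lemma grad_bound_event (c : nat -> R) :
  grad_scale * enorm (\sum_(0 <= t < T) (clip mu (w t om i ord0) - c t) *: phi (x t om))
    < 24 + log_const c0 * ell ->
  grad_scale * enorm (\sum_(0 <= t < T) c t *: phi (x t om)) < 4 * expR 1 + log_const c0 * ell ->
  enorm (\sum_(0 <= t < T) clip mu (w t om i ord0) *: phi (x t om)) <= grad_bound.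
Proof.
move=> h1 h2; have g0 := grad_scale_gt0.
have -> : \sum_(0 <= t < T) clip mu (w t om i ord0) *: phi (x t om) =
  \sum_(0 <= t < T) (clip mu (w t om i ord0) - c t) *: phi (x t om) +
  \sum_(0 <= t < T) c t *: phi (x t om).
  by rewrite -big_split/=; apply: eq_bigr => t _; rewrite -scalerDl subrK.
apply: (le_trans (enormD _ _)).
set G1 := enorm _ in h1 *; set G2 := enorm _ in h2 *.
have lc : c0 <= ell := regime_ell reg.
have e1 : 1 <= ell / c0 by rewrite ler_pdivlMr// mul1r.
have h3 : grad_scale * (G1 + G2) <= grad_const c0 * ell.
  have -> : grad_const c0 * ell = (24 + 4 * expR 1) * (ell / c0) + 2 * (log_const c0 * ell).
    by rewrite /grad_const; ring.
  have h4 : 24 + 4 * expR 1 <= (24 + 4 * expR 1) * (ell / c0).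
    by rewrite ler_peMr// addr_ge0// mulr_ge0// expR_ge0.
  rewrite mulrDr; move: (grad_scale * G1) (grad_scale * G2) (log_const c0 * ell) h1 h2 => a b z.
  by move: ((24 + 4 * expR 1) * (ell / c0)) (4 * expR 1) h4 => y u; lra.
have -> : grad_bound = grad_const c0 * ell / grad_scale.
  by rewrite /grad_bound /grad_scale invrK; ring.
by rewrite ler_pdivlMr// mulrC.
Qed.

(** Each time that is not moderate uses up a share [24 * V / kap ^+ 2] of the energy,
    so that there are at most [T / 8] of them among the [T./2] even times. *)
Lemma moderate_count : 4 <= T%:R :> R ->
  kap ^+ 2 * \sum_(0 <= t < T) enorm (x t om) ^+ 2 <= V * (3 * T%:R) ->
  T%:R / 4 <= \sum_(0 <= j < T./2) (\1_(moderate A x L sigma j) om : R).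
Proof.
move=> T4 en.
have k2 : 0 < kap ^+ 2 by rewrite exprn_gt0// (kap_gt0 sys).
have v0 := V_gt0 sys.
have JT : (T./2.*2 <= T)%N by rewrite -{2}(odd_double_half T) leq_addl.
have JT2 : (T <= T./2.*2.+1)%N by rewrite -{1}(odd_double_half T) -add1n leq_add2r; case: odd.
have h1 : \sum_(0 <= j < T./2) (1 - (\1_(moderate A x L sigma j) om : R)) * (24 * V / kap ^+ 2) <=
    3 * (V * T%:R / kap ^+ 2).
  apply: (@le_trans _ _ (\sum_(0 <= t < T) enorm (x t om) ^+ 2)).
    have := sum_even_le JT (fun t => sqr_ge0 (enorm (x t om))).
    apply: le_trans; apply: ler_sum => j _; rewrite indicE.
    have [mo|mo] := boolP (om \in moderate A x L sigma j).
      by rewrite subrr mul0r sqr_ge0.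
    rewrite subr0 mul1r ltW// ltNge; apply/negP => le; move: mo; rewrite notin_setE; exact.
  have -> : 3 * (V * T%:R / kap ^+ 2) = (kap ^+ 2)^-1 * (V * (3 * T%:R)) by ring.
  by rewrite ler_pdivlMl.
have h2 : \sum_(0 <= j < T./2) (1 - (\1_(moderate A x L sigma j) om : R)) <= T%:R / 8.
  have b0 : 0 < 24 * V / kap ^+ 2 by rewrite divr_gt0// mulr_gt0.
  rewrite -(ler_pM2r b0) mulr_suml; apply: (le_trans h1).
  by rewrite le_eqVlt; apply/orP; left; apply/eqP; field; rewrite (gt_eqF (kap_gt0 sys)).
move: h2; rewrite sumrB sumr_const_nat subn0.
have : T%:R <= 2 * (T./2)%:R + 1 :> R.
  by rewrite -natrM -[X in _ + X]/(1%:R) -natrD ler_nat mul2n addn1.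
move: (\sum_(_ <= _ < _) _) => S; lra.
Qed.

Lemma curvature_event (p : nat -> R) (M : nat -> Omega -> 'M[R]_m) :
  kap ^+ 2 * \sum_(0 <= t < T) enorm (x t om) ^+ 2 <= V * (3 * T%:R) ->
  (forall t, q <= p t <= 1) ->
  (forall j, (j < T./2)%N -> loewner_le (l2%:M) (M j om)) ->
  nrm (fun ab => excitation_sum phi A x w L sigma mu excitation_scale i p M T./2 ab om) <
    growth_const * excitation_scale ^+ 2 * T%:R + log_const c0 * ell ->
  forall v : 'cV[R]_m, curvature * enorm v ^+ 2 <=
    \sum_(0 <= t < T) (`|w t om i ord0| <= mu / 2)%R%:R * (v^T *m phi (x t om)) ord0 ord0 ^+ 2.
Proof.
move=> en pq hM hN v.
have T4 := sample_ge4 c0_gt0 reg.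
have growth := sample_ge_growth c0_gt0 reg.
have p01 t : 0 <= p t <= 1.
  by have /andP[h ->] := pq t; rewrite andbT (le_trans _ h)// ltW.
have JT : (T./2.*2 <= T)%N by rewrite -{2}(odd_double_half T) leq_addl.
have lower := excitation_lower sys mu i excitation_scale_gt0 p01 v hM.
have K0 := K2_gt0 sys.
have ql0 : 0 < q * l2 by rewrite mulr_gt0// exprn_gt0.
have fluct : K2 / excitation_scale *
    nrm (fun ab => excitation_sum phi A x w L sigma mu excitation_scale i p M T./2 ab om) <=
    q * l2 * T%:R / 8.
  have ks0 : 0 < K2 / excitation_scale by exact: divr_gt0 K0 excitation_scale_gt0.
  apply: (le_trans (ler_wpM2l (ltW ks0) (ltW hN))).
  have es0 := excitation_scale_gt0.
  rewrite /excitation_scale in es0 *.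
  have G0 := @growth_const_gt0 R; move: growth; rewrite QE.
  move: growth_const G0 es0 => G G0 es0.
  move: (log_const c0 * ell) (T%:R) (q * l2) (K2) ql0 K0 es0 => z TT u k u0 k0 es0 gr.
  have -> : k / (u / (16 * k * G)) * (G * (u / (16 * k * G)) ^+ 2 * TT + z) =
     u * TT / 16 + u / 16 * (256 * G * (k ^+ 2 / u ^+ 2 * z)).
    by field; rewrite !gt_eqF.
  have := ler_wpM2l (ltW (divr_gt0 u0 (ltr0n _ 16))) gr.
  lra.
have count := moderate_count T4 en.
have v0 : 0 <= enorm v ^+ 2 by exact: sqr_ge0.
have main : q * l2 * T%:R / 4 * enorm v ^+ 2 <= \sum_(0 <= j < T./2)
   \1_(moderate A x L sigma j) om * (p j.*2.+1 * (l2 * enorm v ^+ 2)).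
  apply: (@le_trans _ _ (\sum_(0 <= j < T./2) \1_(moderate A x L sigma j) om * (q * (l2 * enorm v ^+ 2)))).
    rewrite -mulr_suml.
    have -> : q * l2 * T%:R / 4 * enorm v ^+ 2 = T%:R / 4 * (q * (l2 * enorm v ^+ 2)) by field.
    by apply: ler_wpM2r => //; rewrite mulr_ge0 ?(ltW q0)// mulr_ge0// sqr_ge0.
  apply: ler_sum => j _; apply: ler_wpM2l; first by rewrite indicE.
  by apply: ler_wpM2r; [rewrite mulr_ge0// sqr_ge0|have /andP[] := pq j.*2.+1].
have odd_le : \sum_(0 <= j < T./2) \1_(small_noise mu i) (w j.*2.+1 om) *
    (v^T *m phi (x j.*2.+1 om)) ord0 ord0 ^+ 2 <=
  \sum_(0 <= t < T) (`|w t om i ord0| <= mu / 2)%R%:R * (v^T *m phi (x t om)) ord0 ord0 ^+ 2.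
  pose F t : R := (`|w t om i ord0| <= mu / 2)%R%:R * (v^T *m phi (x t om)) ord0 ord0 ^+ 2.
  have F0 t : 0 <= F t by rewrite mulr_ge0 ?sqr_ge0.
  apply: le_trans (sum_odd_le JT F0); apply: ler_sum => j _; rewrite /F.
  rewrite indicE; have -> : (w j.*2.+1 om \in small_noise mu i) = (`|w j.*2.+1 om i ord0| <= mu / 2) => //.
  by apply/idP/idP; rewrite inE.
apply: le_trans odd_le; rewrite /curvature.
have f2 := ler_wpM2r v0 fluct.
move: lower main f2; move: (\sum_(_ <= _ < _) _) => S1; move: (\sum_(_ <= _ < _) _) => S2; move: (enorm v ^+ 2) => v2.
move: (q * l2 * T%:R) => u; move: (K2 / excitation_scale * _) => N.
have -> : u / 4 * v2 = u * v2 / 4 by ring.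
have -> : u / 8 * v2 = u * v2 / 8 by ring.
move: (N * v2) (u * v2) => a b; lra.
Qed.

(** The radius decreases like [T^(-1/2)] and the features grow like the square root
    of a logarithm, so that for large [T] the curvature is available along the
    whole segment. *)
Lemma feature_radius t :
  enorm (phi (x t om)) ^+ 2 <= K2 * ln (8 * expR 1 * T%:R / delta) ->
  error_radius * enorm (phi (x t om)) <= mu / 2.
Proof.
move=> h; have big := sample_ge_max c0_gt0 reg.
have K0 := K2_gt0 sys; have T0 : (0 : R) < T%:R by rewrite ltr0n ltnW.
have ql0 : 0 < q * l2 by rewrite mulr_gt0// exprn_gt0.
have ec0 := error_const_gt0 c0_gt0.
have l0 : 0 < ell by have [] := regime_basic c0_gt0 reg.
have er0 : 0 <= error_radius.
  have h1 : 0 <= mu * Num.sqrt K2 * ell.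
    exact: (mulr_ge0 (mulr_ge0 (ltW mu0) (sqrtr_ge0 _)) (ltW l0)).
  have h2 : 0 <= Num.sqrt T%:R * (q * l2) by exact: (mulr_ge0 (sqrtr_ge0 _) (ltW ql0)).
  exact: (mulr_ge0 (ltW ec0) (divr_ge0 h1 h2)).
have lhs0 : 0 <= error_radius * enorm (phi (x t om)) := mulr_ge0 er0 (enorm_ge0 _).
have rhs0 : 0 <= mu / 2 by rewrite divr_ge0// ltW.
rewrite -(@ler_pXn2r _ 2) ?nnegrE//.
rewrite exprMn; apply: (le_trans (ler_wpM2l (sqr_ge0 _) h)).
have er2 : error_radius ^+ 2 = error_const c0 ^+ 2 * (mu ^+ 2 * K2 * ell ^+ 2 / (T%:R * (q * l2) ^+ 2)).
  rewrite /error_radius !exprMn exprVn !exprMn !sqr_sqrtr ?(ltW K0) ?(ltW T0)//.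
rewrite er2; move: big; rewrite QE /max_const.
move: (ln _) => z.
move: (error_const c0) (T%:R) (q * l2) (K2) T0 ql0 K0 => C TT u k TT0 u0 k0 big.
have -> : C ^+ 2 * (mu ^+ 2 * k * ell ^+ 2 / (TT * u ^+ 2)) * (k * z) =
  mu ^+ 2 / (4 * TT) * (4 * C ^+ 2 * (k ^+ 2 / u ^+ 2 * ell ^+ 2 * z)).
  by field; rewrite !gt_eqF.
have -> : (mu / 2) ^+ 2 = mu ^+ 2 / (4 * TT) * TT by field; rewrite gt_eqF.
have n4 : (0 : R) < 4 by rewrite ltr0n.
by apply: ler_wpM2l big; exact: (divr_ge0 (sqr_ge0 mu) (ltW (mulr_gt0 n4 TT0))).
Qed.

Lemma radius_beats_gradient : 2 * grad_bound < error_radius * curvature.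
Proof.
have K0 := K2_gt0 sys; have T0 : (0 : R) < T%:R by rewrite ltr0n ltnW.
have ql0 : 0 < q * l2 by rewrite mulr_gt0// exprn_gt0.
have l0 : 0 < ell by have [] := regime_basic c0_gt0 reg.
have sT0 : 0 < Num.sqrt T%:R :> R by rewrite sqrtr_gt0.
have sK0 : 0 < Num.sqrt K2 by rewrite sqrtr_gt0.
have gc0 := grad_const_gt0 c0_gt0.
have -> : error_radius * curvature = 17 / 8 * grad_bound.
  rewrite /error_radius /curvature /grad_bound /error_const (sqrtrM T%:R (ltW K0)).
  have TE := sqr_sqrtr (ltW T0); move: TE sT0.
  move: (Num.sqrt T%:R) (Num.sqrt K2) (grad_const c0) => s k g.
  move: (T%:R) => TT <- s0.
  move: (q * l2) ql0 => u u0.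
  by field; rewrite !gt_eqF.
have : 0 < grad_bound.
  by rewrite /grad_bound mulr_gt0// mulr_gt0// mulr_gt0// sqrtr_gt0 KT0.
by move: grad_bound => z; lra.
Qed.

End bound_on_good_event.
End row.
End estimation.

(** * Identification of the rows *)

Section identification.
Context {d} {Omega : measurableType d} {R : realType}.
Variable P : probability Omega R.
Context {n m T : nat}.
Variables (phi : 'cV[R]_n -> 'cV[R]_m) (A : 'M[R]_(n, m)).
Variables (x w : nat -> {RV P >-> 'cV[R]_n}) (L sigma : R).
Hypothesis sys : stable_system T phi A x w L sigma.

Local Notation kap := (1 - opnorm A * L).
Local Notation V := (n%:R * sigma ^+ 2).
Local Notation K2 := (L ^+ 2 * V / kap ^+ 2).

Variable mu : R.
Hypothesis mu0 : 0 < mu.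

Definition clip_mean (i : 'I_n) t : R := fine (\int[P]_om (clip mu (w t om i ord0))%:E)%E.

Lemma clip_meanE i t : (\int[P]_om (clip mu (w t om i ord0))%:E = (clip_mean i t)%:E)%E.
Proof. by rewrite fineK// integrable_fin_num//; exact: (clip_integrable w i mu0 t). Qed.

Lemma clip_mean_bound i t : `|clip_mean i t| <= mu.
Proof.
have ic := clip_integrable w i mu0 t.
have icst (c : R) : P.-integrable setT (EFin \o (fun=> c)) by exact: integrable_cst_real.
have cst (c : R) : (\int[P]_om c%:E = c%:E)%E.
  by rewrite integral_cst_on// probability_setT mule1.
have bound om := clip_bound (w t om i ord0) mu0.
rewrite ler_norml -2!lee_fin -clip_meanE -(cst (- mu)) -[X in _ && (_ <= X)%E]cst.
apply/andP; split.
  apply: (ae_le_integral measurableT (icst _) ic); apply: aeW => om.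
  by have := bound om; rewrite ler_norml => /andP[].
apply: (ae_le_integral measurableT ic (icst _)); apply: aeW => om.
by have := bound om; rewrite ler_norml => /andP[].
Qed.

(** The clipping function is odd, so that its mean vanishes under a symmetric law. *)
Lemma clip_mean_symmetric i t : symmetric_distribution P (w t) -> clip_mean i t = 0.
Proof.
move=> sym.
have ic := clip_integrable w i mu0 t.
have icst (c : R) : P.-integrable setT (EFin \o (fun=> c)) by exact: integrable_cst_real.
have cst (c : R) : (\int[P]_om c%:E = c%:E)%E.
  by rewrite integral_cst_on// probability_setT mule1.
have pos (v : 'cV[R]_n) : 0 <= clip mu (v i ord0) + mu.
  by have := clip_bound (v i ord0) mu0; rewrite ler_norml -subr_ge0 opprK => /andP[].
have mf : measurable_fun setT (fun v : 'cV[R]_n => clip mu (v i ord0) + mu).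
  by apply: measurable_funD => //; exact: measurable_clip.
have := eq_law_integral (measurable_w w t) (measurable_oppmx (measurable_w w t)) sym mf pos.
have -> : (\int[P]_om (clip mu (w t om i ord0) + mu)%:E = (clip_mean i t)%:E + mu%:E)%E.
  by under eq_integral do rewrite EFinD; rewrite integralD_EFin// clip_meanE cst.
have -> : (\int[P]_om (clip mu ((- w t om) i ord0) + mu)%:E = (- clip_mean i t)%:E + mu%:E)%E.
  under eq_integral do rewrite mxE clipN// addrC EFinB.
  by rewrite integralB_EFin// clip_meanE cst addeC EFinN.
rewrite -!EFinD => -[]; lra.
Qed.

Definition small_noise_prob (i : 'I_n) t : R := fine (P (w t @^-1` small_noise mu i)).

Lemma measurable_small_noise_event i t : measurable (w t @^-1` small_noise mu i).
Proof.
rewrite (_ : _ @^-1` _ = [set om | `|w t om i ord0| \in `]-oo, mu / 2]]).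
  have mf : measurable_fun setT (fun om => `|w t om i ord0|).
    by apply: measurableT_comp => //; apply: measurable_entry_comp; exact: measurable_w.
  by have := mf measurableT `]-oo, mu / 2]%classic (measurable_itv _); rewrite setTI.
by apply/seteqP; split => om /=; rewrite in_itv.
Qed.

Lemma small_noise_prob_fin i t : (small_noise_prob i t)%:E = P (w t @^-1` small_noise mu i).
Proof. by rewrite fineK// fin_num_measure//; exact: measurable_small_noise_event. Qed.

Lemma small_noise_probE i t :
  (\int[P]_om (\1_(small_noise mu i) (w t om) : R)%:E = (small_noise_prob i t)%:E)%E.
Proof.
rewrite small_noise_prob_fin -[in RHS](setIT (w t @^-1` _)).
rewrite -integral_indic//; exact: measurable_small_noise_event.
Qed.

Lemma small_noise_prob_bound q i t :
  (q%:E <= P [set om | (`|w t om i ord0| <= mu / 2)%R])%E -> q <= small_noise_prob i t <= 1.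
Proof.
move=> h; rewrite -2!lee_fin small_noise_prob_fin h/=.
exact: (probability_le1 P (measurable_small_noise_event i t)).
Qed.

End identification.

(** * The error of the minimizer *)

Section row_errors.
Context {d} {Omega : measurableType d} {R : realType}.
Variable P : probability Omega R.
Context {n m T : nat}.
Variables (phi : 'cV[R]_n -> 'cV[R]_m) (A : 'M[R]_(n, m)).
Variables (x w : nat -> {RV P >-> 'cV[R]_n}) (L sigma : R).
Hypothesis sys : stable_system T phi A x w L sigma.

Local Notation kap := (1 - opnorm A * L).
Local Notation V := (n%:R * sigma ^+ 2).
Local Notation K2 := (L ^+ 2 * V / kap ^+ 2).

Variables (mu q lambda c0 Q ell ellm Lam delta : R).
Hypothesis mu0 : 0 < mu.
Hypothesis c0_gt0 : 0 < c0.
Hypothesis reg : sample_regime c0 T%:R Q ell ellm Lam delta.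
Hypothesis q0 : 0 < q.
Hypothesis lambda0 : 0 < lambda.
Hypothesis QE : Q = K2 ^+ 2 / (q * lambda ^+ 2) ^+ 2.
Local Notation l2 := (lambda ^+ 2).
Local Notation eta := (excitation_scale A L sigma q lambda).
Local Notation radius := (error_radius (T := T) A L sigma mu q lambda ell c0).
Local Notation scale := (grad_scale (T := T) A L sigma mu).

Let T2 : (2 <= T)%N.
Proof.
have := sample_ge4 c0_gt0 reg; rewrite ler_nat; exact: leq_trans.
Qed.

Lemma error_radius_gt0 : 0 < radius.
Proof.
have K0 := K2_gt0 sys; have T0 : (0 : R) < T%:R by rewrite ltr0n ltnW.
have ql0 : 0 < q * l2 by rewrite mulr_gt0// exprn_gt0.
have l0 : 0 < ell by have [] := regime_basic c0_gt0 reg.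
have sT0 : 0 < Num.sqrt T%:R :> R by rewrite sqrtr_gt0.
have sK0 : 0 < Num.sqrt K2 by rewrite sqrtr_gt0.
have num0 := mulr_gt0 (mulr_gt0 mu0 sK0) l0.
exact: mulr_gt0 (error_const_gt0 c0_gt0) (divr_gt0 num0 (mulr_gt0 sT0 ql0)).
Qed.

(** [huber_error] on the intersection of all events. *)
Lemma row_error (a : 'I_n -> 'cV[R]_m) (i : 'I_n) om (c p : nat -> R)
    (M : nat -> Omega -> 'M[R]_m) :
  huber_minimizer T mu phi (fun t => x t om) a ->
  kap ^+ 2 * \sum_(0 <= t < T) enorm (x t om) ^+ 2 <= V * (3 * T%:R) ->
  (forall t, (t < T)%N -> enorm (phi (x t om)) ^+ 2 <= K2 * ln (8 * expR 1 * T%:R / delta)) ->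
  scale * enorm (\sum_(0 <= t < T) (clip mu (w t om i ord0) - c t) *: phi (x t om))
    < 24 + log_const c0 * ell ->
  scale * enorm (\sum_(0 <= t < T) c t *: phi (x t om)) < 4 * expR 1 + log_const c0 * ell ->
  (forall t, q <= p t <= 1) ->
  (forall j, (j < T./2)%N -> loewner_le (l2%:M) (M j om)) ->
  nrm (fun ab => excitation_sum phi A x w L sigma mu eta i p M T./2 ab om) <
    growth_const * eta ^+ 2 * T%:R + log_const c0 * ell ->
  enorm ((row i A)^T - a i) <= radius.
Proof.
move=> hmin en feat cen dri pq hM fluct.
rewrite -opprB -scaleN1r enormZ normrN1 mul1r.
apply: (huber_error (T := T) (w := fun t => w t om i ord0) (f := fun t => phi (x t om)) mu0 error_radius_gt0).
- have prodE t : (A *m phi (x t om)) i ord0 = ((row i A)^T^T *m phi (x t om)) ord0 ord0.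
    by rewrite trmxK -row_mul [in RHS]mxE.
  have stepE t : (t < T)%N -> x t.+1 om i ord0 = (A *m phi (x t om)) i ord0 + w t om i ord0.
    by move=> tT; rewrite (sys_dyn sys)// mxE.
  have -> : \sum_(0 <= t < T) huber mu (w t om i ord0 - ((a i - (row i A)^T)^T *m phi (x t om)) ord0 ord0)
      = \sum_(0 <= t < T) huber mu (x t.+1 om i ord0 - ((a i)^T *m phi (x t om)) ord0 ord0).
    apply: eq_big_nat => t /andP[_ tT]; rewrite stepE// prodE; congr huber.
    by rewrite linearB mulmxBl [in LHS]mxE [X in _ - (_ + X)]mxE; ring.
  have -> : \sum_(0 <= t < T) huber mu (w t om i ord0) =
      \sum_(0 <= t < T) huber mu (x t.+1 om i ord0 - ((row i A)^T^T *m phi (x t om)) ord0 ord0).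
    by apply: eq_big_nat => t /andP[_ tT]; rewrite stepE// prodE addrC addKr.
  exact: huber_minimizer_row hmin.
- exact: (grad_bound_event sys mu0 T2 c0_gt0 reg cen dri).
- exact: (curvature_event sys c0_gt0 reg q0 lambda0 QE en pq hM fluct).
- by move=> t tT; exact: (feature_radius sys mu0 T2 c0_gt0 reg q0 lambda0 QE (feat t tT)).
- exact: (radius_beats_gradient sys mu0 T2 c0_gt0 reg q0 lambda0).
Qed.

Hypothesis ellE : ell = ln (n%:R / delta).

(** The factor [C <= 16] comes from sharing out the probability [delta] among the
    events. *)
Lemma log_absorbed (C k : R) : 0 < C -> C <= 16 -> 1 <= k -> k <= n%:R ->
  ln (C * k / delta) <= log_const c0 * ell.
Proof.
move=> C0 C16 k1 kn.
have d0 := regime_delta reg; have k0 : 0 < k by lra.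
have n0 : (0 : R) < n%:R by lra.
have cd : 0 < C * k / delta by rewrite divr_gt0// mulr_gt0.
have h1 : ln (C * k / delta) <= ln 16 + ell.
  rewrite ellE -lnM ?posrE ?divr_gt0// ler_ln ?posrE//; last by rewrite mulr_gt0// divr_gt0.
  by rewrite mulrA ler_wpM2r ?invr_ge0 ?(ltW d0)// ler_pM// ltW.
apply: (le_trans h1); rewrite /log_const mulrDl mul1r addrC lerD2l.
have -> : ln 16 / c0 * ell = ln 16 * (ell / c0) by rewrite mulrAC mulrA.
rewrite ler_peMr ?ln_ge0 ?ler1n// ler_pdivlMr// mul1r; exact: regime_ell reg.
Qed.

(** The energy and the largest feature concern the whole trajectory; the two parts
    of the gradient and the excitation concern one row each. Events of the
    former kind fail with probability at most [delta / 8], those of the latter kind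
    with probability at most [delta / (8 * n)]. *)
Lemma rows_identified (ahat : Omega -> 'I_n -> 'cV[R]_m) (M : nat -> Omega -> 'M[R]_m) :
  (forall om, huber_minimizer T mu phi (fun t => x t om) (ahat om)) ->
  (forall j, (j.*2.+1 < T)%N -> forall a b,
    is_cond_expectation P (natural_filtration x j.*2)
      (fun om => (phi (x j.*2.+1 om) *m (phi (x j.*2.+1 om))^T) a b)
      (fun om => M j om a b)) ->
  (forall j, (j.*2.+1 < T)%N -> {ae P, forall om, loewner_le (l2%:M) (M j om)}) ->
  (forall t i, (q%:E <= P [set om | (`|w t om i ord0| <= mu / 2)%R])%E) ->
  (forall i, with_probability_ge P (1 - delta / (8 * n%:R)) [set om |
    scale * enorm (\sum_(0 <= t < T) clip_mean w mu i t *: phi (x t om))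
      < 4 * expR 1 + ln (2 / (delta / (8 * n%:R)))]) ->
  with_probability_ge P (1 - delta)
    [set om | forall i, enorm ((row i A)^T - ahat om i) <= radius].
Proof.
move=> hmin hM hl hq hdrift.
have d0 := regime_delta reg.
have n1 : (1 : R) <= n%:R by rewrite ler1n (sys_n sys).
have n0 : (0 : R) < n%:R by lra.
have T4 := sample_ge4 c0_gt0 reg; have Tlog := sample_ge_log c0_gt0 reg.
have e0 : 0 < delta / 8 by rewrite divr_gt0.
have r0 : 0 < delta / (8 * n%:R) by rewrite divr_gt0// mulr_gt0.
have logr : ln (2 / (delta / (8 * n%:R))) <= log_const c0 * ell.
  have -> : 2 / (delta / (8 * n%:R)) = 16 * n%:R / delta by field; rewrite (gt_eqF d0) (gt_eqF n0).
  exact: log_absorbed.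
have loge : ln (delta / 8)^-1 <= log_const c0 * ell.
  have -> : (delta / 8)^-1 = 8 * 1 / delta by field; rewrite (gt_eqF d0).
  by apply: log_absorbed => //; rewrite ler_nat.
have K0 := K2_gt0 sys; have ql0 : 0 < q * l2 by rewrite mulr_gt0// exprn_gt0.
have eta0 : 0 < eta by exact: (excitation_scale_gt0 sys q0 lambda0).
have ql_le : q * l2 <= K2.
  have := regime_Q reg; rewrite QE ler_pdivlMr ?exprn_gt0// mul1r.
  by rewrite ler_pXn2r// nnegrE ltW.
have eta4 : eta <= 4^-1.
  rewrite /excitation_scale; have G0 := @growth_const_gt0 R.
  have G1 : 1 <= growth_const :> R.
    rewrite /growth_const; have := @expR_ge1Dx R 26; lra.
  move: growth_const G0 G1 (q * l2) (K2) ql_le ql0 K0 => G G0 G1 u k uk u0 k0.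
  rewrite ler_pdivrMr ?mulr_gt0//.
  have : k * 1 <= k * G by rewrite ler_pM2l.
  have -> : 4^-1 * (16 * k * G) = 4 * (k * G) by field.
  move: (k * G) => z; lra.
have JT : (T./2.*2 <= T)%N by rewrite -{2}(odd_double_half T) leq_addl.
pose p i t := small_noise_prob w mu i t.
have pq i t : q <= p i t <= 1 by exact: small_noise_prob_bound.
have p01 i t : 0 <= p i t <= 1.
  by have /andP[h ->] := pq i t; rewrite andbT (le_trans _ h)// ltW.
have ev1 := energy_event sys e0.
have ev2 := feature_event sys e0 (ltnW T2).
have ev3 i := centered_event sys mu0 T2 (clip_meanE w mu0 i) (clip_mean_bound w mu0 i) r0.
have ev4 i := excitation_event sys eta0 eta4 (small_noise_probE w mu i) (p01 i) hM JT r0.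
have ev5 : {ae P, forall om, forall j, (j < T./2)%N -> loewner_le (l2%:M) (M j om)}.
  apply: ae_foralln => j.
  have [jT|jT] := boolP (j < T./2)%N; last by apply: aeW => om.
  have jT' : (j.*2.+1 < T)%N by apply: leq_trans JT; rewrite -doubleS leq_double.
  by apply: filterS (hl j jT').
have evr i := wp_and (ev3 i) (wp_and (ev4 i) (hdrift i)).
have total : 1 - delta <= 1 - (delta / 8 + delta / 8 + (0 + n%:R *
    (delta / (8 * n%:R) + (delta / (8 * n%:R) + delta / (8 * n%:R))))).
  have -> : n%:R * (delta / (8 * n%:R) + (delta / (8 * n%:R) + delta / (8 * n%:R))) = 3 * delta / 8.
    by field; rewrite (gt_eqF n0).
  lra.
apply: wp_sub (wp_le total (wp_and (wp_and ev1 ev2) (wp_and (wp_ae ev5) (wp_forall evr)))).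
move=> om [[en feat] [ae_om rows]] i /=.
have [cen [fluct dri]] := rows i.
have en' : kap ^+ 2 * \sum_(0 <= t < T) enorm (x t om) ^+ 2 <= V * (3 * T%:R).
  apply: (le_trans (ltW en)); apply: ler_wpM2l; first exact: ltW (V_gt0 sys).
  by rewrite -natr1; move: loge Tlog T4; move: (ln _) (log_const c0 * ell) (T%:R) => *; lra.
apply: (row_error (c := clip_mean w mu i) (p := p i) (M := M) (hmin om) en' _ _ _ (pq i) ae_om).
- move=> t tT; have := feat t tT.
  by have -> : expR 1 * T%:R / (delta / 8) = 8 * expR 1 * T%:R / delta by field; rewrite (gt_eqF d0).
- by apply: lt_le_trans (cen en') _; rewrite lerD2l.
- by apply: lt_le_trans dri _; rewrite lerD2l.
- by apply: lt_le_trans fluct _; rewrite lerD2l.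
Qed.

End row_errors.

(** * The parameters of the sample size *)

(** From [state_exp] and [expR 1 * y <= expR y]. *)
Lemma feature_second_moment {d} {Omega : measurableType d} {R : realType}
    (P : probability Omega R) (n m T : nat) (phi : 'cV[R]_n -> 'cV[R]_m)
    (A : 'M[R]_(n, m)) (x w : nat -> {RV P >-> 'cV[R]_n}) (L sigma : R) t :
  stable_system T phi A x w L sigma -> (t <= T)%N ->
  (\int[P]_om (enorm (phi (x t om)) ^+ 2)%:E <=
    (L ^+ 2 * (n%:R * sigma ^+ 2) / (1 - opnorm A * L) ^+ 2)%:E)%E.
Proof.
move=> sys tT; have K0 := K2_gt0 sys.
have L0 := sys_L sys; have k0 := kap_gt0 sys; have v0 := V_gt0 sys.
set K2 := (_ / _) in K0 *.
have n0 : n%:R != 0 :> R by rewrite pnatr_eq0 -lt0n (sys_n sys).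
pose y om := (1 - opnorm A * L) ^+ 2 / (n%:R * sigma ^+ 2) * enorm (x t om) ^+ 2.
have e1 := expR_gt0 (1 : R).
have bound om : enorm (phi (x t om)) ^+ 2 <= K2 / expR 1 * expR (y om).
  apply: (@le_trans _ _ (K2 * y om)).
    have -> : K2 * y om = (L * enorm (x t om)) ^+ 2.
      by rewrite /K2 /y; field; rewrite n0 (gt_eqF k0) (gt_eqF (sys_sigma sys)).
    by rewrite lerXn2r ?nnegrE ?enorm_ge0 ?(enorm_phi sys)// mulr_ge0 ?enorm_ge0// ltW.
  rewrite -(mulrA K2 (expR 1)^-1) ler_pM2l// ler_pdivlMl//; exact: expR1_mul_le.
have mx := measurable_x x t.
have m1 : measurable_fun setT (fun om => enorm (phi (x t om)) ^+ 2).
  by apply: measurable_funX; apply: measurable_enorm_comp; exact: (measurableT_comp (measurable_phi sys) mx).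
have m2 : measurable_fun setT (fun om => expR (y om)).
  apply: measurable_expR_comp; apply: measurable_funM => //.
  by apply: measurable_funX; exact: measurable_enorm_comp.
have c0 : 0 <= K2 / expR 1 by rewrite divr_ge0// ltW.
apply: (@le_trans _ _ (\int[P]_om (K2 / expR 1 * expR (y om))%:E)%E).
  apply: ge0_le_integral_real => //; first exact: measurable_funM.
  by move=> om; exact: sqr_ge0.
rewrite ge0_integralZl_on//.
apply: (@le_trans _ _ ((K2 / expR 1)%:E * (expR 1)%:E)%E).
  by rewrite lee_wpmul2l ?lee_fin//; exact: (state_exp sys).
by rewrite -EFinM divfK// gt_eqF.
Qed.

(** The trace of the matrix inequality. *)
Lemma excitation_le_features {d} {Omega : measurableType d} {R : realType}
    (P : probability Omega R) (m : nat) (G : set (set Omega))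
    (Y : Omega -> 'cV[R]_m) (c : R) :
  measurable_fun setT Y -> G setT -> cond_second_moment_ge P G Y c ->
  ((m%:R * c)%:E <= \int[P]_om (enorm (Y om) ^+ 2)%:E)%E.
Proof.
move=> mY GT hc.
under eq_integral do rewrite enormE sqr_nrm.
rewrite ge0_integral_sum_on//; last 2 first.
- by move=> a; apply: measurable_funX; exact: measurable_entry_comp.
- by move=> a om; exact: sqr_ge0.
apply: (@le_trans _ _ (\sum_(a < m) c%:E)%E).
  by rewrite sumEFin sumr_const card_ord mulr_natl.
by apply: lee_sum => a _; exact: cond_second_moment_coord hc.
Qed.

Section parameters.
Context {R : realType}.
Variables (n m : nat) (q lambda L sigma kap delta c0 : R).
Hypothesis n0 : (0 < n)%N.
Hypothesis m0 : (0 < m)%N.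
Hypothesis q01 : 0 < q <= 1.
Hypothesis lambda0 : 0 < lambda.
Hypothesis L0 : 0 < L.
Hypothesis sigma0 : 0 < sigma.
Hypothesis kap0 : 0 < kap.
Hypothesis delta01 : 0 < delta < 1.
Local Notation K2 := (L ^+ 2 * (n%:R * sigma ^+ 2) / kap ^+ 2).
Hypothesis K2_ge : m%:R * lambda ^+ 2 <= K2.
Hypothesis c0_le : c0 <= ln (n%:R / delta).
Local Notation X := (n%:R * L * sigma / (q * lambda * kap * delta)).
Local Notation Q := (K2 ^+ 2 / (q * lambda ^+ 2) ^+ 2).

(** Everything follows from [m%:R * lambda ^+ 2 <= K2] and [q * delta <= 1]: the
    square of the argument [X] of the last logarithm dominates [m * n / delta], and
    its fourth power dominates [Q]. *)
Lemma parameters_regime (T : R) :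
  time_const c0 * (Q * ln (m%:R * n%:R / delta) ^+ 2 * ln X) <= T ->
  sample_regime c0 T Q (ln (n%:R / delta)) (ln (m%:R * n%:R / delta)) (ln X) delta.
Proof.
move=> hT; have /andP[q0 q1] := q01; have /andP[d0 d1] := delta01.
have nr1 : (1 : R) <= n%:R by rewrite ler1n.
have mr1 : (1 : R) <= m%:R by rewrite ler1n.
have nr0 : (0 : R) < n%:R by lra.
have mr0 : (0 : R) < m%:R by lra.
have X0 : 0 < X by rewrite divr_gt0 ?mulr_gt0.
have l20 : 0 < lambda ^+ 2 by rewrite exprn_gt0.
(* The signal-to-excitation ratio dominates the dimension of the features. *)
have [D [DE Dm]] : exists D, D = K2 / lambda ^+ 2 /\ m%:R <= D.
  by exists (K2 / lambda ^+ 2); split; rewrite // ler_pdivlMr.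
have D1 : 1 <= D by exact: le_trans Dm.
have D0 : 0 < D by lra.
have qd0 : 0 < q * delta by rewrite mulr_gt0.
have qd1 : q * delta <= 1 by rewrite -[1]mulr1 ler_pM// ltW.
have qd_delta : q * delta <= delta by rewrite ler_piMl// ltW.
have qd_q : q * delta <= q by rewrite ler_piMr// ltW.
have X2E : X ^+ 2 = D * n%:R / (q * delta) ^+ 2.
  by rewrite DE; field; rewrite !gt_eqF.
have QE : Q = D ^+ 2 / q ^+ 2.
  by rewrite DE; field; rewrite !gt_eqF.
have Q1 : 1 <= Q.
  rewrite QE ler_pdivlMr ?exprn_gt0// mul1r lerXn2r ?nnegrE ?(ltW D0) ?(ltW q0)//.
  exact: le_trans D1.
have nd0 : 0 < n%:R / delta by rewrite divr_gt0.
have mnd0 : 0 < m%:R * n%:R / delta by rewrite divr_gt0// mulr_gt0.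
split => //.
- rewrite ler_ln ?posrE// ler_wpM2r ?invr_ge0 ?(ltW d0)//.
  by rewrite ler_peMl// ltW.
- have -> : 2 * ln X = ln (X ^+ 2) by rewrite lnXn// mulr_natl.
  rewrite ler_ln ?posrE ?exprn_gt0// X2E; apply: ler_pM.
  + by rewrite mulr_ge0// ltW.
  + by rewrite invr_ge0 ltW.
  + by rewrite ler_wpM2r// ltW.
  + rewrite lef_pV2 ?posrE ?exprn_gt0//.
    by rewrite expr2 -[leRHS]mul1r ler_pM ?(ltW qd0)//; exact: qd_delta.
- have -> : 4 * ln X = ln (X ^+ 4) by rewrite lnXn// mulr_natl.
  rewrite ler_ln ?posrE ?exprn_gt0//; last exact: lt_le_trans Q1.
  have -> : X ^+ 4 = (X ^+ 2) ^+ 2 by rewrite -exprM.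
  have -> : Q = (D / q) ^+ 2 by rewrite QE expr_div_n.
  have Dq0 : 0 <= D / q by rewrite divr_ge0// ltW.
  rewrite lerXn2r ?nnegrE ?sqr_ge0// X2E; apply: ler_pM => //.
  + exact: ltW.
  + by rewrite invr_ge0 ltW.
  + by rewrite ler_peMr// ltW.
  + rewrite lef_pV2 ?posrE ?exprn_gt0//.
    by rewrite expr2 -[leRHS]mul1r ler_pM ?(ltW qd0)//; exact: qd_q.
- rewrite ler_ln ?posrE ?invr_gt0// ler_peMl// invr_ge0; exact: ltW.
Qed.
End parameters.

(** Otherwise the features would vanish identically. *)
Lemma lipschitz_gt0 {d} {Omega : measurableType d} {R : realType}
    (P : probability Omega R) (n m : nat) (phi : 'cV[R]_n -> 'cV[R]_m)
    (G : set (set Omega)) (X : Omega -> 'cV[R]_n) (L c : R) :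
  (0 < m)%N -> elipschitz L phi -> phi 0 = 0 -> 0 < c -> G setT ->
  cond_second_moment_ge P G (fun om => phi (X om)) c -> 0 < L.
Proof.
move=> m0 lip phi0 c_gt0 GT hc; rewrite ltNge; apply/negP => L0.
have phiE v : phi v = 0.
  apply: enorm_eq0; apply/eqP; rewrite eq_le enorm_ge0 andbT.
  have := lip v 0; rewrite phi0 !subr0 => h; apply: (le_trans h).
  by rewrite mulr_le0_ge0// enorm_ge0.
have := cond_second_moment_coord (Ordinal m0) GT hc.
under eq_integral do rewrite phiE mxE expr0n.
by rewrite integral0 lee_fin leNgt c_gt0.
Qed.

(** For [n >= 2] the argument of the logarithm is at least 2; only for [n = 1] does
    the bound come from [delta0]. *)
Lemma log_floor {R : realType} (delta0 delta : R) n :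
  (0 < n)%N -> 0 < delta0 < 1 -> 0 < delta < 1 -> (n = 1%N -> delta <= delta0) ->
  Num.min (ln delta0^-1) (ln 2) <= ln (n%:R / delta).
Proof.
move=> n0 /andP[d00 d01] /andP[d0 d1] h.
have nr0 : (0 : R) < n%:R by rewrite ltr0n.
have [n1|n2] := leqP n 1.
  have nE : n = 1%N by apply/eqP; rewrite eqn_leq n1.
  rewrite nE mul1r ge_min; apply/orP; left.
  by rewrite ler_ln ?posrE ?invr_gt0// lef_pV2 ?posrE// h.
rewrite ge_min; apply/orP; right.
rewrite ler_ln ?posrE ?divr_gt0// ler_pdivlMr//.
apply: (@le_trans _ _ (2 * 1)); first by rewrite ler_pM2l// ltW.
by rewrite mulr1 ler_nat.
Qed.

(* [delta0] only concerns n = 1: there, log (n / delta) tends to 0 as delta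
   tends to 1, and no pair (C1, C2) works uniformly for all delta < 1. For
   n >= 2 the constants C1 and C2 are absolute and delta ranges over (0, 1). *)
Theorem theorem1 (R : realType) (delta0 : R) (hdelta0 : 0 < delta0 < 1) :
  exists C1 C2 : R, [/\ 0 < C1, 0 < C2 &
  forall (n m T : nat), (1 <= n)%N -> (1 <= m)%N -> (1 <= T)%N ->
  forall (d : measure_display) (Omega : measurableType d)
    (P : probability Omega R)
    (phi : 'cV[R]_n -> 'cV[R]_m) (Abar : 'M[R]_(n, m))
    (x w : nat -> {RV P >-> 'cV[R]_n}) (mu rho L sigma lambda q : R),
  (forall t, (t < T)%N -> forall om,
     x t.+1 om = Abar *m phi (x t om) + w t om) ->
  0 < mu ->
  (* stability *)
  rho = opnorm Abar -> elipschitz L phi -> phi 0 = 0 -> rho * L < 1 ->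
  (* sub-Gaussian disturbance *)
  0 < sigma ->
  (forall i : 'I_n,
     (psi2_norm P (fun om => x 0%N om i ord0) <= sigma%:E)%E) ->
  (forall t (i : 'I_n),
     cond_psi2_norm_le P (natural_filtration x t)
       (fun om => w t om i ord0) sigma) ->
  (* independent zero-mean noise: the family x_0, w_0, w_1, ... *)
  mutually_independent P
    (fun k : nat => if k is t.+1 then (w t : Omega -> 'cV[R]_n) else x 0%N) ->
  (forall t (i : 'I_n), ('E_P[fun om => w t om i ord0] = 0)%E) ->
  (forall i : 'I_n, ('E_P[fun om => x 0%N om i ord0] = 0)%E) ->
  (* expected excitation *)
  0 < lambda ->
  (forall t, (1 <= t <= T)%N ->
     cond_second_moment_ge P (natural_filtration x t.-1)
       (fun om => phi (x t om)) (lambda ^+ 2)) ->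
  0 < q ->
  (forall t (i : 'I_n),
     (q%:E <= P [set om | (`|w t om i ord0| <= mu / 2)%R])%E) ->
  (forall t, symmetric_distribution P (w t)) \/
  (exists Bbar : 'M[R]_(m, n),
     (forall v, phi v = Bbar *m v) /\ opnorm Bbar <= L) ->
  forall ahat : Omega -> 'I_n -> 'cV[R]_m,
  (forall om, huber_minimizer T mu phi (fun t => x t om) (ahat om)) ->
  forall delta : R, 0 < delta < 1 -> (n = 1%N -> delta <= delta0) ->
  C1 * (n%:R ^+ 2 * L ^+ 4 * sigma ^+ 4
          / (q ^+ 2 * lambda ^+ 4 * (1 - rho * L) ^+ 4)
        * ln (m%:R * n%:R / delta) ^+ 2
        * ln (n%:R * L * sigma / (q * lambda * (1 - rho * L) * delta)))
    <= T%:R ->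
  with_probability_ge P (1 - delta)
    [set om | forall i : 'I_n,
       enorm ((row i Abar)^T - ahat om i) <=
       C2 * (mu * Num.sqrt n%:R * L * sigma
               / (Num.sqrt T%:R * q * lambda ^+ 2 * (1 - rho * L))
             * ln (n%:R / delta))]].
Proof.
have /andP[d00 d01] := hdelta0.
pose c0 := Num.min (ln delta0^-1) (ln 2).
have c0_gt0 : 0 < c0.
  by rewrite lt_min ln_gt0 ?invf_gt1// ln_gt0// ltr1n.
exists (time_const c0), (error_const c0); split.
- exact: time_const_gt0.
- exact: error_const_gt0.
move=> n m T n0 m0 T0 d Omega P phi Abar x w mu rho L sigma lambda q dyn mu0 -> lip phi0
  contr sigma0 hx0 hw ind wmean _ lambda0 hexc q0 hq alt ahat hmin delta delta01 hdelta hT.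
have /andP[d0 d1] := delta01.
have GT : natural_filtration x 0 setT by exact: (@measurableT _ (g_sigma_algebraType (history x 0))).
have exc1 := hexc 1%N T0.
have L0 : 0 < L by exact: (lipschitz_gt0 m0 lip phi0 (exprn_gt0 2 lambda0) GT exc1).
have sys : stable_system T phi Abar x w L sigma by exact: StableSystem.
have kap0 := kap_gt0 sys.
set kap := 1 - opnorm Abar * L in kap0 hT *.
have K2_ge : m%:R * lambda ^+ 2 <= L ^+ 2 * (n%:R * sigma ^+ 2) / kap ^+ 2.
  rewrite -lee_fin; apply: le_trans (feature_second_moment sys T0).
  apply: (excitation_le_features _ GT exc1).
  exact: (measurableT_comp (measurable_phi sys) (measurable_x x 1)).
have q1 : 0 < q <= 1.
  rewrite q0/= -lee_fin; apply: (le_trans (hq 0%N (Ordinal n0))).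
  exact: (probability_le1 P (measurable_small_noise_event w mu (Ordinal n0) 0)).
have hc0 := log_floor n0 hdelta0 delta01 hdelta.
set Q := (L ^+ 2 * (n%:R * sigma ^+ 2) / kap ^+ 2) ^+ 2 / (q * lambda ^+ 2) ^+ 2.
have QE : n%:R ^+ 2 * L ^+ 4 * sigma ^+ 4 / (q ^+ 2 * lambda ^+ 4 * kap ^+ 4) = Q.
  by rewrite /Q; field; rewrite !gt_eqF.
rewrite QE in hT.
have reg := parameters_regime n0 m0 q1 lambda0 L0 sigma0 kap0 delta01 K2_ge hc0 hT.
have /choice[M hM] : forall j, exists Mj : Omega -> 'M[R]_m, (j.*2.+1 < T)%N ->
    (forall a b, is_cond_expectation P (natural_filtration x j.*2)
      (fun om => (phi (x j.*2.+1 om) *m (phi (x j.*2.+1 om))^T) a b) (fun om => Mj om a b)) /\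
    {ae P, forall om, loewner_le ((lambda ^+ 2)%:M) (Mj om)}.
  move=> j; have [jT|jT] := boolP (j.*2.+1 < T)%N; last by exists (fun=> 0).
  by have [|Mj h1 h2] := hexc j.*2.+1; [exact: ltnW|exists Mj].
have hM1 j (jT : (j.*2.+1 < T)%N) := proj1 (hM j jT).
have hM2 j (jT : (j.*2.+1 < T)%N) := proj2 (hM j jT).
have nr0 : (0 : R) < n%:R by rewrite ltr0n.
have r0 : 0 < delta / (8 * n%:R) by rewrite divr_gt0// mulr_gt0.
have T2 : (2 <= T)%N.
  by have := sample_ge4 c0_gt0 reg; rewrite ler_nat; exact: leq_trans.
have drift i : with_probability_ge P (1 - delta / (8 * n%:R)) [set om |
    grad_scale (T := T) Abar L sigma mu * enorm (\sum_(0 <= t < T) clip_mean w mu i t *: phi (x t om))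
      < 4 * expR 1 + ln (2 / (delta / (8 * n%:R)))].
  case: alt => [sym|[B [phiB BL]]]; last first.
    apply: (drift_event sys mu0 T2 phiB BL _ (clip_mean_bound w mu0 i) r0) => t k.
    by have := wmean t k; rewrite unlock.
  exists setT; split => //; first by rewrite probability_setT lee_fin gerBl ltW.
  move=> om _ /=; rewrite big1 => [|t _]; last by rewrite (clip_mean_symmetric mu0 i (sym t)) scale0r.
  rewrite enorm0 mulr0 ltr_wpDr ?mulr_gt0 ?expR_gt0//.
  apply: ln_ge0; rewrite ler_pdivlMr// mul1r ler_pdivrMr ?mulr_gt0//.
  have : (1 : R) <= n%:R by rewrite ler1n.
  lra.
have radiusE : error_radius (T := T) Abar L sigma mu q lambda (ln (n%:R / delta)) c0 =
    error_const c0 * (mu * Num.sqrt n%:R * L * sigma / (Num.sqrt T%:R * q * lambda ^+ 2 * kap) *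
      ln (n%:R / delta)).
  have -> : error_radius (T := T) Abar L sigma mu q lambda (ln (n%:R / delta)) c0 =
    error_const c0 * (mu * Num.sqrt (n%:R * (L * sigma / kap) ^+ 2) * ln (n%:R / delta) /
      (Num.sqrt T%:R * (q * lambda ^+ 2))).
    rewrite /error_radius; congr (_ * (_ * Num.sqrt _ * _ / _)).
    by rewrite /kap; field; rewrite gt_eqF.
  have v0 : 0 <= L * sigma / kap by rewrite divr_ge0 ?mulr_ge0// ltW.
  rewrite sqrtrM ?(ltW nr0)// sqrtr_sqr (ger0_norm v0).
  have sT : 0 < Num.sqrt T%:R :> R by rewrite sqrtr_gt0 ltr0n.
  move: (Num.sqrt T%:R) sT => s s0.
  by field; rewrite !gt_eqF.
rewrite -radiusE.
exact: (rows_identified sys mu0 c0_gt0 reg q0 lambda0 erefl erefl hmin hM1 hM2 (fun t i => hq t i) drift).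
Qed.
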